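(* Let $(\vec{\varepsilon}_0,\vec{\theta}_0)\in\Omega_1\times\Omega_2$ and assume all of the following. (a) All entries of $\Pi^{\vec{\varepsilon}_0}$ are strictly positive. (b) For all $y\in\mathcal{Y}$, $q^{\vec{\theta}_0}(z|y)>0$ for all $z\in\mathcal{Z}$. (c) There exists $r_2>0$ such that: for any $(y,z)\in\mathcal{Y}\times\mathcal{Z}$, $\vec{\theta}\mapsto q^{\vec{\theta}}(z|y)$ is (complex) analytic on $\mathbb{C}^{m_2}_{\vec{\theta}_0}(r_2)$; for any $y\in\mathcal{Y}$, $q^{\vec{\theta}}(z|y)$ is jointly continuous in $(z,\vec{\theta})$ on $\mathcal{Z}\times\mathbb{C}^{m_2}_{\vec{\theta}_0}(r_2)$; and the three integrals $$\int_{\mathcal{Z}}\breve{q}(z,r_2)\,dz,\qquad \int_{\mathcal{Z}}\breve{q}(z,r_2)\log\hat{q}(z,r_2)\,dz,\qquad \int_{\mathcal{Z}}\breve{q}(z,r_2)\log\breve{q}(z,r_2)\,dz$$ are all finite, where $\breve{q}(z,r_2)=\sup_{(y,\vec{\theta})\in\mathcal{Y}\times\mathbb{C}^{m_2}_{\vec{\theta}_0}(r_2)}|q^{\vec{\theta}}(z|y)|$ and $\hat{q}(z,r_2)=\inf_{(y,\vec{\theta})\in\mathcal{Y}\times\mathbb{C}^{m_2}_{\vec{\theta}_0}(r_2)}|q^{\vec{\theta}}(z|y)|$. (d) For some $I\in\{1,\dots,l\}$: (i) there exists $r_2>0$ such that for all $j$ the family of functions $\{\vec{\theta}\mapsto q^{\vec{\theta}}(z|j)/q^{\vec{\theta}}(z|I)\}_{z\in\mathcal{Z}}$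 on $\mathbb{C}^{m_2}_{\vec{\theta}_0}(r_2)$ is equicontinuous; (ii) there exists $r_2>0$ such that for each $z\in\mathcal{Z}$ the real function $\log q^{\vec{\theta}}(z|I)$ can be analytically extended to $\mathbb{C}^{m_2}_{\vec{\theta}_0}(r_2)$, and for all $j$, $$\int_{\mathcal{Z}}\ \sup_{\vec{\theta}\in\mathbb{C}^{m_2}_{\vec{\theta}_0}(r_2)}\left|q^{\vec{\theta}}(z|j)\log q^{\vec{\theta}}(z|I)\right|dz<\infty.$$ If, in addition, there exist $C',C''>0$ such that for all $i,j\in\{1,\dots,l\}$ and all $z\in\mathcal{Z}$, $$C'\le\left|\frac{q^{\vec{\theta}_0}(z|j)}{q^{\vec{\theta}_0}(z|i)}\right|\le C'',$$ then the entropy rate $H(Z)$, as a function of $(\vec{\varepsilon},\vec{\theta})$, is analytic around $(\vec{\varepsilon}_0,\vec{\theta}_0)$.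
   Context: Let $\mathcal{Y}=\{1,2,\dots,l\}$ and $\mathcal{Z}=\mathbb{R}$. Let $\Omega_1\subset\mathbb{R}^{m_1}$ and $\Omega_2\subset\mathbb{R}^{m_2}$ be bounded domains (open connected sets). For $\vec{\varepsilon}\in\Omega_1$, $\Pi^{\vec{\varepsilon}}=(\pi^{\vec{\varepsilon}}_{ij})_{l\times l}$ is a stochastic matrix depending real-analytically on $\vec{\varepsilon}$, and $Y=(Y_n)$ is the $\mathcal{Y}$-valued stationary first-order Markov chain with transition matrix $\Pi^{\vec{\varepsilon}}$ and stationary vector $\pi^{\vec{\varepsilon}}$. For $\vec{\theta}\in\Omega_2$ and $y\in\mathcal{Y}$, $q^{\vec{\theta}}(\cdot|y)$ is a probability density on $\mathcal{Z}$, and for each $(y,z)$ the map $\vec{\theta}\mapsto q^{\vec{\theta}}(z|y)$ is real analytic on $\Omega_2$; the same notation denotes its complex analytic extension to a complex neighborhood of a given point. $\mathbb{C}^{m}_{x}(r)$ denotes the (open) $r$-neighborhood of $x$ in $\mathbb{C}^m$. The hidden Markov chain $Z$ is the output of the memoryless channel with input $Y$: conditionally on $Y$, the $Z_n$ are independent and $Z_n$ has density $q^{\vec{\theta}}(\cdot|Y_n)$. Let $p=p^{\vec{\varepsilon},\vec{\theta}}$ denote the resulting (joint) densities, with $z_{-n}^0=(z_{-n},\dots,z_0)$. The entropy rate is $$H(Z)=\lim_{n\to\infty}\frac{1}{n+1}H(Z_{-n}^0),\qquad H(Z_{-n}^0)=-\int_{\mathcal{Z}^{n+1}}p(z_{-n}^0)\log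 p(z_{-n}^0)\,dz_{-n}^0.$$ ''Analytic around $(\vec{\varepsilon}_0,\vec{\theta}_0)$'' means real analytic, jointly in $(\vec{\varepsilon},\vec{\theta})$, on a neighborhood of $(\vec{\varepsilon}_0,\vec{\theta}_0)$ in $\Omega_1\times\Omega_2$. *)

(* Defs.v *)
From HB Require Import structures.
From mathcomp Require Import all_boot all_order all_algebra.
From mathcomp Require Import all_classical all_reals all_analysis.
From mathcomp Require Import complex.

Set Implicit Arguments.
Unset Strict Implicit.
Unset Printing Implicit Defensive.

Import Order.TTheory GRing.Theory Num.Theory.
Import numFieldNormedType.Exports.

Local Open Scope classical_set_scope.
Local Open Scope ring_scope.

(* [R[i]] itself carries no topology; its regular module [R[i]^o] is a normed
   module over [R[i]]. *)
Notation Cplx R := (GRing.regular (complex R)).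

Section analytic.
Variables (K : numFieldType) (m : nat).
Implicit Types (c : {ffun 'I_m -> nat} -> K) (f : 'rV[K]_m -> K) (h : 'rV[K]_m).

(* The sum of c_alpha h^alpha over the multi-indices alpha in {0, ..., N-1}^m. *)
Definition box_psum c (N : nat) h : K :=
  \sum_(alpha : {ffun 'I_m -> 'I_N})
     c [ffun i => nat_of_ord (alpha i)] * \prod_(i < m) h ord0 i ^+ alpha i.

(* Near a, f is the sum of an absolutely convergent power series centred at a;
   this is real analyticity for K = R and complex analyticity for K = C. *)
Definition analytic_at f (a : 'rV[K]_m) : Prop :=
  exists c, exists2 r : K, 0 < r & forall x : 'rV[K]_m, ball a r x ->
    (exists M : K, forall N : nat,
       box_psum (fun alpha => `|c alpha|) N (map_mx Num.norm (x - a)) <= M) /\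
    box_psum c N (x - a) @[N --> \oo] --> f x.

End analytic.

Section complex_neighbourhoods.
Variables (R : realType) (m : nat).

Definition cplx_rV (x : 'rV[R]_m) : 'rV[Cplx R]_m := map_mx (real_complex R) x.

(* The library metric on 'rV is the maximum metric, so this is a polydisc. *)
Definition Cball (x : 'rV[R]_m) (r : R) : set 'rV[Cplx R]_m :=
  ball (cplx_rV x) (real_complex R r).

Definition analytic_extension (D : set 'rV[R]_m) (f : 'rV[R]_m -> R)
    (a : 'rV[R]_m) (r : R) (F : 'rV[Cplx R]_m -> Cplx R) : Prop :=
  (forall w, Cball a r w -> analytic_at F w) /\
  (forall x, D x -> Cball a r (cplx_rV x) ->
     F (cplx_rV x) = real_complex R (f x)).

End complex_neighbourhoods.

Definition bounded_domain (R : realType) (m : nat) (D : set 'rV[R]_m) : Prop :=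
  [/\ open D, connected D & bounded_set D].

Section envelopes.
Variables (R : realType) (l m : nat).
Variables (Q : 'rV[Cplx R]_m -> 'I_l -> R -> Cplx R) (a : 'rV[R]_m) (r : R).

Definition q_breve (z : R) : \bar R :=
  ereal_sup [set (ComplexField.Normc.normc (Q yw.2 yw.1 z))%:E
            | yw in [set: 'I_l] `*` Cball a r].

Definition q_hat (z : R) : \bar R :=
  ereal_inf [set (ComplexField.Normc.normc (Q yw.2 yw.1 z))%:E
            | yw in [set: 'I_l] `*` Cball a r].

End envelopes.

Section lebesgue_tuple.
Variable R : realType.
Local Notation rT := (measurableTypeR R).

Section step.
Variables (n : nat) (mu : {sigma_finite_measure set (n.-tuple rT) -> \bar R}).

Definition tuple_cons (xs : rT * n.-tuple rT) : n.+1.-tuple rT :=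
  [the n.+1.-tuple rT of xs.1 :: xs.2].

Definition cons_measure : set (n.+1.-tuple rT) -> \bar R :=
  pushforward (lebesgue_measure \x mu)%E tuple_cons.

Lemma measurable_tuple_cons : measurable_fun [set: rT * n.-tuple rT] tuple_cons.
Proof. exact: measurable_cons. Qed.

Let cons_measure0 : cons_measure set0 = 0%E.
Proof. by rewrite /cons_measure /pushforward preimage_set0 measure0. Qed.

Let cons_measure_ge0 A : (0 <= cons_measure A)%E.
Proof. by rewrite /cons_measure /pushforward; exact: measure_ge0. Qed.

Let cons_measure_sigma_additive : semi_sigma_additive cons_measure.
Proof.
have mcons A : measurable A -> measurable (tuple_cons @^-1` A).
  by move=> mA; rewrite -[X in measurable X]setTI; exact: measurable_tuple_cons.
move=> F mF tF mUF; rewrite /cons_measure /pushforward preimage_bigcup.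
apply: measure_semi_sigma_additive => //.
- by move=> n'; exact: mcons.
- apply/trivIsetP => /= i j _ _ ij; rewrite -preimage_setI.
  by move/trivIsetP : tF => /(_ _ _ _ _ ij) ->//; rewrite preimage_set0.
- by rewrite -preimage_bigcup; exact: mcons.
Qed.

HB.instance Definition _ := isMeasure.Build _ _ _ cons_measure
  cons_measure0 cons_measure_ge0 cons_measure_sigma_additive.

Let cons_measure_sigma_finite : sigma_finite setT cons_measure.
Proof.
have /sigma_finiteP[F [TF ndF Foo]] := sigma_finiteT (@lebesgue_measure R).
have /sigma_finiteP[G [TG ndG Goo]] := sigma_finiteT mu.
pose u (t : n.+1.-tuple rT) : rT * n.-tuple rT :=
  (tnth t ord0, [tuple of behead t]).
have uK p : u (tuple_cons p) = p.
  by case: p => x s; congr pair; apply/val_inj.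
have mu_ : measurable_fun [set: n.+1.-tuple rT] u.
  apply/measurable_fun_pairP; split; first exact: measurable_tnth.
  exact: measurable_behead.
exists (fun k => u @^-1` (F k `*` G k)).
  apply/esym; rewrite -subTset => t _.
  have [i _ Fi] : (\bigcup_i F i) (u t).1 by rewrite -TF.
  have [j _ Gj] : (\bigcup_i G i) (u t).2 by rewrite -TG.
  exists (maxn i j) => //; split.
    by move: Fi; exact/subsetPset/ndF/leq_maxl.
  by move: Gj; exact/subsetPset/ndG/leq_maxr.
move=> k; have [mF Fk] := Foo k; have [mG Gk] := Goo k; split.
  by rewrite -[X in measurable X]setTI; apply: mu_ => //; exact: measurableX.
rewrite /cons_measure /pushforward -comp_preimage.
rewrite (_ : u \o tuple_cons = id) ?preimage_id; last exact/funext.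
by rewrite product_measure1E// lte_mul_pinfty// ge0_fin_numE.
Qed.

HB.instance Definition _ := Measure_isSigmaFinite.Build _ _ _ cons_measure
  cons_measure_sigma_finite.

End step.

(* Lebesgue measure on R^n. *)
Fixpoint lebesgue_tuple (n : nat) :
    {sigma_finite_measure set (n.-tuple rT) -> \bar R} :=
  match n with
  | 0 => \d_([tuple] : 0.-tuple rT)
  | n'.+1 => cons_measure (lebesgue_tuple n')
  end.

Lemma lebesgue_tupleS n A : lebesgue_tuple n.+1 A =
  (lebesgue_measure \x lebesgue_tuple n)%E (@tuple_cons n @^-1` A).
Proof. by []. Qed.

End lebesgue_tuple.

Definition stochastic_mx (R : realType) (l : nat) (P : 'M[R]_l) : Prop :=
  (forall i j, 0 <= P i j) /\ (forall i, \sum_j P i j = 1).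

Definition stationary_vector (R : realType) (l : nat) (P : 'M[R]_l)
    (v : 'rV[R]_l) : Prop :=
  [/\ forall i, 0 <= v ord0 i, \sum_i v ord0 i = 1 & v *m P = v].

Definition probability_density (R : realType) (g : R -> R) : Prop :=
  [/\ measurable_fun [set: measurableTypeR R] g, forall z, 0 <= g z &
      (\int[lebesgue_measure]_z (g z)%:E = 1)%E].

Section hidden_markov.
Variables (R : realType) (l : nat).
Variables (v : 'rV[R]_l) (P : 'M[R]_l) (g : 'I_l -> R -> R).
Local Notation rT := (measurableTypeR R).

(* In an (n+1)-tuple, the entry of index i stands for time i - n. *)

Definition chain_pmf (n : nat) (y : n.+1.-tuple 'I_l) : R :=
  v ord0 (tnth y ord0) *
  \prod_(i < n) P (tnth y (widen_ord (leqnSn n) i)) (tnth y (lift ord0 i)).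

Definition channel_pdf (n : nat) (y : n.+1.-tuple 'I_l) (z : n.+1.-tuple rT) : R :=
  \prod_(i < n.+1) g (tnth y i) (tnth z i).

Definition hmc_pdf (n : nat) (z : n.+1.-tuple rT) : R :=
  \sum_(y : n.+1.-tuple 'I_l) chain_pmf y * channel_pdf y z.

(* [ln 0 = 0], so the integrand vanishes where the density does. *)
Definition block_entropy (n : nat) : \bar R :=
  (- \int[lebesgue_tuple R n.+1]_z (hmc_pdf z * ln (hmc_pdf z))%:E)%E.

Definition mean_entropy (n : nat) : \bar R :=
  ((n.+1%:R^-1)%:E * block_entropy n)%E.

Definition entropy_rate : \bar R := limn mean_entropy.

End hidden_markov.

(* Main.v *)
(* Work in the l^1 Banach algebra of real power series on a polydisc around
   (eps0, theta0).  The complex hypotheses enter only through Cauchy's estimates,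
   which bound the l^1 norms of the real expansions of q, of q ln q_I and of
   q_j / q_I, the latter uniformly in z by equicontinuity.

   After division by q_I the density of a word is a product of positive matrices
   M_z(i,j) = (q_i / q_I)(z) P_ij whose entries are uniformly comparable, so these
   products contract the oscillation of vectors.  Since the M_z stay uniformly
   l^1-close to their value at the centre, the contraction persists for power
   series: the logarithmic increments ln (U (z :: s)_I / U s_I) have bounded l^1
   norm, and deleting the last letter of s changes them by O(gamma ^ |s|) with
   gamma < 1.  The word weights have total l^1 norm at most kappa ^ n with kappa
   arbitrarily close to 1 on small polydiscs; as kappa gamma < 1, the expected
   increments converge as power series, and the entropy rate is minus the sum of
   their limit and of the expectation of ln q_I. *)

Require Import Defs.
From HB Require Import structures.
From mathcomp Require Import all_boot all_order all_algebra.
From mathcomp Require Import all_classical all_reals all_analysis.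
From mathcomp Require Import measurable_realfun complex.
From mathcomp Require cyclic separable cyclotomic.
From mathcomp Require Import ring lra zify.

Set Implicit Arguments.
Unset Strict Implicit.
Unset Printing Implicit Defensive.

Import Order.TTheory GRing.Theory Num.Theory.
Import numFieldNormedType.Exports.

Local Open Scope classical_set_scope.
Local Open Scope ring_scope.

(** * Multi-indices and box partial sums *)

(** The obstacle is uniformity in the length of the word. A product of [n] perturbed matrices has
    l^1 norm that may grow exponentially in [n], so [U s] and its inverse admit no common bound;
    every uniform estimate concerns quotients in which the common growth cancels. At the centre,
    each factor is conjugated by the vectors [U] into a stochastic kernel (a Doob transform). Away
    from the centre the kernels differ from these by perturbations of row sum zero, and such a
    perturbation sees a vector only through its oscillation, which contracts.

    Letters are added at the head of a word while memory is lost at its tail, so the increments of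
    the logarithm condition a letter on the later ones; stationarity and consistency of the
    densities move words in both directions.

    The order of the constants is decisive: the contraction rate [gamma] depends only on bounds at
    the centre. The size [eta] of the perturbation, then [d], then the radius are chosen afterwards,
    which makes [kappa * gamma < 1] attainable.

    Integration over letters needs coefficients that are measurable in the letter; these are
    recovered as limits of difference quotients. *)

Section multi_indices.
Variable m : nat.
Local Notation mi := {ffun 'I_m -> nat}.
Implicit Types a b g : mi.

Definition mdeg a := (\sum_i a i)%N.
Definition madd a b : mi := [ffun i => (a i + b i)%N].
Definition msub a b : mi := [ffun i => (a i - b i)%N].
Definition mle a b := [forall i, a i <= b i]%N.
Definition m0 : mi := [ffun => 0%N].
(** The boxes are lists over one common type, so that boxes of different sides can be compared by
    inclusion. *)
Definition mbox N : seq mi :=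
  [seq ([ffun i => nat_of_ord (f i)] : mi) | f : {ffun 'I_m -> 'I_N} <- enum {: {ffun 'I_m -> 'I_N}}].

Lemma mem_mbox N a : (a \in mbox N) = [forall i, a i < N]%N.
Proof.
apply/mapP/forallP => [[b _ ->] i|aN]; first by rewrite ffunE.
by exists [ffun i => Ordinal (aN i)]; rewrite ?mem_enum//; apply/ffunP => i; rewrite !ffunE.
Qed.

Lemma mbox_uniq N : uniq (mbox N).
Proof.
rewrite map_inj_uniq ?enum_uniq// => a b /ffunP ab.
by apply/ffunP => i; apply/val_inj; move: (ab i); rewrite !ffunE.
Qed.

Lemma sub_mbox N N' : (N <= N')%N -> {subset mbox N <= mbox N'}.
Proof.
move=> NN' a; rewrite !mem_mbox => /forallP aN; apply/forallP => i.
exact: leq_trans (aN i) NN'.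
Qed.

Lemma leq_mdeg a i : (a i <= mdeg a)%N.
Proof. by rewrite /mdeg (bigD1 i)//= leq_addr. Qed.

Lemma mbox_mdeg a N : (mdeg a < N)%N -> a \in mbox N.
Proof.
by move=> aN; rewrite mem_mbox; apply/forallP => i; apply: leq_ltn_trans aN; exact: leq_mdeg.
Qed.

Lemma mdeg_madd a b : mdeg (madd a b) = (mdeg a + mdeg b)%N.
Proof. by rewrite /mdeg -big_split; apply: eq_bigr => i _; rewrite ffunE. Qed.

Lemma mdeg0 : mdeg m0 = 0%N.
Proof. by rewrite /mdeg big1// => i _; rewrite ffunE. Qed.

Lemma mdeg_eq0 a : (mdeg a == 0%N) = (a == m0).
Proof.
apply/idP/eqP => [|->]; last by rewrite mdeg0.
rewrite /mdeg sum_nat_eq0 => /forallP a0; apply/ffunP => i.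
by rewrite ffunE; have := a0 i; rewrite implyTb => /eqP.
Qed.

Lemma mle_madd a b g : mle a b -> (b == madd a g) = (g == msub b a).
Proof.
move=> /forallP ab; apply/eqP/eqP => [->|->].
  by apply/ffunP => i; rewrite !ffunE addKn.
by apply/ffunP => i; rewrite !ffunE subnKC.
Qed.

Lemma mle_maddl a g : mle a (madd a g).
Proof. by apply/forallP => i; rewrite ffunE leq_addr. Qed.

Lemma mbox_mle N a b : b \in mbox N -> mle a b -> a \in mbox N.
Proof.
rewrite !mem_mbox => /forallP bN /forallP ab; apply/forallP => i.
exact: leq_ltn_trans (ab i) (bN i).
Qed.

Lemma mle_mdeg a b : mle a b -> (mdeg a <= mdeg b)%N.
Proof. by move=> /forallP ab; exact: leq_sum. Qed.

Lemma msub_mle a b : mle (msub b a) b.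
Proof. by apply/forallP => i; rewrite ffunE leq_subr. Qed.

End multi_indices.
Arguments m0 {m}.

Lemma sum_uniq_sub (V : zmodType) (I : eqType) (s t : seq I) (F : I -> V) :
  uniq s -> uniq t -> {subset t <= s} ->
  \sum_(i <- s) F i = \sum_(i <- t) F i + \sum_(i <- s | i \notin t) F i.
Proof.
move=> us ut ts; rewrite (bigID (mem t))/=; congr (_ + _).
rewrite -big_filter; apply: perm_big; apply: uniq_perm => //; first exact: filter_uniq.
by move=> i; rewrite mem_filter andb_idr//; exact: ts.
Qed.

Section power_sums.
Variables (K : numFieldType) (m : nat).
Local Notation mi := {ffun 'I_m -> nat}.
Implicit Types (c d : mi -> K) (h w : 'rV[K]_m).

Definition mon h (a : mi) : K := \prod_(i < m) h ord0 i ^+ a i.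
Definition psum c N h : K := \sum_(a <- mbox m N) c a * mon h a.
Definition pnorm (rho : K) c N : K := \sum_(a <- mbox m N) `|c a| * rho ^+ mdeg a.
(** The homogeneous part of degree [k]; the box of side [k.+1] already contains every multi-index of
    that degree. *)
Definition hsum c (k : nat) h : K := \sum_(a <- mbox m k.+1 | mdeg a == k) c a * mon h a.

Lemma box_psumE c N h : box_psum c N h = psum c N h.
Proof.
rewrite /psum big_map big_enum; apply: eq_bigr => a _; congr (_ * _).
by apply: eq_bigr => i _; rewrite ffunE.
Qed.

Lemma monD h a b : mon h (madd a b) = mon h a * mon h b.
Proof. by rewrite /mon -big_split; apply: eq_bigr => i _; rewrite ffunE exprD. Qed.

Lemma mon0 h : mon h m0 = 1.
Proof. by rewrite /mon big1// => i _; rewrite ffunE expr0. Qed.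

Lemma monZ (s : K) h a : mon (s *: h) a = s ^+ mdeg a * mon h a.
Proof.
rewrite /mon /mdeg -prodrXr -big_split; apply: eq_bigr => i _.
by rewrite mxE exprMn.
Qed.

Lemma mon_le (rho : K) h a : 0 <= rho -> (forall i, `|h ord0 i| <= rho) ->
  `|mon h a| <= rho ^+ mdeg a.
Proof.
move=> r0 hr; rewrite /mon /mdeg -prodrXr normr_prod; apply: ler_prod => i _.
by rewrite normr_ge0/= normrX lerXn2r// ?nnegrE.
Qed.

Lemma pnorm_ge0 (rho : K) c N : 0 <= rho -> 0 <= pnorm rho c N.
Proof. by move=> r0; apply: sumr_ge0 => a _; rewrite mulr_ge0// exprn_ge0. Qed.

Lemma pnorm_nd (rho : K) c N N' : 0 <= rho -> (N <= N')%N ->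
  pnorm rho c N <= pnorm rho c N'.
Proof.
move=> r0 NN'; rewrite /pnorm (sum_uniq_sub _ (mbox_uniq m N') (mbox_uniq m N)).
  by rewrite lerDl; apply: sumr_ge0 => a _; rewrite mulr_ge0// exprn_ge0.
exact: sub_mbox.
Qed.

Lemma psum_le (rho : K) c N h : 0 <= rho -> (forall i, `|h ord0 i| <= rho) ->
  `|psum c N h| <= pnorm rho c N.
Proof.
move=> r0 hr; apply: le_trans (ler_norm_sum _ _ _) _; apply: ler_sum => a _.
by rewrite normrM ler_wpM2l// mon_le.
Qed.

Lemma pnorm_term (rho : K) c (B : K) a : 0 <= rho -> (forall N, pnorm rho c N <= B) ->
  `|c a| * rho ^+ mdeg a <= B.
Proof.
move=> r0 cB; apply: le_trans (cB (mdeg a).+1).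
rewrite /pnorm (bigD1_seq a) ?mbox_uniq ?mbox_mdeg//= lerDl.
by apply: sumr_ge0 => b _; rewrite mulr_ge0// exprn_ge0.
Qed.

(** Coefficients of the product of two power series. *)
Definition mconv c d (a : mi) : K :=
  \sum_(b <- mbox m (mdeg a).+1 | mle b a) c b * d (msub a b).

End power_sums.

(** Reindexing by the pair ([b], [a] minus [b]). With [p] trivial it serves products summed over
    boxes, with [p] fixing the degree it serves homogeneous parts. *)
Lemma conv_sumE (m : nat) (V : zmodType) (F : {ffun 'I_m -> nat} -> {ffun 'I_m -> nat} -> V)
    (s t : seq {ffun 'I_m -> nat}) (p : pred {ffun 'I_m -> nat}) :
  uniq s -> uniq t -> (forall a b, a \in s -> p a -> mle b a -> b \in t) ->
  \sum_(a <- s | p a) \sum_(b <- mbox m (mdeg a).+1 | mle b a) F b (msub a b) =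
  \sum_(b <- t) \sum_(g <- t | (madd b g \in s) && p (madd b g)) F b g.
Proof.
move=> us ut st.
transitivity (\sum_(b <- t) \sum_(g <- t) \sum_(a <- s | p a && (a == madd b g)) F b g); last first.
  apply: eq_bigr => b _; rewrite [RHS]big_mkcond; apply: eq_bigr => g _.
  case: ifPn => [/andP[bgs pbg]|bgs].
    rewrite (big_rem (madd b g))//= pbg eqxx/= big1_seq ?addr0// => a /andP[/andP[_ /eqP->]].
    by rewrite mem_rem_uniq// inE eqxx.
  rewrite big1_seq// => a /andP[/andP[pa /eqP ab] ais]; case/negP: bgs.
  by rewrite -ab ais pa.
transitivity (\sum_(a <- s | p a) \sum_(b <- t) \sum_(g <- t | a == madd b g) F b g); last first.
  rewrite exchange_big/=; apply: eq_bigr => b _.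
  transitivity (\sum_(a <- s | p a) \sum_(g <- t) if a == madd b g then F b g else 0).
    by apply: eq_bigr => a _; rewrite -big_mkcond.
  rewrite exchange_big/=; apply: eq_bigr => g _.
  by rewrite -big_mkcondr.
rewrite big_seq_cond [RHS]big_seq_cond; apply: eq_bigr => a /andP[ais pa].
transitivity (\sum_(b <- t | mle b a) F b (msub a b)).
  rewrite -big_filter -[RHS]big_filter; apply: perm_big; apply: uniq_perm.
  - exact/filter_uniq/mbox_uniq.
  - exact: filter_uniq.
  move=> b; rewrite !mem_filter; case: (boolP (mle b a)) => //= ba.
  by rewrite (st a)// mbox_mdeg// ltnS mle_mdeg.
rewrite big_mkcond; apply: eq_bigr => b _; case: ifPn => ba.
  under eq_bigl => g do rewrite mle_madd//.
  rewrite (big_rem (msub a b)) ?(st a) ?msub_mle//= eqxx big1_seq ?addr0// => g /andP[/eqP->].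
  by rewrite mem_rem_uniq// inE eqxx.
by rewrite big1// => g /eqP E; case/negP: ba; rewrite E mle_maddl.
Qed.

Section lines.
Variables (K : numFieldType) (m : nat).
Local Notation mi := {ffun 'I_m -> nat}.
Implicit Types (c d : mi -> K) (h w : 'rV[K]_m).

Lemma hsum_mbox c k h N : (k < N)%N ->
  hsum c k h = \sum_(a <- mbox m N | mdeg a == k) c a * mon h a.
Proof.
move=> kN; rewrite /hsum -big_filter -[RHS]big_filter; apply: perm_big.
apply: uniq_perm; rewrite ?filter_uniq ?mbox_uniq// => a; rewrite !mem_filter.
by case: eqP => //= ak; rewrite !mbox_mdeg// ak.
Qed.

Lemma hsumZ c k (s : K) h : hsum c k (s *: h) = s ^+ k * hsum c k h.
Proof.
by rewrite /hsum mulr_sumr; apply: eq_bigr => a /eqP <-; rewrite monZ mulrCA.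
Qed.

Lemma hsum0 c h : hsum c 0 h = c m0.
Proof.
rewrite /hsum big_mkcond (bigD1_seq m0) ?mbox_uniq ?mbox_mdeg ?mdeg0//= mon0 mulr1.
by rewrite big1 ?addr0// => a a0; rewrite mdeg_eq0 (negbTE a0).
Qed.

(** Links summation over boxes, used to define analyticity, with summation by degree, which is what
    restriction to a line sees. *)
Lemma psum_hsum c N n h : (n <= N)%N -> psum c N h =
  \sum_(k < n) hsum c k h + \sum_(a <- mbox m N | (n <= mdeg a)%N) c a * mon h a.
Proof.
move=> nN; rewrite /psum (bigID (fun a => (n <= mdeg a)%N))/= addrC; congr (_ + _).
under [RHS]eq_bigr => k _ do rewrite (hsum_mbox _ _ (leq_trans (ltn_ord k) nN)).
rewrite big_mkcond; under [RHS]eq_bigr => k _ do rewrite big_mkcond.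
rewrite exchange_big/=; apply: eq_bigr => a _.
rewrite -ltnNge -big_mkcond/=; case: ltnP => an.
  by rewrite (big_pred1 (Ordinal an))// => k; rewrite -val_eqE eq_sym.
by rewrite big1// => k /eqP ak; move: (ltn_ord k); rewrite -ak ltnNge an.
Qed.

(** In degree [d >= n], [s ^+ d] is at most [s ^+ n * rho ^+ (d - n)]; the factor [(s / rho) ^+ n]
    comes out of the weighted norm. *)
Lemma line_rem (rho s : K) c N n w : 0 < rho -> 0 <= s <= rho ->
  (forall i, `|w ord0 i| <= 1) ->
  \sum_(a <- mbox m N | (n <= mdeg a)%N) `|c a * (s ^+ mdeg a * mon w a)| <=
  (s / rho) ^+ n * pnorm rho c N.
Proof.
move=> r0 /andP[s0 sr] w1; rewrite /pnorm mulr_sumr big_mkcond; apply: ler_sum => a _.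
case: ifPn => na; last by rewrite !mulr_ge0 ?exprn_ge0 ?divr_ge0// ltW.
rewrite normrM mulrCA ler_wpM2l// normrM normrX.
have w1' : `|mon w a| <= 1 by rewrite -(expr1n _ (mdeg a)) mon_le.
apply: le_trans (ler_wpM2l _ w1') _; first by rewrite exprn_ge0.
rewrite mulr1 (_ : (s / rho) ^+ n * _ = s ^+ n * rho ^+ (mdeg a - n)).
  rewrite ger0_norm// -{1}(subnKC na) exprD ler_wpM2l ?exprn_ge0//.
  by rewrite lerXn2r ?nnegrE// ltW.
by rewrite -{1}(subnKC na) exprD expr_div_n mulrA divfK ?expf_neq0 ?gt_eqF.
Qed.

Definition PS (x0 : 'rV[K]_m) (rho B : K) (f : 'rV[K]_m -> K) c : Prop :=
  (forall N, pnorm rho c N <= B) /\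
  forall x : 'rV[K]_m, (forall i, `|x ord0 i - x0 ord0 i| <= rho) ->
    (fun N => psum c N (x - x0)) @ \oo --> f x.

Lemma cvg_norm_le (u : nat -> K) (l B : K) (n0 : nat) :
  u @ \oo --> l -> (forall n, (n0 <= n)%N -> `|u n| <= B) -> `|l| <= B.
Proof.
move=> ul uB.
(* The order of a [numFieldType] is partial; [B] is real because it dominates a norm. *)
have B0 : B \is Num.real by rewrite ger0_real// (le_trans _ (uB n0 _)).
have [//|Bl] := real_leP (normr_real l) B0.
have e0 : 0 < `|l| - B by rewrite subr_gt0.
move/cvgrPdist_lt : ul => /(_ _ e0)[N _ NP].
have ND := NP (maxn N n0) (leq_maxl _ _).
have DN : `|l| - B <= `|l - u (maxn N n0)|.
  by apply: le_trans (lerB_dist _ _); rewrite lerB// uB// leq_maxr.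
by have := le_lt_trans DN ND; rewrite ltxx.
Qed.

(** A Taylor remainder on lines with an explicit constant. It is used over the reals to recover
    measurable coefficients and over the complex numbers to obtain expansions and continuity. *)
Lemma PS_line x0 rho B f c w s n : 0 < rho -> PS x0 rho B f c ->
  0 <= s <= rho -> (forall i, `|w ord0 i| <= 1) ->
  `|f (x0 + s *: w) - \sum_(k < n) s ^+ k * hsum c k w| <= (s / rho) ^+ n * B.
Proof.
move=> r0 [cB cf] /[dup] s0r /andP[s0 sr] w1.
have /cf cvf : forall i, `|(x0 + s *: w) ord0 i - x0 ord0 i| <= rho.
  move=> i; rewrite !mxE addrAC subrr add0r normrM ger0_norm//.
  by rewrite -[leRHS]mulr1 ler_pM.
pose v := \sum_(k < n) s ^+ k * hsum c k w.
have : (fun N => psum c N (x0 + s *: w - x0) - v) @ \oo --> f (x0 + s *: w) - v.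
  by apply: cvgB => //; exact: cvg_cst.
move/(@cvg_norm_le _ _ ((s / rho) ^+ n * B) n); apply => N nN.
rewrite addrAC subrr add0r (psum_hsum _ _ nN).
under [in X in X + _]eq_bigr => k _ do rewrite hsumZ.
rewrite addrAC subrr add0r.
under eq_bigr => a _ do rewrite monZ.
apply: le_trans (ler_norm_sum _ _ _) _.
apply: le_trans (line_rem _ _ _ r0 s0r w1) _.
by rewrite ler_wpM2l// exprn_ge0// divr_ge0// ltW.
Qed.

End lines.

(** * The Banach algebra of power series on a polydisc *)

Section real_sequences.
Variable R : realType.
Implicit Types (u v : nat -> R) (l B : R).

Lemma cvg_epsP u l : u @ \oo --> l <->
  (forall e, 0 < e -> exists N, forall n, (N <= n)%N -> `|u n - l| <= e).
Proof.
split=> [/cvgrPdist_le ul e e0|ul].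
  by have [N _ NP] := ul e e0; exists N => n nN; rewrite distrC; exact: NP.
by apply/cvgrPdist_le => e /ul[N NP]; exists N => // n /= nN; rewrite distrC NP.
Qed.

Lemma nd_cvg u B : (forall n k, (n <= k)%N -> u n <= u k) -> (forall n, u n <= B) ->
  exists l, [/\ u @ \oo --> l, forall n, u n <= l & l <= B].
Proof.
move=> nd uB.
have cu : cvgn u.
  by apply: nondecreasing_is_cvgn => //; exists B => _ [n _ <-].
exists (limn u); split=> //; first by move=> n; exact: nondecreasing_cvgn_le.
by apply: limr_le => //; near=> n.
Unshelve. all: by end_near. Qed.

Lemma cvg_dominated u v l : v @ \oo --> 0 -> (forall n, `|u n - l| <= v n) ->
  u @ \oo --> l.
Proof.
move=> /cvg_epsP v0 uv; apply/cvg_epsP => e /v0[N NP]; exists N => n /NP.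
by rewrite subr0; apply: le_trans; rewrite (le_trans (uv n))// ler_norm.
Qed.

Lemma cvg_seq_sum (I : Type) (s : seq I) (P : pred I) (f : nat -> I -> R) (g : I -> R) :
  (forall i, P i -> (fun n => f n i) @ \oo --> g i) ->
  (fun n => \sum_(i <- s | P i) f n i) @ \oo --> \sum_(i <- s | P i) g i.
Proof. by move=> fg; apply: cvg_big => //; exact: add_continuous. Qed.

Lemma abs_series_cvg u b S : (forall n, `|u n| <= b n) ->
  (forall n, \sum_(k < n) b k <= S) -> cvgn (fun n => \sum_(k < n) u k).
Proof.
move=> ub bS; have b0 n : 0 <= b n by exact: le_trans (ub n).
rewrite (_ : (fun _ => _) = series u); last first.
  by apply/funext => n; rewrite /series/= big_mkord.
apply: normed_cvg.
have nd n k : (n <= k)%N -> \sum_(i < n) `|u i| <= \sum_(i < k) `|u i|.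
  by move=> nk; rewrite -(subnKC nk) big_split_ord/= lerDl sumr_ge0.
have bd n : \sum_(i < n) `|u i| <= S.
  by apply: le_trans (bS n); exact: ler_sum.
have [l [ul _ _]] := nd_cvg nd bd.
apply/cvg_ex; exists l; rewrite (_ : [normed series u] = (fun n => \sum_(i < n) `|u i|))//.
by apply/funext => n; rewrite /normed_series_of /series /= big_mkord.
Qed.

End real_sequences.

Section analytic_norm.
Variables (R : realType) (m : nat) (x0 : 'rV[R]_m).
Local Notation mi := {ffun 'I_m -> nat}.
Implicit Types (f g : 'rV[R]_m -> R) (c d : mi -> R) (x h : 'rV[R]_m) (rho B : R).

Definition pdisc rho x := forall i, `|x ord0 i - x0 ord0 i| <= rho.
(* [f] is a power series of l^1 norm at most [B] on the polydisc of radius [rho]. *)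
Definition An rho f B := exists c, PS x0 rho B f c.

Lemma pdiscB rho x i : pdisc rho x -> `|(x - x0) ord0 i| <= rho.
Proof. by move=> /(_ i); rewrite !mxE. Qed.

Lemma pdisc0 rho : 0 <= rho -> pdisc rho x0.
Proof. by move=> ? i; rewrite subrr normr0. Qed.

Lemma pdisc_le rho rho' x : rho' <= rho -> pdisc rho' x -> pdisc rho x.
Proof. by move=> rr xr i; exact: le_trans (xr i) rr. Qed.

Lemma An_le rho f B B' : B <= B' -> An rho f B -> An rho f B'.
Proof. by move=> BB [c [cB cf]]; exists c; split=> // N; exact: le_trans (cB N) BB. Qed.

(** Functions need to agree on the polydisc only, so identities with denominators that do not vanish
    there are admissible. *)
Lemma An_ext rho f g B : (forall x, pdisc rho x -> f x = g x) -> An rho f B -> An rho g B.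
Proof.
by move=> fg [c [cB cf]]; exists c; split=> // x xr; rewrite -fg//; exact: cf.
Qed.

Lemma An_mon rho a (b : mi) :
  0 <= rho -> An rho (fun x => a * mon (x - x0) b) (`|a| * rho ^+ mdeg b).
Proof.
move=> r0; exists (fun k => if k == b then a else 0); split=> [N|x xr].
  rewrite /pnorm (eq_bigr (fun k => if k == b then `|a| * rho ^+ mdeg b else 0)); last first.
    by move=> k _; case: eqP => [->//|]; rewrite normr0 mul0r.
  case: (boolP (b \in mbox m N)) => bN.
    rewrite (bigD1_seq b) ?mbox_uniq//= eqxx big1 ?addr0// => k /negbTE ->//.
  rewrite big1_seq ?mulr_ge0 ?exprn_ge0// => k /= kN; case: eqP => // kb.
  by rewrite -kb kN in bN.
apply/cvg_epsP => e e0; exists (mdeg b).+1 => n bn.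
rewrite /psum (bigD1_seq b) ?mbox_uniq ?mbox_mdeg//= eqxx big1 ?addr0 ?subrr ?normr0 ?ltW//.
by move=> k /negbTE ->; rewrite mul0r.
Qed.

Lemma An_cst rho a : 0 <= rho -> An rho (fun=> a) `|a|.
Proof.
move=> r0; have := An_mon a m0 r0; rewrite mdeg0 expr0 mulr1.
by apply: An_ext => x _; rewrite mon0 mulr1.
Qed.

Lemma An_coord rho i : 0 <= rho -> An rho (fun x => x ord0 i - x0 ord0 i) rho.
Proof.
move=> r0; pose b : mi := [ffun j => (j == i) : nat].
have E : mdeg b = 1%N.
  by rewrite /mdeg (bigD1 i)//= ffunE eqxx big1 ?addn0// => j /negbTE ji; rewrite ffunE ji.
have := An_mon 1 b r0; rewrite E normr1 mul1r expr1; apply: An_ext => x _.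
rewrite mul1r /mon (bigD1 i)//= ffunE eqxx expr1 big1 ?mulr1 ?mxE// => j /negbTE ji.
by rewrite ffunE ji expr0.
Qed.

Lemma AnD rho f g B B' : 0 <= rho ->
  An rho f B -> An rho g B' -> An rho (fun x => f x + g x) (B + B').
Proof.
move=> r0 [c [cB cf]] [d [dB dg]]; exists (fun a => c a + d a); split=> [N|x xr].
  apply: le_trans (lerD (cB N) (dB N)); rewrite /pnorm -big_split/=; apply: ler_sum => a _.
  by rewrite -mulrDl ler_wpM2r ?exprn_ge0// ler_normD.
rewrite (_ : (fun N => _) = (fun N => psum c N (x - x0) + psum d N (x - x0))).
  by apply: cvgD; [exact: cf|exact: dg].
apply/funext => N; rewrite /psum -big_split/=; apply: eq_bigr => a _.
by rewrite mulrDl.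
Qed.

Lemma AnZ rho k f B : An rho f B -> An rho (fun x => k * f x) (`|k| * B).
Proof.
move=> [c [cB cf]]; exists (fun a => k * c a); split=> [N|x xr].
  rewrite (_ : pnorm _ _ _ = `|k| * pnorm rho c N); first by rewrite ler_wpM2l.
  by rewrite /pnorm mulr_sumr; apply: eq_bigr => a _; rewrite normrM mulrA.
rewrite (_ : (fun N => _) = (fun N => k * psum c N (x - x0))).
  by apply: cvgM; [exact: cvg_cst|exact: cf].
by apply/funext => N; rewrite /psum mulr_sumr; apply: eq_bigr => a _; rewrite mulrA.
Qed.

Lemma AnN rho f B : An rho f B -> An rho (fun x => - f x) B.
Proof.
move=> /(AnZ (-1)); rewrite normrN1 mul1r; apply: An_ext => x _.
by rewrite mulN1r.
Qed.

Lemma AnB rho f g B B' : 0 <= rho ->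
  An rho f B -> An rho g B' -> An rho (fun x => f x - g x) (B + B').
Proof. by move=> r0 fB /AnN; exact: AnD. Qed.

Lemma An_sum rho (I : Type) (s : seq I) (P : pred I) (f : I -> 'rV[R]_m -> R) (B : I -> R) :
  0 <= rho -> (forall i, P i -> An rho (f i) (B i)) ->
  An rho (fun x => \sum_(i <- s | P i) f i x) (\sum_(i <- s | P i) B i).
Proof.
move=> r0 fB; elim: s => [|i s IH].
  rewrite big_nil; have := @An_cst _ 0 r0; rewrite normr0; apply: An_ext => x _.
  by rewrite big_nil.
rewrite big_cons; case: ifPn => Pi.
  by apply: An_ext (AnD r0 (fB i Pi) IH) => x _; rewrite big_cons Pi.
by apply: An_ext IH => x _; rewrite big_cons (negbTE Pi).
Qed.

Lemma An_bound rho f B x : 0 <= rho -> An rho f B -> pdisc rho x -> `|f x| <= B.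
Proof.
move=> r0 [c [cB cf]] xr; apply: (cvg_norm_le (n0 := 0%N) (cf x xr)) => N _.
by apply: le_trans (cB N); apply: psum_le => // i; exact: pdiscB.
Qed.

Lemma An_ge0 rho f B : 0 <= rho -> An rho f B -> 0 <= B.
Proof. by move=> r0 fB; apply: le_trans (An_bound r0 fB (pdisc0 r0)). Qed.

(** Without its constant term the series has only monomials of positive degree, and each of them
    gains a factor [rho' / rho]. This is how small polydiscs make perturbations small. *)
Lemma An_small rho rho' f B : 0 < rho -> 0 <= rho' <= rho -> An rho f B ->
  An rho' (fun x => f x - f x0) (rho' / rho * B).
Proof.
move=> r0 /andP[r0' rr] [c [cB cf]].
have c0 : c m0 = f x0.
  have /cvgrPdist_le cv := cf x0 (pdisc0 (ltW r0)).
  apply/eqP; rewrite eq_sym -subr_eq0 -normr_eq0; apply/eqP/le_anti; rewrite normr_ge0 andbT.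
  apply/ler_addgt0Pr => e e0; rewrite add0r; have [N _ NP] := cv e e0.
  have := NP N.+1 (leqnSn N); rewrite subrr /psum (bigD1_seq m0) ?mbox_uniq ?mbox_mdeg ?mdeg0//=.
  rewrite mon0 mulr1 big1 ?addr0// => a a0.
  rewrite /mon; have [i ai] : exists i, (0 < a i)%N.
    apply/not_existsP => a00; case/eqP: a0; apply/ffunP => i; rewrite ffunE.
    by apply/eqP; rewrite -leqn0 leqNgt; apply/negP/a00.
  by rewrite (bigD1 i)//= mxE expr0n gtn_eqF// mul0r mulr0.
exists (fun a => if a == m0 then 0 else c a); split=> [N|x xr].
  apply: le_trans (ler_wpM2l _ (cB N)); last by rewrite divr_ge0// ltW.
  rewrite /pnorm mulr_sumr; apply: ler_sum => a _; case: eqP => [_|/eqP a0].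
    by rewrite normr0 mul0r !mulr_ge0 ?exprn_ge0 ?invr_ge0// ltW.
  rewrite mulrCA ler_wpM2l//.
  have : (0 < mdeg a)%N by rewrite lt0n mdeg_eq0.
  case: (mdeg a) => // n _; rewrite !exprS mulrA divfK ?gt_eqF//.
  by rewrite ler_wpM2l// lerXn2r// ?nnegrE// ltW.
have cvx := cf x (pdisc_le rr xr).
apply/cvg_epsP => e e0; have /cvg_epsP/(_ e e0)[N NP] := cvx.
exists N.+1 => n Nn; have := NP n (ltnW Nn).
have n0 : m0 \in mbox m n by rewrite mbox_mdeg// mdeg0 (leq_ltn_trans _ Nn).
rewrite /psum (bigD1_seq m0) ?mbox_uniq//= mon0 mulr1 c0.
rewrite [X in _ -> `|X - _| <= _](bigD1_seq m0) ?mbox_uniq//= eqxx mul0r add0r.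
rewrite [X in _ -> `|X - _| <= _](_ : _ = \sum_(a <- mbox m n | a != m0) c a * mon (x - x0) a).
  by move=> H; apply: le_trans H; rewrite le_eqVlt; apply/orP; left; apply/eqP; congr (`|_|); ring.
by apply: eq_bigr => a /negbTE ->.
Qed.

End analytic_norm.

Section products.
Variables (R : realType) (m : nat) (x0 : 'rV[R]_m).
Local Notation mi := {ffun 'I_m -> nat}.
Implicit Types (f g : 'rV[R]_m -> R) (c d : mi -> R) (x h : 'rV[R]_m) (rho B : R).
Local Notation An := (An x0).
Local Notation pdisc := (pdisc x0).

Lemma conv_pnorm rho c d N : 0 <= rho ->
  pnorm rho (mconv c d) N <= pnorm rho c N * pnorm rho d N.
Proof.
move=> r0; pose F b k := (`|c b| * rho ^+ mdeg b) * (`|d k| * rho ^+ mdeg k).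
have F0 b k : 0 <= F b k by rewrite !mulr_ge0 ?exprn_ge0.
have -> : pnorm rho c N * pnorm rho d N = \sum_(b <- mbox m N) \sum_(k <- mbox m N) F b k.
  by rewrite /pnorm big_distrlr.
apply: (@le_trans _ _ (\sum_(b <- mbox m N) \sum_(k <- mbox m N | (madd b k \in mbox m N) && xpredT (madd b k)) F b k)).
  rewrite -(@conv_sumE m R F _ _ xpredT) ?mbox_uniq//; last by move=> a b aN _; exact: mbox_mle.
  apply: ler_sum => a _; rewrite /mconv.
  apply: le_trans (ler_wpM2r _ (ler_norm_sum _ _ _)) _; first exact: exprn_ge0.
  rewrite mulr_suml; apply: ler_sum => b ba; rewrite normrM /F.
  have E : a = madd b (msub a b) by apply/eqP; rewrite mle_madd.
  have -> : mdeg a = (mdeg b + mdeg (msub a b))%N by rewrite -mdeg_madd -E.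
  by rewrite exprD mulrACA.
apply: ler_sum => b _; rewrite big_mkcond; apply: ler_sum => k _.
by case: ifP.
Qed.

(** The error consists of pairs whose sum leaves the box of side [N]. As [n + n <= N], one member of
    such a pair lies outside the box of side [n], so the error is a tail of the product of the
    norms. *)
Lemma conv_psum rho c d N n h : 0 <= rho -> (forall i, `|h ord0 i| <= rho) -> (n + n <= N)%N ->
  `|psum (mconv c d) N h - psum c N h * psum d N h| <=
  pnorm rho c N * pnorm rho d N - pnorm rho c n * pnorm rho d n.
Proof.
move=> r0 hr nN; pose G b k := (c b * mon h b) * (d k * mon h k).
pose F b k := (`|c b| * rho ^+ mdeg b) * (`|d k| * rho ^+ mdeg k).
have F0 b k : 0 <= F b k by rewrite !mulr_ge0 ?exprn_ge0.
have GF b k : `|G b k| <= F b k.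
  rewrite /G !normrM /F; apply: ler_pM; rewrite ?mulr_ge0//;
  by rewrite ler_wpM2l// mon_le.
have -> : psum c N h * psum d N h = \sum_(b <- mbox m N) \sum_(k <- mbox m N) G b k.
  by rewrite /psum big_distrlr.
have -> : psum (mconv c d) N h = \sum_(b <- mbox m N)
    \sum_(k <- mbox m N | (madd b k \in mbox m N) && xpredT (madd b k)) G b k.
  rewrite -(@conv_sumE m R G _ _ xpredT) ?mbox_uniq//; last by move=> a b aN _; exact: mbox_mle.
  apply: eq_bigr => a _; rewrite /mconv mulr_suml; apply: eq_bigr => b ba.
  have E : a = madd b (msub a b) by apply/eqP; rewrite mle_madd.
  have -> : mon h a = mon h b * mon h (msub a b) by rewrite -monD -E.
  by rewrite /G mulrACA.
rewrite -sumrB.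
have -> : pnorm rho c N * pnorm rho d N = \sum_(b <- mbox m N) \sum_(k <- mbox m N) F b k.
  by rewrite /pnorm big_distrlr.
have -> : pnorm rho c n * pnorm rho d n = \sum_(b <- mbox m n) \sum_(k <- mbox m n) F b k.
  by rewrite /pnorm big_distrlr.
have nN' : (n <= N)%N by apply: leq_trans nN; exact: leq_addr.
have sb m' := @sub_mbox m' _ _ nN'.
apply: (@le_trans _ _ (\sum_(b <- mbox m N) \sum_(k <- mbox m N | madd b k \notin mbox m N) F b k)).
  apply: le_trans (ler_norm_sum _ _ _) _; apply: ler_sum => b _.
  rewrite distrC; set u := \sum_(k <- _) _; set v := \sum_(k <- _ | _) _.
  have -> : u - v = \sum_(k <- mbox m N | madd b k \notin mbox m N) G b k.
    rewrite /u (bigID (fun k => madd b k \in mbox m N))/= addrAC.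
    by under [v]eq_bigl => k do rewrite andbT; rewrite subrr add0r.
  apply: le_trans (ler_norm_sum _ _ _) _; apply: ler_sum => k _; exact: GF.
rewrite [X in _ - X](_ : _ =
    \sum_(b <- mbox m N) \sum_(k <- mbox m N | (b \in mbox m n) && (k \in mbox m n)) F b k); last first.
  rewrite [RHS](sum_uniq_sub _ (mbox_uniq m N) (mbox_uniq m n) (sb m)).
  rewrite [X in _ + X]big1 ?addr0; last first.
    by move=> b /negbTE bn; rewrite big1// => k; rewrite bn.
  rewrite big_seq [RHS]big_seq; apply: eq_bigr => b ->.
  rewrite [RHS]big_mkcond/= [RHS](sum_uniq_sub _ (mbox_uniq m N) (mbox_uniq m n) (sb m))/=.
  rewrite [X in _ + X]big1 ?addr0; last by move=> k /negbTE ->.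
  by rewrite [LHS]big_seq [RHS]big_seq; apply: eq_bigr => k ->.
rewrite -sumrB; apply: ler_sum => b _.
rewrite [X in _ <= X - _](bigID (fun k => (b \in mbox m n) && (k \in mbox m n)))/=.
rewrite addrAC subrr add0r big_mkcond [leRHS]big_mkcond; apply: ler_sum => k _.
case: ifPn; case: ifPn => //; rewrite negbK => /andP[]; rewrite !mem_mbox.
move=> /forallP bn /forallP kn /negP[]; apply/forallP => i; rewrite ffunE.
by apply: leq_trans nN; rewrite -addnS leq_add// ltnW.
Qed.

Lemma AnM rho f g B B' : 0 <= rho ->
  An rho f B -> An rho g B' -> An rho (fun x => f x * g x) (B * B').
Proof.
move=> r0 [c [cB cf]] [d [dB dg]]; exists (mconv c d); split=> [N|x xr].
  by apply: le_trans (conv_pnorm _ _ _ r0) _; apply: ler_pM => //; exact: pnorm_ge0.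
have [lc [clc _ _]] := nd_cvg (fun n k => @pnorm_nd _ _ rho c n k r0) cB.
have [ld [dld _ _]] := nd_cvg (fun n k => @pnorm_nd _ _ rho d n k r0) dB.
have cd : (fun N => psum c N (x - x0) * psum d N (x - x0)) @ \oo --> f x * g x.
  by apply: cvgM; [exact: cf|exact: dg].
apply/(subr_cvg0 (fun N => psum (mconv c d) N (x - x0))).
have P : (fun N => pnorm rho c N * pnorm rho d N) @ \oo --> lc * ld by exact: cvgM.
(* With [n] equal to half of [N], the bound of [conv_psum] is a difference of two sequences with the
   same limit. *)
have P2 : (fun N => pnorm rho c N./2 * pnorm rho d N./2) @ \oo --> lc * ld.
  apply/cvg_epsP => e e0; move/cvg_epsP : P => /(_ e e0)[N NP]; exists N.*2 => n nN.
  by apply: NP; rewrite geq_half_double.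
have PP : (fun N => (pnorm rho c N * pnorm rho d N - pnorm rho c N./2 * pnorm rho d N./2) +
    `|psum c N (x - x0) * psum d N (x - x0) - f x * g x|) @ \oo --> 0.
  rewrite -[X in _ --> X]addr0; apply: cvgD.
    by rewrite -(subrr (lc * ld)); exact: cvgB.
  rewrite -(@normr0 R R) -(subrr (f x * g x)); apply: cvg_norm.
  by apply: cvgB => //; exact: cvg_cst.
apply: cvg_dominated PP _ => N; rewrite subr0.
have := @conv_psum rho c d N N./2 (x - x0) r0 _ _.
move=> /(_ (fun i => pdiscB i xr)) H.
rewrite -(subrKA (psum c N (x - x0) * psum d N (x - x0))).
apply: le_trans (ler_normD _ _) _; rewrite lerD2r H// addnn.
by rewrite -{2}(odd_double_half N) leq_addl.
Qed.

Lemma AnX rho f B n : 0 <= rho -> An rho f B -> An rho (fun x => f x ^+ n) (B ^+ n).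
Proof.
move=> r0 fB; elim: n => [|n IH].
  have := An_cst x0 1 r0; rewrite normr1 => H.
  by apply: An_ext H => x _; rewrite expr0.
by rewrite exprS; apply: An_ext (AnM r0 fB IH) => x _; rewrite exprS.
Qed.

Lemma An_prod rho (I : Type) (s : seq I) (f : I -> 'rV[R]_m -> R) (B : I -> R) :
  0 <= rho -> (forall i, An rho (f i) (B i)) ->
  An rho (fun x => \prod_(i <- s) f i x) (\prod_(i <- s) B i).
Proof.
move=> r0 fB; elim: s => [|i s IH].
  rewrite big_nil; have := An_cst x0 1 r0; rewrite normr1 => H.
  by apply: An_ext H => x _; rewrite big_nil.
by rewrite big_cons; apply: An_ext (AnM r0 (fB i) IH) => x _; rewrite big_cons.
Qed.

(** Completeness of the algebra. Coefficients are summed one by one, and the weighted norm of their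
    tails is controlled by the tails of the series of [B]; this makes the exchange of limits a
    three-epsilon argument. *)
Lemma An_series rho (f : nat -> 'rV[R]_m -> R) (B : nat -> R) g S : 0 < rho ->
  (forall n, An rho (f n) (B n)) -> (forall n, \sum_(k < n) B k <= S) ->
  (forall x, pdisc rho x -> (fun n => \sum_(k < n) f k x) @ \oo --> g x) ->
  An rho g S.
Proof.
move=> r0 /choice[c cP] BS fg; have r0' := ltW r0.
have B0 n : 0 <= B n by apply: An_ge0 r0' _; exists (c n); exact: cP.
pose C k (a : mi) := \sum_(n < k) c n a.
have [S' [BS' BleS' S'S]] : exists l : R, [/\ (fun n => \sum_(k < n) B k) @ \oo --> l,
    forall n, \sum_(k < n) B k <= l & l <= S].
  have nd n k : (n <= k)%N -> \sum_(i < n) B i <= \sum_(i < k) B i.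
    by move=> nk; rewrite -(subnKC nk) big_split_ord/= lerDl sumr_ge0.
  exact: (nd_cvg nd BS).
have cvC a : cvgn (C^~ a).
  have H1 n : `|c n a| <= B n / rho ^+ mdeg a.
    rewrite ler_pdivlMr ?exprn_gt0//; apply: pnorm_term => //.
    by case: (cP n).
  have H2 n : \sum_(k < n) B k / rho ^+ mdeg a <= S / rho ^+ mdeg a.
    by rewrite -mulr_suml ler_wpM2r ?invr_ge0 ?exprn_ge0.
  exact: (abs_series_cvg H1 H2).
pose Coo a := limn (C^~ a).
have pC k k' N : (k <= k')%N ->
    pnorm rho (fun a => C k' a - C k a) N <= \sum_(n < k') B n - \sum_(n < k) B n.
  move=> kk; rewrite -(subnKC kk) [X in _ <= X - _]big_split_ord/= addrAC subrr add0r.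
  apply: (@le_trans _ _ (\sum_(i < k' - k) pnorm rho (c (k + i)%N) N)); last first.
    by apply: ler_sum => i _; case: (cP (k + i)%N).
  rewrite /pnorm exchange_big/=; apply: ler_sum => a _.
  rewrite /C big_split_ord/= addrAC subrr add0r -mulr_suml ler_wpM2r ?exprn_ge0//.
  exact: ler_norm_sum.
have pCoo k N : pnorm rho (fun a => Coo a - C k a) N <= S' - \sum_(n < k) B n.
  have cv : (fun k' => pnorm rho (fun a => C k' a - C k a) N) @ \oo -->
      pnorm rho (fun a => Coo a - C k a) N.
    apply: cvg_seq_sum => a _; apply: cvgM; last exact: cvg_cst.
    by apply: cvg_norm; apply: cvgB; [exact: cvC|exact: cvg_cst].
  rewrite -(cvg_lim _ cv)//; apply: limr_le; first by apply/cvg_ex; eexists; exact: cv.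
  near=> k'; have kk : (k <= k')%N by near: k'; exact: nbhs_infty_ge.
  by apply: le_trans (pC k k' N kk) _; rewrite lerD2r.
have cvG x k : pdisc rho x -> (fun N => psum (C k) N (x - x0)) @ \oo --> \sum_(n < k) f n x.
  move=> xr; rewrite (_ : (fun _ => _) = (fun N => \sum_(n < k) psum (c n) N (x - x0))).
    by apply: cvg_seq_sum => n _; case: (cP n) => _; exact.
  apply/funext => N; rewrite /psum exchange_big; apply: eq_bigr => a _.
  by rewrite mulr_suml.
exists Coo; split=> [N|x xr].
  have := pCoo 0%N N; rewrite big_ord0 subr0 => H; apply: le_trans S'S.
  apply: le_trans H; rewrite /pnorm le_eqVlt; apply/orP; left; apply/eqP.
  by apply: eq_bigr => a _; rewrite /C big_ord0 subr0.
apply/cvg_epsP => e e0.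
have e3 : 0 < e / 3 by rewrite divr_gt0.
have [k1 k1P] := (cvg_epsP _ _).1 BS' _ e3.
have [k2 k2P] := (cvg_epsP _ _).1 (fg x xr) _ e3.
pose k := maxn k1 k2.
have [N NP] := (cvg_epsP _ _).1 (cvG x k xr) _ e3.
exists N => n nN.
rewrite (_ : _ - _ = (psum Coo n (x - x0) - psum (C k) n (x - x0)) +
  (psum (C k) n (x - x0) - \sum_(i < k) f i x) + (\sum_(i < k) f i x - g x)); last by ring.
have H1 : `|psum Coo n (x - x0) - psum (C k) n (x - x0)| <= e / 3.
  rewrite (_ : _ - _ = psum (fun a => Coo a - C k a) n (x - x0)); last first.
    by rewrite /psum -sumrB; apply: eq_bigr => a _; rewrite mulrBl.
  apply: le_trans (psum_le _ _ r0' (fun i => pdiscB i xr)) _.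
  apply: le_trans (pCoo k n) _.
  have := k1P k (leq_maxl _ _); rewrite distrC; apply: le_trans; exact: ler_norm.
have H2 := NP n nN; have H3 := k2P k (leq_maxr _ _).
apply: le_trans (ler_normD _ _) _; apply: le_trans (lerD (ler_normD _ _) (lexx _)) _.
lra.
Unshelve. all: by end_near. Qed.

End products.

Lemma analytic_at_PS (K : numFieldType) (m : nat) (x0 : 'rV[K]_m) (f : 'rV[K]_m -> K) :
  analytic_at f x0 -> exists rho B c, 0 < rho /\ PS x0 rho B f c.
Proof.
move=> [c [r r0 cf]]; pose s := r / 2; have s0 : 0 < s by rewrite divr_gt0.
have sr : s < r by rewrite ltr_pdivrMr// ltr_pMr// ltr1n.
have xb (x : 'rV[K]_m) : (forall i, `|x ord0 i - x0 ord0 i| <= s) -> ball x0 r x.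
  move=> xs; split=> // i j; rewrite (ord1 i) -ball_normE /ball_/= distrC.
  exact: le_lt_trans (xs j) sr.
(* At the corner of the polydisc of radius [s], absolute convergence is exactly boundedness of the
   weighted norms. *)
have [|[B cB] _] := cf (x0 + const_mx s).
  apply: xb => i; rewrite !mxE addrAC subrr add0r. rewrite ger0_norm. 2: exact: ltW. idtac. by [].
exists s, B, c; split=> //; split=> [N|x xs].
  apply: le_trans (cB N); rewrite box_psumE; apply: ler_sum => a _.
  rewrite ler_wpM2l// (_ : mon _ a = s ^+ mdeg a)// /mon /mdeg -prodrXr.
  by apply: eq_bigr => i _; rewrite !mxE addrAC subrr add0r ger0_norm// ltW.
have [_ cv] := cf x (xb x xs).
rewrite (_ : (fun _ => _) = (fun N => box_psum c N (x - x0)))//.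
by apply/funext => N; rewrite box_psumE.
Qed.

Section composition.
Variable R : realType.

Lemma geom_partial (z : R) n : z != 1 -> \sum_(k < n) z ^+ k = (1 - z ^+ n) / (1 - z).
Proof.
move=> z1; apply: (canRL (mulfK _)); first by rewrite subr_eq0 eq_sym.
by rewrite mulrC -[1 - z ^+ n]opprB subrX1 -mulNr opprB.
Qed.

Lemma geom_partial_le (z : R) n : 0 <= z < 1 -> \sum_(k < n) z ^+ k <= (1 - z)^-1.
Proof.
move=> /andP[z0 z1]; rewrite geom_partial ?lt_eqF// ler_pdivrMr ?subr_gt0//.
by rewrite mulVf ?gt_eqF ?subr_gt0// gerBl exprn_ge0.
Qed.

Lemma cvg_pow0 (z : R) : `|z| < 1 -> (fun n => z ^+ n) @ \oo --> 0.
Proof. exact: cvg_expr. Qed.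

Lemma cvg_geom (z : R) : `|z| < 1 -> (fun n => \sum_(k < n) z ^+ k) @ \oo --> (1 - z)^-1.
Proof.
move=> z1; have zn1 : z != 1.
  by apply/negP => /eqP z1E; move: z1; rewrite z1E normr1 ltxx.
rewrite (_ : (fun _ => _) = (fun n => (1 - z ^+ n) / (1 - z))); last first.
  by apply/funext => n; rewrite geom_partial.
rewrite -[X in _ --> X]mul1r; apply: cvgM; last exact: cvg_cst.
by rewrite -[X in _ --> X]subr0; apply: cvgB; [exact: cvg_cst|exact: cvg_pow0].
Qed.

Section fixed_center.
Variables (m : nat) (x0 : 'rV[R]_m).
Local Notation An := (An x0).
Local Notation pdisc := (pdisc x0).
Implicit Types (u f g : 'rV[R]_m -> R).

Lemma An_inv rho u b : 0 < rho -> An rho u b -> b < 1 ->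
  An rho (fun x => (1 + u x)^-1) (1 - b)^-1.
Proof.
move=> r0 ub b1; have r0' := ltW r0; have b0 := An_ge0 r0' ub.
apply: (@An_series _ _ _ _ (fun n x => (- u x) ^+ n) (fun n => b ^+ n)) => //.
- by move=> n; apply: AnX => //; exact: AnN.
- by move=> n; apply: geom_partial_le; rewrite b0.
move=> x xr; rewrite -[X in 1 + X]opprK; apply: cvg_geom.
by rewrite normrN; exact: le_lt_trans (An_bound r0' ub xr) b1.
Qed.

End fixed_center.

(** A monomial of degree [d] in the coordinates of [g - y0] has norm at most [rho ^+ d], so
    substitution turns the weighted norm of [f] into a summable majorant. *)
Lemma An_comp (m m' : nat) (x0 : 'rV[R]_m) (y0 : 'rV[R]_m') (f : 'rV[R]_m' -> R)
    (g : 'rV[R]_m -> 'rV[R]_m') (rho rho' B : R) :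
  0 < rho -> 0 < rho' -> An y0 rho f B ->
  (forall i, An x0 rho' (fun x => g x ord0 i - y0 ord0 i) rho) ->
  An x0 rho' (fun x => f (g x)) B.
Proof.
move=> r0 r0' [c [cB cf]] gr; have r'0 := ltW r0'.
(* Successive differences: the terms of the series are the increments from one box to the next, so
   its partial sums are the box sums. *)
pose pv (u : nat -> R) n := if n is n'.+1 then u n - u n' else u 0%N.
have pvS u n : \sum_(k < n.+1) pv u k = u n.
  elim: n => [|n IH]; first by rewrite big_ord1.
  by rewrite big_ord_recr IH/= addrC subrK.
apply: (@An_series _ _ _ _ (fun n x => pv (fun n => psum c n (g x - y0)) n)
  (pv (pnorm rho c))) => //.
- have mA (a : {ffun 'I_m' -> nat}) :
      An x0 rho' (fun x => c a * mon (g x - y0) a) (`|c a| * rho ^+ mdeg a).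
    apply: AnZ; rewrite /mdeg -prodrXr.
    apply: (@An_prod _ _ _ _ _ _ (fun i x => (g x - y0) ord0 i ^+ a i)) => // i.
    by apply: AnX => //; apply: An_ext (gr i) => x _; rewrite !mxE.
  case=> [|n] /=; first exact: An_sum.
  have sb := @sub_mbox m' _ _ (leqnSn n).
  rewrite {1}/pnorm (sum_uniq_sub _ (mbox_uniq m' n.+1) (mbox_uniq m' n) sb).
  rewrite addrAC subrr add0r.
  apply: An_ext (An_sum _ r'0 (fun a _ => mA a)) => x _.
  rewrite /psum (sum_uniq_sub _ (mbox_uniq m' n.+1) (mbox_uniq m' n) sb).
  by rewrite addrAC subrr add0r.
- case=> [|n]; last by rewrite pvS.
  by rewrite big_ord0; apply: le_trans (cB 0%N); exact/pnorm_ge0/ltW.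
- move=> x xr; rewrite -(cvg_shiftn 1)/=.
  under eq_fun => n do rewrite addn1 pvS.
  by apply: cf => i; apply: An_bound (gr i) xr.
Qed.

Lemma PS_analytic_at (m : nat) (x0 : 'rV[R]_m) rho B (f : 'rV[R]_m -> R) :
  0 < rho -> An x0 rho f B -> analytic_at f x0.
Proof.
move=> r0 [c [cB cf]]; exists c, rho => // x [_ /(_ ord0) xr].
have xr' i : `|(x - x0) ord0 i| <= rho.
  by rewrite !mxE distrC; have /ltW := xr i.
split; last first.
  rewrite (_ : (fun _ => _) = (fun N => psum c N (x - x0))).
  2: by apply/funext => N; rewrite box_psumE.
  by apply: cf => i; have := xr' i; rewrite !mxE.
exists B => N; rewrite box_psumE; apply: le_trans (cB N); apply: ler_sum => a _.
rewrite ler_wpM2l//; apply: le_trans (ler_norm _) _; apply: mon_le; first exact: ltW.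
by move=> i; rewrite mxE normr_id.
Qed.

Lemma rV_entry_le (m : nat) (h : 'rV[R]_m) i : `|h ord0 i| <= `|h|.
Proof.
rewrite [leRHS]mx_normrE.
exact: (le_bigmax _ (fun ij : 'I_1 * 'I_m => `|h ij.1 ij.2|) (ord0, i)).
Qed.

(** Recentring is composition with a translation: on radius [s] around [x], the coordinates relative
    to [x0] have norm at most [|x0 - x| + s <= rho]. *)
Lemma An_analytic_at (m : nat) (x0 : 'rV[R]_m) rho B (f : 'rV[R]_m -> R) x :
  An x0 rho f B -> `|x0 - x| < rho -> analytic_at f x.
Proof.
move=> fB xr.
pose s := (rho - `|x0 - x|) / 2; have s0 : 0 < s by rewrite divr_gt0// subr_gt0.
have xs : `|x0 - x| + s <= rho by rewrite /s; lra.
have r0 : 0 < rho by exact: le_lt_trans xr.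
have /(An_comp r0 s0 fB)/(PS_analytic_at s0)// :
    forall i, An x s (fun y => y ord0 i - x0 ord0 i) rho.
move=> i; have H1 := An_coord x i (ltW s0).
have H2 := An_cst x (x ord0 i - x0 ord0 i) (ltW s0).
apply: An_le (An_ext _ (AnD (ltW s0) H1 H2)); last by move=> y _; rewrite addrA subrK.
apply: le_trans xs; rewrite addrC lerD2r distrC.
by have := rV_entry_le (x0 - x) i; rewrite !mxE.
Qed.

(** The derivative of the remainder is the remainder of a geometric series, at most
    [b ^+ n / (1 - b)] in absolute value; the mean value theorem from 0 concludes. *)
Lemma ln_taylor (y b : R) n : `|y| <= b -> b < 1 ->
  `|ln (1 + y) - \sum_(k < n) - (- y) ^+ k.+1 / k.+1%:R| <= b ^+ n / (1 - b).
Proof.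
move=> yb b1.
have b0 : 0 <= b by exact: le_trans yb.
pose phi (t : R) := ln (1 + t) - \sum_(k < n) - (- t) ^+ k.+1 / k.+1%:R.
pose dphi (t : R) := (1 + t)^-1 - \sum_(k < n) (- t) ^+ k.
have d1 (t : R) k : is_derive t 1 (fun t : R => - (- t) ^+ k.+1 / k.+1%:R) ((- t) ^+ k).
  have H : is_derive t 1 ((- k.+1%:R^-1) *: ((- (@id R)) ^+ k.+1))
      ((- k.+1%:R^-1) *: ((k.+1%:R * (- t) ^+ k) *: (-1))).
    exact: is_deriveZ.
  rewrite (_ : (fun _ => _) = (- k.+1%:R^-1) *: ((- (@id R)) ^+ k.+1)).
    apply: is_derive_eq; rewrite /GRing.scale/= mulrN1 mulrNN mulrA mulVf ?mul1r//.
  by apply/funext => u; rewrite !fctE /GRing.scale/= !mulNr mulrC.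
have dphiP (t : R) : `|t| <= b -> is_derive t 1 phi (dphi t).
  move=> tb; have tl := ler_norml t b; rewrite tb in tl; have /andP[tl1 tl2] := esym tl.
  apply: is_deriveB.
    have H1 : is_derive t 1 (fun t : R => 1 + t) 1.
      have H0 : is_derive t 1 (cst 1 + @id R) (0 + 1) by exact: is_deriveD.
      by rewrite add0r in H0.
    have H2 : is_derive (1 + t) 1 (@ln R) (1 + t)^-1 by apply: is_derive1_ln; lra.
    by have := is_derive1_comp H2 H1; rewrite mulr1.
  have H := is_derive_sum (fun i : 'I_n => d1 t i).
  rewrite (_ : (fun x : R => \sum_(k < n) - (- x) ^+ k.+1 / k.+1%:R) =
    \sum_(k < n) (fun x : R => - (- x) ^+ k.+1 / k.+1%:R))//.
  by apply/funext => u; rewrite fct_sumE.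
have dphi_le t : `|t| <= b -> `|dphi t| <= b ^+ n / (1 - b).
  move=> tb; have t1 : - t != 1.
    by apply/negP => /eqP tE; move: tb; rewrite -normrN tE normr1; lra.
  have tl := ler_norml t b; rewrite tb in tl; have /andP[tl1 tl2] := esym tl.
  rewrite /dphi geom_partial// opprK -[X in X - _]mul1r -mulrBl opprB addrC subrK.
  rewrite normrM normrX normrN; apply: ler_pM => //.
    by rewrite lerXn2r ?nnegrE.
  by rewrite normfV lef_pV2 ?posrE ?normr_gt0; try lra; rewrite ger0_norm; lra.
have phi0 : phi 0 = 0.
  rewrite /phi addr0 ln1 sub0r big1 ?oppr0// => k _.
  by rewrite expr0n/= oppr0 mul0r.
have C0 : 0 <= b ^+ n / (1 - b) by rewrite divr_ge0 ?exprn_ge0// subr_ge0 ltW.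
have mvt (u v : R) : u <= v -> `|u| <= b -> `|v| <= b ->
    `|phi v - phi u| <= b ^+ n / (1 - b) * `|v - u|.
  move=> uv ub vb.
  have inb (t : R) : t \in `[u, v] -> `|t| <= b.
    rewrite in_itv/= => /andP[ut tv]; rewrite ler_norml.
    move: ub vb; rewrite !ler_norml => /andP[ub _] /andP[_ vb].
    by rewrite (le_trans ub)// (le_trans tv).
  have [||t tuv ->] := @MVT_segment R phi dphi u v uv.
  - by move=> t tuv; apply/dphiP/inb; exact: subset_itv_oo_cc.
  - apply: derivable_within_continuous => t tuv.
    by have [] := dphiP t (inb t tuv).
  by rewrite normrM ler_wpM2r// dphi_le// inb.
have n0 : `|0 : R| <= b by rewrite normr0.
rewrite -[X in `|X| <= _]/(phi y) -[phi y]subr0 -phi0.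
have yb1 : `|y| <= 1 by rewrite (le_trans yb)// ltW.
have [y0|/ltW y0] := leP 0 y.
  apply: le_trans (mvt 0 y y0 n0 yb) _; rewrite subr0 -[leRHS]mulr1.
  by rewrite ler_wpM2l.
rewrite distrC; apply: le_trans (mvt y 0 y0 yb n0) _; rewrite sub0r normrN -[leRHS]mulr1.
by rewrite ler_wpM2l.
Qed.

Lemma An_ln (m : nat) (x0 : 'rV[R]_m) rho u b : 0 < rho -> An x0 rho u b -> b < 1 ->
  An x0 rho (fun x => ln (1 + u x)) (b / (1 - b)).
Proof.
move=> r0 ub b1; have r0' := ltW r0; have b0 := An_ge0 r0' ub.
apply: (@An_series _ _ _ _ (fun n x => - (- u x) ^+ n.+1 / n.+1%:R) (fun n => b * b ^+ n)) => //.
- move=> n; have H := AnZ (n.+1%:R^-1) (AnN (AnX n.+1 r0' (AnN ub))).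
  apply: An_le (An_ext _ H); last by move=> x _; rewrite mulrC.
  rewrite ger0_norm ?invr_ge0// -exprS ler_piMl ?exprn_ge0//.
  by rewrite invf_le1// ler1n.
- move=> n; rewrite -mulr_sumr ler_wpM2l// geom_partial_le// b0//.
move=> x xr; have uxb := An_bound r0' ub xr.
apply: (@cvg_dominated _ _ (fun n => b ^+ n / (1 - b))).
  rewrite -(mul0r (1 - b)^-1); apply: cvgM; last exact: cvg_cst.
  by apply: cvg_pow0; rewrite ger0_norm.
by move=> n; rewrite distrC; exact: ln_taylor.
Qed.

End composition.

(** * Integrals of families of power series *)

(** Uniqueness of base-[k] digits; it makes the substitution that merges several variables into one
    injective on exponents. *)
Lemma digits_inj (m k : nat) (a b : 'I_m -> nat) :
  (forall i, a i < k)%N -> (forall i, b i < k)%N ->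
  (\sum_i a i * k ^ i = \sum_i b i * k ^ i)%N -> a =1 b.
Proof.
elim: m a b => [|m IH] a b ak bk; first by move=> _ [].
rewrite !big_ord_recl !expn0 !muln1.
have E (u : 'I_m.+1 -> nat) : (\sum_(i < m) u (lift ord0 i) * k ^ lift ord0 i =
    k * \sum_(i < m) u (lift ord0 i) * k ^ i)%N.
  by rewrite big_distrr/=; apply: eq_bigr => i _; rewrite /bump/= add1n expnS mulnCA.
rewrite !E => H.
have H0 : a ord0 = b ord0.
  have := congr1 (modn^~ k) H; rewrite !(addnC (_ ord0)) !(mulnC k) !modnMDl.
  by rewrite !modn_small.
have k0 : (0 < k)%N by apply: leq_ltn_trans (ak ord0).
have HS : (fun i => a (lift ord0 i)) =1 (fun i => b (lift ord0 i)).
  apply: IH => //.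
  move: H; rewrite H0 => /addnI/eqP; rewrite eqn_pmul2l// => /eqP.
  by [].
by move=> i; case: (unliftP ord0 i) => [j ->|->].
Qed.

Section real_integral.
Variables (d : measure_display) (T : measurableType d) (R : realType).
Variable mu : {measure set T -> \bar R}.
Implicit Types f g : T -> R.

Definition rintegrable f := mu.-integrable [set: T] (EFin \o f).

Lemma rintegrable_le f g : measurable_fun [set: T] f -> (forall t, `|f t| <= g t) -> rintegrable g -> rintegrable f.
Proof.
move=> mf fg; apply: le_integrable => //; first exact/measurable_EFinP.
by move=> t _ /=; rewrite lee_fin (le_trans (fg t))// ler_norm.
Qed.

Lemma rintegrable_measurable f : rintegrable f -> measurable_fun [set: T] f.
Proof. by move=> /integrableP[/measurable_EFinP]. Qed.

Lemma rintegrableZl k f : rintegrable f -> rintegrable (fun t => k * f t).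
Proof.
move=> fi; rewrite /rintegrable (_ : EFin \o _ = (fun x => k%:E * (f x)%:E)%E).
  exact: integrableZl.
by apply/funext => x /=; rewrite EFinM.
Qed.

Lemma rintegrableD f g : rintegrable f -> rintegrable g -> rintegrable (fun t => f t + g t).
Proof.
move=> fi gi; rewrite /rintegrable (_ : EFin \o _ = (EFin \o f) \+ (EFin \o g))//.
exact: integrableD.
Qed.

Lemma rintegrable0 : rintegrable (fun=> 0).
Proof. exact: integrable0. Qed.

Lemma rintegrable_sum (I : Type) (s : seq I) (P : pred I) (f : I -> T -> R) :
  (forall i, P i -> rintegrable (f i)) -> rintegrable (fun t => \sum_(i <- s | P i) f i t).
Proof.
move=> fi; elim: s => [|i s IH].
  by rewrite (_ : (fun t => _) = (fun=> 0)); [exact: rintegrable0|apply/funext => t; rewrite big_nil].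
case: (boolP (P i)) => Pi.
  rewrite (_ : (fun t => _) = (fun t => f i t + \sum_(j <- s | P j) f j t)).
    by apply: rintegrableD => //; exact: fi.
  by apply/funext => t; rewrite big_cons Pi.
by rewrite (_ : (fun t => _) = (fun t => \sum_(j <- s | P j) f j t))//;
  apply/funext => t; rewrite big_cons (negbTE Pi).
Qed.

Lemma Rintegral_sum (I : Type) (s : seq I) (P : pred I) (f : I -> T -> R) :
  (forall i, P i -> rintegrable (f i)) ->
  \int[mu]_t (\sum_(i <- s | P i) f i t) = \sum_(i <- s | P i) \int[mu]_t f i t.
Proof.
move=> fi; elim: s => [|i s IH].
  under eq_Rintegral => t _ do rewrite big_nil.
  by rewrite big_nil /Rintegral integral0.
rewrite big_cons; case: ifPn => Pi; last first.
  by rewrite -IH; apply: eq_Rintegral => t _; rewrite big_cons (negbTE Pi).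
rewrite -IH -RintegralD//; first by apply: eq_Rintegral => t _; rewrite big_cons Pi.
- exact: fi.
- exact: rintegrable_sum.
Qed.

End real_integral.

Section coefficient_measurability.
Variables (d : measure_display) (T : measurableType d) (R : realType).

(** By induction on the order, each coefficient is a pointwise limit of quotients of measurable
    functions along [rho / n.+1]. Since pointwise limits suffice, [C] may depend on [t]. *)
Lemma taylor_measurable (g : T -> R -> R) (a : nat -> T -> R) (rho : R) : 0 < rho ->
  (forall s, 0 < s <= rho -> measurable_fun [set: T] (g ^~ s)) ->
  (forall t n, exists C, forall s, 0 < s <= rho ->
     `|g t s - \sum_(k < n) a k t * s ^+ k| <= C * s ^+ n) ->
  forall k, measurable_fun [set: T] (a k).
Proof.
move=> r0 mg ga; elim/ltn_ind => k IH.
pose s n : R := rho / n.+1%:R.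
have s0 n : 0 < s n <= rho.
  by rewrite divr_gt0//= ler_pdivrMr// ler_peMr ?ler1n// ltW.
apply: (@measurable_fun_cvg _ _ _ _ (fun n t => (g t (s n) - \sum_(i < k) a i t * s n ^+ i) / s n ^+ k)).
  move=> n; apply: measurable_funM => //; apply: measurable_funB; first exact: mg.
  by apply: measurable_sum => i; apply: measurable_funM => //; exact: IH.
move=> t _; have [C CP] := ga t k.+1.
have sn0 : s @ \oo --> 0.
  rewrite -(mulr0 rho); apply: cvgM; first exact: cvg_cst.
  exact: cvg_harmonic.
apply: (@cvg_dominated _ _ (fun n => C * s n)).
  by rewrite -(mulr0 C); apply: cvgM => //; exact: cvg_cst.
move=> n; have /andP[sn1 sn2] := s0 n; have := CP (s n) (s0 n).
have sk : 0 < s n ^+ k by rewrite exprn_gt0.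
rewrite big_ord_recr/= opprD addrA => H.
rewrite -[a k t](mulfK (lt0r_neq0 sk)) -mulrBl normrM normfV (gtr0_norm sk).
by rewrite ler_pdivrMr// -mulrA -exprS.
Qed.

Variables (m : nat) (x0 : 'rV[R]_m).
Local Notation mi := {ffun 'I_m -> nat}.

(* Restricting to lines gives the homogeneous parts; evaluating these at
   w_i = s ^ ((k+1) ^ i) separates their monomials. *)
Lemma coef_measurable (rho : R) (B : T -> R) (f : T -> 'rV[R]_m -> R) (c : T -> mi -> R) :
  0 < rho -> (forall t, PS x0 rho (B t) (f t) (c t)) ->
  (forall x, pdisc x0 rho x -> measurable_fun [set: T] (f ^~ x)) ->
  forall a, measurable_fun [set: T] (c ^~ a).
Proof.
move=> r0 cf mf.
have mh (w : 'rV[R]_m) k : (forall i, `|w ord0 i| <= 1) ->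
    measurable_fun [set: T] (fun t => hsum (c t) k w).
  move=> w1; move: k; apply: (@taylor_measurable (fun t s => f t (x0 + s *: w)) _ rho) => //.
    move=> s /andP[s0 sr]; apply: mf => i; rewrite !mxE addrAC subrr add0r normrM.
    by rewrite gtr0_norm// -[leRHS]mulr1 ler_pM// ltW.
  move=> t n; exists (B t / rho ^+ n) => s /andP[s0 sr].
  under eq_bigr => k _ do rewrite mulrC.
  apply: le_trans (PS_line n r0 (cf t) _ w1) _; first by rewrite ltW.
  by rewrite expr_div_n mulrC mulrA mulrAC.
move=> a; set k := mdeg a.
pose e (b : mi) := (\sum_i b i * k.+1 ^ i)%N.
pose w (s : R) : 'rV[R]_m := \row_i s ^+ (k.+1 ^ i).
have wE s (b : mi) : mon (w s) b = s ^+ e b.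
  rewrite /mon /e -prodrXr; apply: eq_bigr => i _.
  by rewrite mxE -exprM mulnC.
pose al n t := \sum_(b <- mbox m k.+1 | (mdeg b == k) && (e b == n)) c t b.
have mal n : measurable_fun [set: T] (al n).
  move: n; apply: (@taylor_measurable (fun t s => hsum (c t) k (w s)) _ 1) => //.
    move=> s /andP[s0 s1]; apply: mh => i; rewrite mxE normrX gtr0_norm//.
    by rewrite exprn_ile1// ltW.
  move=> t n; exists (\sum_(b <- mbox m k.+1 | mdeg b == k) `|c t b|) => s /andP[s0 s1].
  rewrite /hsum (eq_bigr (fun b => c t b * s ^+ e b)); last by move=> b _; rewrite wE.
  rewrite (_ : \sum_(j < n) _ = \sum_(b <- mbox m k.+1 | (mdeg b == k) && (e b < n)%N) c t b * s ^+ e b).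
    rewrite (bigID (fun b => (e b < n)%N))/= addrAC subrr add0r.
    apply: le_trans (ler_norm_sum _ _ _) _; rewrite mulr_suml big_mkcondr/=.
    apply: ler_sum => b _; case: ifPn => [|_].
      rewrite -leqNgt => nb; rewrite normrM ler_wpM2l// normrX gtr0_norm//.
      by rewrite ler_wiXn2l// ltW.
    by rewrite mulr_ge0// exprn_ge0// ltW.
  rewrite /al; under eq_bigr => j _ do rewrite mulr_suml big_mkcondr.
  rewrite exchange_big/= big_mkcondr; apply: eq_bigr => b _.
  rewrite -big_mkcond/=; case: ltnP => bn.
    by rewrite (big_pred1 (Ordinal bn))// => j; rewrite -val_eqE/= eq_sym.
  by rewrite big1// => j /eqP bj; move: (ltn_ord j); rewrite -bj ltnNge bn.
(* Exponents of degree [k] are digits below [k.+1], so [a] is the only multi-index with code [e a]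
   and the sum [al] reduces to one coefficient. *)
have := mal (e a); congr (measurable_fun _ _); apply/funext => t.
rewrite /al big_mkcond (bigD1_seq a) ?mbox_uniq ?mbox_mdeg//= !eqxx/= big_seq_cond big1 ?addr0//.
move=> b /andP[bk ba]; case: ifPn => // /andP[_ /eqP eab]; case/eqP: ba.
apply/ffunP; apply: (digits_inj _ _ eab) => i; last by rewrite ltnS leq_mdeg.
by move: bk; rewrite mem_mbox => /forallP.
Qed.

End coefficient_measurability.

Section analytic_integral.
Variables (d : measure_display) (T : measurableType d) (R : realType).
Variable mu : {measure set T -> \bar R}.
Variables (m : nat) (x0 : 'rV[R]_m).

Lemma An_rintegrable (rho : R) (B : T -> R) (f : T -> 'rV[R]_m -> R) x :
  0 <= rho -> (forall t, An x0 rho (f t) (B t)) -> pdisc x0 rho x ->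
  measurable_fun [set: T] (f ^~ x) -> rintegrable mu B -> rintegrable mu (f ^~ x).
Proof.
move=> r0 fB xr mf; apply: rintegrable_le => // t; exact: An_bound (fB t) xr.
Qed.

(** Coefficients are integrated one by one, which is legitimate because [coef_measurable] makes them
    measurable and [B] dominates them. [B] also dominates all partial sums, so the integrated series
    has the right value. *)
Lemma An_integral (rho : R) (B : T -> R) (f : T -> 'rV[R]_m -> R) :
  0 < rho -> (forall t, An x0 rho (f t) (B t)) ->
  (forall x, pdisc x0 rho x -> measurable_fun [set: T] (f ^~ x)) ->
  rintegrable mu B -> An x0 rho (fun x => \int[mu]_t f t x) (\int[mu]_t B t).
Proof.
move=> r0 /choice[c cP] mf Bi; have r0' := ltW r0.
have mc := coef_measurable r0 cP mf.
have cB t a : `|c t a| * rho ^+ mdeg a <= B t.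
  by apply: pnorm_term => // N; case: (cP t).
have ci a : rintegrable mu (c ^~ a).
  have := rintegrableZl (rho ^+ mdeg a)^-1 Bi; apply: rintegrable_le => // t.
  by rewrite mulrC ler_pdivlMr ?exprn_gt0.
have ti a k : rintegrable mu (fun t => c t a * k).
  by have := rintegrableZl k (ci a); congr (rintegrable _ _); apply/funext => t; rewrite mulrC.
have tE a k : \int[mu]_t (c t a * k) = (\int[mu]_t c t a) * k.
  rewrite mulrC -RintegralZl//; first by apply: eq_Rintegral => t _; rewrite mulrC.
  exact: ci.
have tni a k : rintegrable mu (fun t => `|c t a| * k).
  have := rintegrableZl k (integrable_norm (ci a)); congr (rintegrable _ _).
  by apply/funext => t; rewrite mulrC.
exists (fun a => \int[mu]_t c t a); split=> [N|x xr].
  apply: (@le_trans _ _ (\int[mu]_t pnorm rho (c t) N)); last first.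
    by apply: le_Rintegral => //; [exact: rintegrable_sum|move=> t _; case: (cP t)].
  rewrite Rintegral_sum//; apply: ler_sum => a _.
  rewrite [leRHS](_ : _ = (\int[mu]_t `|c t a|) * rho ^+ mdeg a); last first.
    rewrite mulrC -RintegralZl//; first by apply: eq_Rintegral => t _; rewrite mulrC.
    exact: (integrable_norm (ci a)).
  by rewrite ler_wpM2r ?exprn_ge0//; apply: le_normr_Rintegral => //; exact: ci.
rewrite (_ : (fun _ => _) = (fun N => \int[mu]_t psum (c t) N (x - x0))); last first.
  by apply/funext => N; rewrite Rintegral_sum//; apply: eq_bigr => a _; rewrite tE.
apply: fine_cvg; rewrite fineK; last first.
  apply: integrable_fin_num => //.
  exact: (An_rintegrable r0' (fun t => ex_intro _ _ (cP t)) xr (mf x xr) Bi).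
apply: (@dominated_cvg _ _ _ mu [set: T] measurableT
  (fun N t => (psum (c t) N (x - x0))%:E) (fun t => (f t x)%:E) (EFin \o B)) => //.
- by move=> N; apply/measurable_EFinP; apply: rintegrable_measurable; exact: rintegrable_sum.
- by move=> t _; apply: cvg_EFin; [exact: nearW|case: (cP t) => _; exact].
- move=> N t _; rewrite /= lee_fin; have [cN _] := cP t; apply: le_trans (cN N).
  by apply: psum_le => // i; exact: pdiscB.
Qed.

End analytic_integral.

(** * Cauchy estimates *)

Local Notation Re := (@complex.Re _).
Local Notation Im := (@complex.Im _).

Section complex_modulus.
Variable R : realType.
Local Notation C := (R[i])%C.
Implicit Types (z w : C).

(** The norm of [R[i]] is itself a complex number in a partial order; this is the modulus as an
    element of the ordered field [R]. *)
Definition nC z : R := ComplexField.Normc.normc z.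

Lemma nC_sqr z : nC z ^+ 2 = Re z ^+ 2 + Im z ^+ 2.
Proof. by case: z => a b; rewrite /nC/= sqr_sqrtr// addr_ge0// sqr_ge0. Qed.

Lemma nC_ge0 z : 0 <= nC z.
Proof. by case: z => a b; exact: sqrtr_ge0. Qed.

Lemma normCE z : `|z| = (nC z)%:C%C.
Proof. by rewrite normc_def; case: z. Qed.

Lemma ltr_nC z (b : R) : (`|z| < b%:C%C) = (nC z < b).
Proof. by rewrite normCE ltcR. Qed.

Lemma nCD z w : nC (z + w) <= nC z + nC w.
Proof. exact: le_normcD. Qed.

Lemma nCN z : nC (- z) = nC z.
Proof. exact: normcN. Qed.

Lemma nCB z w : nC (z - w) <= nC z + nC w.
Proof. by rewrite -[nC w]nCN; exact: nCD. Qed.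

Lemma nC_dist z w : nC (z - w) = nC (w - z).
Proof. by rewrite -nCN opprB. Qed.

Lemma nCM z w : nC (z * w) = nC z * nC w.
Proof. exact: ComplexField.Normc.normcM. Qed.

Lemma nCV z : nC z^-1 = (nC z)^-1.
Proof. exact: ComplexField.Normc.normcV. Qed.

Lemma nC0 : nC 0 = 0.
Proof. exact: ComplexField.Normc.normc0. Qed.

Lemma nC1 : nC 1 = 1.
Proof. exact: ComplexField.Normc.normc1. Qed.

Lemma nCX z n : nC (z ^+ n) = nC z ^+ n.
Proof. by elim: n => [|n IH]; rewrite ?expr0 ?nC1// !exprS nCM IH. Qed.

Lemma nC_eq0 z : (nC z == 0) = (z == 0).
Proof.
by apply/eqP/eqP => [|->]; [exact: ComplexField.Normc.eq0_normc|exact: nC0].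
Qed.

Lemma nC_gt0 z : z != 0 -> 0 < nC z.
Proof. by move=> z0; rewrite lt_def nC_eq0 z0 nC_ge0. Qed.

Lemma nC_sum (I : Type) (s : seq I) (P : pred I) (F : I -> C) :
  nC (\sum_(i <- s | P i) F i) <= \sum_(i <- s | P i) nC (F i).
Proof.
elim: s => [|i s IH]; first by rewrite !big_nil nC0.
by rewrite !big_cons; case: ifP => // _; apply: le_trans (nCD _ _) _; rewrite lerD2l.
Qed.

Lemma nC_Re z : `|Re z| <= nC z.
Proof.
by rewrite -(@ler_pXn2r _ 2) ?nnegrE ?nC_ge0// nC_sqr real_normK ?num_real// lerDl sqr_ge0.
Qed.

Lemma nC_Im z : `|Im z| <= nC z.
Proof.
by rewrite -(@ler_pXn2r _ 2) ?nnegrE ?nC_ge0// nC_sqr [leRHS]addrC real_normK ?num_real// lerDl sqr_ge0.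
Qed.

Lemma nC_real (x : R) : nC x%:C%C = `|x|.
Proof. by rewrite /nC/= expr0n/= addr0 sqrtr_sqr. Qed.

Lemma nC_le_ReIm z : nC z <= `|Re z| + `|Im z|.
Proof.
rewrite -(@ler_pXn2r _ 2) ?nnegrE ?nC_ge0 ?addr_ge0// nC_sqr sqrrD !real_normK ?num_real//.
by rewrite addrAC lerDl mulrn_wge0// mulr_ge0.
Qed.

Lemma nC_sub_le z w : nC z - nC w <= nC (z - w).
Proof. by rewrite lerBlDr -{1}(subrK w z) nCD. Qed.

End complex_modulus.

(** * The maximum principle for functions with second-order expansions *)

Section max_principle.
Variable R : realType.
Local Notation C := (R[i])%C.
Implicit Types (g : C -> C) (t h : C).

(** The form of holomorphy on which the maximum principle is based: a quadratic polynomial in the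
    complex increment, up to a cubic error. *)
Definition taylor3 g t := exists b0 b1 b2 : C, exists K delta : R,
  0 < delta /\ forall h, nC h <= delta ->
    nC (g (t + h) - (b0 + b1 * h + b2 * h ^+ 2)) <= K * nC h ^+ 3.

Lemma taylor3_val g t b0 b1 b2 (K delta : R) : 0 < delta ->
  (forall h, nC h <= delta ->
    nC (g (t + h) - (b0 + b1 * h + b2 * h ^+ 2)) <= K * nC h ^+ 3) -> b0 = g t.
Proof.
move=> d0 /(_ 0); rewrite nC0 (ltW d0) => /(_ isT).
rewrite !expr0n/= !mulr0 !addr0 => H; apply/eqP; rewrite eq_sym -subr_eq0 -nC_eq0.
by rewrite eq_le nC_ge0 andbT.
Qed.

Lemma taylor3_continuous g t : taylor3 g t -> forall e : R, 0 < e ->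
  exists2 eta, 0 < eta & forall h, nC h <= eta -> nC (g (t + h) - g t) <= e.
Proof.
move=> [b0 [b1 [b2 [K [delta [d0 H]]]]]] e e0.
have E := taylor3_val d0 H; pose M := nC b1 + nC b2 + `|K| + 1.
have M0 : 0 < M by rewrite /M ltr_wpDl// !addr_ge0// nC_ge0.
exists (Num.min delta (Num.min 1 (e / M))) => [|h].
  by rewrite !lt_min d0 ltr01 divr_gt0.
rewrite !le_min => /and3P[hd h1 he].
have h0 := nC_ge0 h.
rewrite (_ : g (t + h) - g t = (g (t + h) - (b0 + b1 * h + b2 * h ^+ 2)) +
  (b1 * h + b2 * h ^+ 2)); last by rewrite E; ring.
apply: le_trans (nCD _ _) _; apply: le_trans (lerD (H h hd) (nCD _ _)) _.
rewrite (nCM b1) (nCM b2) nCX.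
have h2 : nC h ^+ 2 <= nC h by rewrite expr2 ler_piMl.
have h3 : nC h ^+ 3 <= nC h by rewrite exprS ler_piMr// exprn_ile1.
apply: (@le_trans _ _ (M * nC h)); last by rewrite mulrC -ler_pdivlMr.
rewrite /M !mulrDl mul1r.
have : K * nC h ^+ 3 <= `|K| * nC h.
  apply: le_trans (ler_wpM2r (exprn_ge0 _ h0) (ler_norm K)) _.
  by rewrite ler_wpM2l.
have : nC b2 * nC h ^+ 2 <= nC b2 * nC h by rewrite ler_wpM2l ?nC_ge0.
lra.
Qed.

(** A discrete mean value inequality: over the four increments [h] of modulus [e] along the axes,
    [h] and its square both sum to zero, hence all cross terms cancel and only squares remain. *)
Lemma four_directions (b0 b1 b2 : C) (e : R) (A := fun h : C => b0 + b1 * h + b2 * h ^+ 2) :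
  4 * nC b0 ^+ 2 <= nC (A (e +i* 0)%C) ^+ 2 + nC (A (- e +i* 0)%C) ^+ 2 +
    nC (A (0 +i* e)%C) ^+ 2 + nC (A (0 +i* - e)%C) ^+ 2.
Proof.
rewrite !nC_sqr /A; case: b0 b1 b2 @A => [a0 a0'] [a1 a1'] [a2 a2'] _ /=.
rewrite [leRHS](_ : _ = 4 * (a0 ^+ 2 + a0' ^+ 2) + 4 * (a1 ^+ 2 + a1' ^+ 2) * e ^+ 2
  + 4 * (a2 ^+ 2 + a2' ^+ 2) * (e ^+ 2) ^+ 2); last by ring.
have H (u v w : R) : 0 <= 4 * (u ^+ 2 + v ^+ 2) * w ^+ 2.
  by apply: mulr_ge0; rewrite ?sqr_ge0//; apply: mulr_ge0 => //; rewrite addr_ge0 ?sqr_ge0.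
by rewrite -addrA lerDl addr_ge0 ?H.
Qed.

Definition square (s : R) : set C := [set t | `|Re t| <= s /\ `|Im t| <= s].

(* At a maximum point of [|g|^2 + eps |t|^2] inside the square, the
   second-order expansion in four directions contradicts maximality. *)
Lemma max_square g (s M : R) : 0 < s -> (forall t, square s t -> taylor3 g t) ->
  (forall t, square s t -> `|Re t| = s \/ `|Im t| = s -> nC (g t) <= M) ->
  forall t, square s t -> nC (g t) <= M.
Proof.
move=> s0 g3 gM.
have M0 : 0 <= M.
  have S : square s (s%:C)%C by split; rewrite /= ?normr0 ?gtr0_norm// ltW.
  apply: le_trans (gM _ S _); first exact: nC_ge0.
  by left; rewrite /= gtr0_norm.
(* [2 * s ^+ 2] bounds the squared modulus on the square; letting [e] tend to 0 removes this
   term. *)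
suff H (e : R) : 0 < e -> forall t, square s t -> nC (g t) ^+ 2 <= M ^+ 2 + e * (2 * s ^+ 2).
  move=> t ts; rewrite -(@ler_pXn2r _ 2) ?nnegrE ?nC_ge0//.
  apply/ler_addgt0Pr => e e0.
  have c0 : 0 < 2 * s ^+ 2 by rewrite mulr_gt0// exprn_gt0.
  by have := H (e / (2 * s ^+ 2)) (divr_gt0 e0 c0) t ts; rewrite divfK ?gt_eqF.
move=> e0.
pose T (p : R * R) : C := (p.1 +i* p.2)%C.
pose psi (p : R * R) : R := nC (g (T p)) * nC (g (T p)) + e * (p.1 * p.1 + p.2 * p.2).
have psiE p : psi p = nC (g (T p)) ^+ 2 + e * (p.1 ^+ 2 + p.2 ^+ 2) by rewrite /psi; ring.
pose A : set (R * R) := `[- s, s]%classic `*` `[- s, s]%classic.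
have AT p : A p <-> square s (T p).
  by rewrite /A /square /T/= !in_itv/= !ler_norml.
have cA : compact A by apply: compact_setX; exact: segment_compact.
have A0 : A !=set0 by exists (0, 0); apply/AT; rewrite /square/= normr0 ltW.
have cpsi : {within A, continuous psi}.
  apply: continuous_in_subspaceT => p; rewrite inE => /AT Tp.
  suff cg : {for p, continuous (fun p => nC (g (T p)))}.
    apply: cvgD; first exact: cvgM.
    by apply: cvgM; [exact: cvg_cst|apply: cvgD; apply: cvgM; (exact: cvg_fst || exact: cvg_snd)].
  rewrite /continuous_at; apply/(@cvgrPdist_le _ _ _ (nbhs p)) => e' e'0.
  have [eta eta0 etaP] := taylor3_continuous (g3 _ Tp) e'0.
  have e2 : 0 < eta / 2 by rewrite divr_gt0.
  have F1 : \forall q \near nbhs p, `|p.1 - q.1| <= eta / 2.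
    by apply: (@cvgr_dist_le _ _ _ (nbhs p) _ (fst : R * R -> R)) => //; exact: cvg_fst.
  have F2 : \forall q \near nbhs p, `|p.2 - q.2| <= eta / 2.
    by apply: (@cvgr_dist_le _ _ _ (nbhs p) _ (snd : R * R -> R)) => //; exact: cvg_snd.
  near=> q; have h1 : `|p.1 - q.1| <= eta / 2 by near: q.
  have h2 : `|p.2 - q.2| <= eta / 2 by near: q.
  have hh : nC (T q - T p) <= eta.
    apply: le_trans (nC_le_ReIm _) _.
    rewrite [Re _](_ : _ = q.1 - p.1)// [Im _](_ : _ = q.2 - p.2)//.
    by rewrite (distrC q.1) (distrC q.2) (le_trans (lerD h1 h2))// -splitr.
  have := etaP _ hh; rewrite (addrC (T p)) subrK => H.
  rewrite ler_distl; have := nC_sub_le (g (T q)) (g (T p)).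
  have := nC_sub_le (g (T p)) (g (T q)); rewrite [nC (g (T p) - _)]nC_dist; lra.
have [p pA pmax] := compact_EVT_max A0 cA cpsi.
have {}pA : A p by rewrite inE in pA.
have Tp := (AT p).1 pA.
have bd (q : R * R) : A q -> q.1 ^+ 2 + q.2 ^+ 2 <= 2 * s ^+ 2.
  move=> /AT[/= q1 q2]; rewrite mulrDl mul1r -(real_normK (num_real q.1)) -(real_normK (num_real q.2)).
  by rewrite lerD// lerXn2r ?nnegrE// ltW.
suff pM : nC (g (T p)) <= M.
  move=> t ts; have tA : A (Re t, Im t) by apply/AT; case: t ts.
  have := pmax (Re t, Im t); rewrite inE => /(_ tA); rewrite !psiE/=.
  have -> : T (Re t, Im t) = t by case: t {ts tA}.
  have := bd p pA => H1 H2.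
  have H3 : nC (g (T p)) ^+ 2 <= M ^+ 2 by rewrite lerXn2r ?nnegrE ?nC_ge0.
  have H4 : 0 <= Re t ^+ 2 + Im t ^+ 2 by rewrite addr_ge0// sqr_ge0.
  have H5 : e * (p.1 ^+ 2 + p.2 ^+ 2) <= e * (2 * s ^+ 2) by rewrite ler_wpM2l// ltW.
  have H6 : 0 <= e * (Re t ^+ 2 + Im t ^+ 2) by rewrite mulr_ge0// ltW.
  lra.
have [/eqP H|H1] := boolP (`|Re (T p)| == s); first by apply: gM => //; left.
have [/eqP H|H2] := boolP (`|Im (T p)| == s); first by apply: gM => //; right.
exfalso.
have {}H1 : `|p.1| < s by rewrite lt_neqAle H1; case: Tp.
have {}H2 : `|p.2| < s by rewrite lt_neqAle H2; case: Tp.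
have [b0 [b1 [b2 [K [delta [d0 H]]]]]] := g3 _ Tp.
have E := taylor3_val d0 H.
pose L := nC b0 + nC b1 + nC b2.
have L0 : 0 <= L by rewrite !addr_ge0 ?nC_ge0.
(* Maximality summed over four steps of length [eta] loses [4 * e * eta ^+ 2] from the quadratic
   term, against a cubic error of at most [4 * (D - 1) * eta ^+ 3]. The bound [eta <= e / D / 2]
   makes the loss strictly larger. *)
pose D := 2 * L * `|K| + 1.
have D0 : 0 < D by rewrite /D ltr_wpDl// !mulr_ge0.
pose eta := Num.min (Num.min delta 1) (Num.min (Num.min (s - `|p.1|) (s - `|p.2|)) (e / D / 2)).
have eta0 : 0 < eta by rewrite !lt_min d0 ltr01 !subr_gt0 H1 H2 !divr_gt0.
have : eta <= eta by []; rewrite {2}/eta !le_min => /andP[/andP[hd h1] /andP[/andP[hp1 hp2] he]].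
pose Ah (h : C) := b0 + b1 * h + b2 * h ^+ 2.
have key (h : C) (q : R * R) : nC h = eta -> T q = T p + h -> A q ->
    nC (Ah h) ^+ 2 <= nC b0 ^+ 2 + e * (p.1 ^+ 2 + p.2 ^+ 2) - e * (q.1 ^+ 2 + q.2 ^+ 2) + (D - 1) * eta ^+ 3.
  move=> hE qE qA; have := pmax q; rewrite inE => /(_ qA); rewrite !psiE qE -E => H3.
  have H4 := H h; rewrite hE in H4; have {H4}H5 := H4 hd.
  have H6 : nC (Ah h) <= L.
    apply: le_trans (nCD _ _) _; apply: le_trans (lerD (nCD _ _) (lexx _)) _.
    rewrite (nCM b1) (nCM b2) nCX hE /L; apply: lerD; first rewrite lerD2l.
      by rewrite ler_piMr ?nC_ge0.
    by rewrite ler_piMr ?nC_ge0// exprn_ile1// ltW.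
  have H7 := nC_sub_le (Ah h) (g (T p + h)).
  rewrite nC_dist in H7.
  have H8 : K * eta ^+ 3 <= `|K| * eta ^+ 3.
    by rewrite ler_wpM2r ?ler_norm// exprn_ge0// ltW.
  set a := nC (Ah h) in H6 H7 *; set b := nC (g (T p + h)) in H3 H7.
  have a0 : 0 <= a := nC_ge0 _. have b_0 : 0 <= b := nC_ge0 _.
  have H9 : a - b <= `|K| * eta ^+ 3 by apply: le_trans H7 _; apply: le_trans H5 H8.
  have H10 : a ^+ 2 <= b ^+ 2 + 2 * L * (`|K| * eta ^+ 3).
    have k0 : 0 <= `|K| * eta ^+ 3 by rewrite mulr_ge0// exprn_ge0// ltW.
    have [ab|ab] := leP a b.
      have : a ^+ 2 <= b ^+ 2 by rewrite lerXn2r ?nnegrE.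
      have : 0 <= 2 * L * (`|K| * eta ^+ 3) by apply: mulr_ge0 => //; apply: mulr_ge0.
      lra.
    have -> : a ^+ 2 = b ^+ 2 + (a + b) * (a - b) by ring.
    rewrite lerD2l; apply: ler_pM; lra.
  rewrite /D; lra.
have F := four_directions b0 b1 b2 eta.
have sq (x y : R) : `|p.1 + x| <= s -> `|p.2 + y| <= s -> A (p.1 + x, p.2 + y).
  by move=> ? ?; apply/AT.
have nn (x : R) : `|x| = eta -> `|p.1 + x| <= s /\ `|p.2 + x| <= s.
  by move=> xE; split; apply: le_trans (ler_normD _ _) _; rewrite xE; lra.
have [ne nem] : `|eta| = eta /\ `|- eta| = eta by rewrite normrN gtr0_norm.
have [P1 P2] := nn _ ne; have [P3 P4] := nn _ nem.
have [q1 q2] : `|p.1 + 0| <= s /\ `|p.2 + 0| <= s by rewrite !addr0 !ltW.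
have nh (x y : R) : x ^+ 2 + y ^+ 2 = eta ^+ 2 -> nC (x +i* y)%C = eta.
  by rewrite /nC/= => ->; rewrite sqrtr_sqr gtr0_norm.
have TD (x y : R) : T (p.1 + x, p.2 + y) = T p + (x +i* y)%C by [].
have K1 : nC (Ah (eta +i* 0)%C) ^+ 2 <= _ :=
  key _ (p.1 + eta, p.2 + 0) (nh _ _ _) (TD _ _) (sq _ _ P1 q2).
have K2 : nC (Ah (- eta +i* 0)%C) ^+ 2 <= _ :=
  key _ (p.1 - eta, p.2 + 0) (nh _ _ _) (TD _ _) (sq _ _ P3 q2).
have K3 : nC (Ah (0 +i* eta)%C) ^+ 2 <= _ :=
  key _ (p.1 + 0, p.2 + eta) (nh _ _ _) (TD _ _) (sq _ _ q1 P2).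
have K4 : nC (Ah (0 +i* - eta)%C) ^+ 2 <= _ :=
  key _ (p.1 + 0, p.2 - eta) (nh _ _ _) (TD _ _) (sq _ _ q1 P4).
have {}K1 := K1 ltac:(by rewrite expr0n addr0).
have {}K2 := K2 ltac:(by rewrite sqrrN expr0n addr0).
have {}K3 := K3 ltac:(by rewrite expr0n add0r).
have {}K4 := K4 ltac:(by rewrite sqrrN expr0n add0r).
rewrite -/Ah in F.
have : e * (4 * eta ^+ 2) <= 4 * ((D - 1) * eta ^+ 3).
  move: F K1 K2 K3 K4; rewrite /=; lra.
have : (D - 1) * eta ^+ 3 <= e / 2 * eta ^+ 2.
  have -> : (D - 1) * eta ^+ 3 = ((D - 1) * eta) * eta ^+ 2 by ring.
  rewrite ler_wpM2r ?sqr_ge0//.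
  have : D * eta <= e / 2 by rewrite mulrC -ler_pdivlMr// -mulrAC.
  have : 0 < eta by []; lra.
have : 0 < e * eta ^+ 2 by rewrite mulr_gt0// exprn_gt0.
lra.
Unshelve. all: by end_near. Qed.

End max_principle.

(** * Cauchy's estimate in one variable, by repeated division *)

Section schwarz.
Variable R : realType.
Local Notation C := (R[i])%C.
Implicit Types (g : C -> C) (t h : C) (a : nat -> C).

(** An asymptotic expansion at 0 to every order, with constants depending on the order; convergence
    is a later consequence of [schwarz]. *)
Definition taylor g a := forall n, exists K delta : R, 0 < delta /\
  forall h, nC h <= delta -> nC (g h - \sum_(k < n) a k * h ^+ k) <= K * nC h ^+ n.

Lemma taylor_taylor3 g a : taylor g a -> taylor3 g 0.
Proof.
move=> /(_ 3%N)[K [delta [d0 H]]]; exists (a 0%N), (a 1%N), (a 2%N), K, delta; split=> // h hd.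
by rewrite add0r; have := H h hd; rewrite !big_ord_recr big_ord0/= add0r expr0 mulr1 expr1.
Qed.

Lemma taylor_val g a : taylor g a -> g 0 = a 0%N.
Proof.
move=> /(_ 1%N)[K [delta [d0 H]]]; have := H 0; rewrite nC0 => /(_ (ltW d0)).
rewrite big_ord_recr big_ord0/= add0r expr0 mulr1 expr1 mulr0 => G.
by apply/eqP; rewrite -subr_eq0 -nC_eq0 eq_le nC_ge0 andbT.
Qed.

(** The singularity at 0 is removable; the expansion of [g] dictates the value there. *)
Definition shift_quot g a t := if t == 0 then a 1%N else (g t - a 0%N) / t.

Lemma taylor_shift g a : taylor g a -> taylor (shift_quot g a) (fun k => a k.+1).
Proof.
move=> ga n; have [K [delta [d0 H]]] := ga n.+1; exists (`|K| + nC (a 1%N)), delta; split=> // h hd.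
rewrite /shift_quot; case: eqP => [->|/eqP h0].
  case: n {H} => [|n]; first by rewrite big_ord0 subr0 expr0 mulr1 lerDr.
  rewrite big_ord_recl expr0 mulr1 big1 ?addr0 ?subrr ?nC0 ?mulr_ge0 ?addr_ge0 ?nC_ge0 ?exprn_ge0//.
  by move=> i _; rewrite lift0 expr0n mulr0.
have h1 := nC_gt0 h0.
rewrite (_ : _ - _ = (g h - \sum_(k < n.+1) a k * h ^+ k) / h); last first.
  rewrite big_ord_recl expr0 mulr1 opprD addrA [RHS]mulrBl mulr_suml; congr (_ - _).
  by apply: eq_bigr => i _; rewrite lift0 exprSr mulrA mulfK.
rewrite nCM nCV ler_pdivrMr// -mulrA -exprSr; apply: le_trans (H h hd) _.
rewrite ler_wpM2r ?exprn_ge0 ?nC_ge0// (le_trans (ler_norm K))// lerDl; exact: nC_ge0.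
Qed.

Lemma taylor3_shift g a t : t != 0 -> taylor3 g t -> taylor3 (shift_quot g a) t.
Proof.
move=> t0 [b0 [b1 [b2 [K [delta [d0 H]]]]]].
(* Division of the local polynomial by [t + h]: these coefficients reproduce it after
   multiplication, up to the cubic term [c2 * h ^+ 3]. *)
pose c0 := (b0 - a 0%N) / t; pose c1 := (b1 - c0) / t; pose c2 := (b2 - c1) / t.
have nt := nC_gt0 t0.
exists c0, c1, c2, ((`|K| + nC c2) / (nC t / 2)), (Num.min delta (nC t / 2)); split.
  by rewrite lt_min d0 divr_gt0.
move=> h; rewrite le_min => /andP[hd ht].
have th : nC t / 2 <= nC (t + h).
  by have := nC_sub_le t (- h); rewrite opprK nCN; lra.
have th0 : t + h != 0 by rewrite -nC_eq0 gt_eqF// (lt_le_trans _ th)// divr_gt0.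
rewrite /shift_quot (negbTE th0).
have -> : (g (t + h) - a 0%N) / (t + h) - (c0 + c1 * h + c2 * h ^+ 2) =
    ((g (t + h) - (b0 + b1 * h + b2 * h ^+ 2)) - c2 * h ^+ 3) / (t + h).
  apply: (canRL (mulfK th0)); rewrite mulrBl divfK//.
  have E0 : b0 = c0 * t + a 0%N by rewrite /c0 divfK// subrK.
  have E1 : b1 = c1 * t + c0 by rewrite /c1 divfK// subrK.
  have E2 : b2 = c2 * t + c1 by rewrite /c2 divfK// subrK.
  rewrite {1}E0 {1}E1 {1}E2; ring.
have h0 := nC_ge0 h.
rewrite nCM nCV ler_pdivrMr ?(lt_le_trans _ th) ?divr_gt0//.
apply: (@le_trans _ _ ((`|K| + nC c2) * nC h ^+ 3)).
  apply: le_trans (nCB _ _) _; rewrite (nCM c2) nCX mulrDl lerD2r.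
  by apply: le_trans (H h hd) _; rewrite ler_wpM2r ?ler_norm// exprn_ge0.
rewrite [leRHS](_ : _ = (`|K| + nC c2) * nC h ^+ 3 * (nC (t + h) / (nC t / 2))); last by ring.
rewrite ler_peMr ?mulr_ge0 ?exprn_ge0 ?addr_ge0 ?nC_ge0//.
by rewrite ler_pdivlMr ?divr_gt0// mul1r.
Qed.

Lemma square_nC (r : R) t : 0 < r -> square (r / 2) t -> nC t < r.
Proof.
move=> r0 [t1 t2]; rewrite -(@ltr_pXn2r _ 2) ?nnegrE ?nC_ge0 ?(ltW r0)// nC_sqr.
have H (x : R) : `|x| <= r / 2 -> x ^+ 2 <= (r / 2) ^+ 2.
  by move=> xr; rewrite -(real_normK (num_real x)) lerXn2r ?nnegrE// (le_trans _ xr).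
have := H _ t1; have := H _ t2.
have -> : (r / 2) ^+ 2 = r ^+ 2 / 4 by rewrite expr_div_n -natrX.
have : 0 < r ^+ 2 by rewrite exprn_gt0.
lra.
Qed.

(** Schwarz's lemma is iterated on one fixed square. On its boundary the modulus of [t] is at least
    [r / 2], so removing the constant term of a function bounded by [B] and dividing by [t] gives at
    most [2 * B / (r / 2)]. The maximum principle carries this inside, and each degree costs the
    factor [4 / r]. *)
Lemma schwarz g a (r M : R) : 0 < r ->
  (forall t, nC t < r -> taylor3 g t) -> taylor g a ->
  (forall t, nC t < r -> nC (g t) <= M) ->
  forall n, nC (a n) <= M * (4 / r) ^+ n /\ forall t, square (r / 2) t ->
     nC (g t - \sum_(k < n) a k * t ^+ k) <= nC t ^+ n * (M * (4 / r) ^+ n).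
Proof.
move=> r0 g3 ga gM n.
have r2 : 0 < r / 2 by rewrite divr_gt0.
have S0 : square (r / 2) 0 by split; rewrite /= normr0 ltW.
suff [f [fE f3 fM fa]] : exists f, [/\ forall t, square (r / 2) t -> g t = \sum_(k < n) a k * t ^+ k + t ^+ n * f t,
    forall t, nC t < r -> taylor3 f t, forall t, square (r / 2) t -> nC (f t) <= M * (4 / r) ^+ n &
    taylor f (fun k => a (n + k)%N)].
  split; first by have := fM 0 S0; rewrite (taylor_val fa) addn0.
  move=> t tr; rewrite (fE t tr) addrAC subrr add0r nCM nCX.
  by rewrite ler_wpM2l ?exprn_ge0 ?nC_ge0// fM.
elim: n => [|n [f [fE f3 fM fa]]].
  exists g; split=> //.
  - by move=> t _; rewrite big_ord0 add0r expr0 mul1r.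
  - by move=> t /(square_nC r0) tr; rewrite expr0 mulr1 gM.
pose fn := shift_quot f (fun k => a (n + k)%N).
have fn3 t : nC t < r -> taylor3 fn t.
  have [->|t0] := eqVneq t 0; first by move=> _; exact: taylor_taylor3 (taylor_shift fa).
  by move=> tr; apply: taylor3_shift => //; exact: f3.
exists fn; split=> //.
- move=> t tr; rewrite (fE t tr) big_ord_recr/= -addrA; congr (_ + _).
  rewrite /fn /shift_quot; case: eqP => [->|/eqP t0].
    by rewrite (taylor_val fa) addn0 exprS mul0r mul0r addr0 mulrC.
  by rewrite exprSr -mulrA [t * _]mulrC divfK// addn0; ring.
- apply: max_square => // [t tr|t tr tb]; first exact/fn3/square_nC.
  have st : r / 2 <= nC t.
    by case: tb => <-; [exact: nC_Re|exact: nC_Im].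
  have t0 : t != 0 by rewrite -nC_eq0 gt_eqF// (lt_le_trans r2).
  rewrite /fn /shift_quot (negbTE t0) nCM nCV ler_pdivrMr ?nC_gt0//.
  apply: le_trans (nCB _ _) _.
  have f0 : nC (a (n + 0)%N) <= M * (4 / r) ^+ n by rewrite -(taylor_val fa) fM.
  apply: le_trans (lerD (fM t tr) f0) _.
  apply: (@le_trans _ _ (M * (4 / r) ^+ n.+1 * (r / 2))); last first.
    have B0 : 0 <= M * (4 / r) ^+ n by apply: le_trans f0; exact: nC_ge0.
    have B1 : 0 <= M * (4 / r) ^+ n.+1.
      rewrite (_ : _ * _ = M * (4 / r) ^+ n * (4 / r)); last by rewrite exprSr; ring.
      by apply: mulr_ge0 => //; apply: divr_ge0 => //; exact: ltW.
    by rewrite ler_wpM2l.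
  rewrite exprSr -!mulrA (_ : 4 * (r^-1 * (r / 2)) = 2); last by field; rewrite gt_eqF.
  by rewrite mulrA mulr_natr mulr2n.
- have := taylor_shift fa; congr (taylor _ _); apply/funext => k.
  by rewrite addnS.
Qed.

End schwarz.

(** * Sums, products and inverses of one-variable expansions *)

Section taylor_algebra.
Variable R : realType.
Local Notation C := (R[i])%C.
Implicit Types (f g : C -> C) (t h : C) (a b : nat -> C).

Lemma taylor_cst (k : C) : taylor (fun=> k) (fun i => if i == 0%N then k else 0).
Proof.
case=> [|n].
  by exists (nC k), 1; split=> // h _; rewrite big_ord0 subr0 expr0 mulr1.
exists 0, 1; split=> // h _; rewrite mul0r big_ord_recl/= expr0 mulr1 big1 ?addr0.
  by rewrite subrr nC0.
by move=> i _; rewrite mul0r.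
Qed.

Lemma taylor_ext f g a : (forall h, f h = g h) -> taylor f a -> taylor g a.
Proof. by move=> fg; rewrite (_ : g = f)//; apply/funext => h. Qed.

Lemma taylorD f g a b : taylor f a -> taylor g b ->
  taylor (fun h => f h + g h) (fun k => a k + b k).
Proof.
move=> fa gb n; have [K [d [d0 H]]] := fa n; have [K' [d' [d0' H']]] := gb n.
exists (K + K'), (Num.min d d'); split; first by rewrite lt_min d0.
move=> h; rewrite le_min => /andP[hd hd'].
rewrite [X in nC (X)](_ : _ = (f h - \sum_(k < n) a k * h ^+ k) + (g h - \sum_(k < n) b k * h ^+ k)).
  by apply: le_trans (nCD _ _) _; rewrite mulrDl lerD ?H ?H'.
by under eq_bigr => k _ do rewrite mulrDl; rewrite big_split/=; ring.
Qed.

Lemma taylorZ f a (k : C) : taylor f a -> taylor (fun h => k * f h) (fun i => k * a i).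
Proof.
move=> fa n; have [K [d [d0 H]]] := fa n; exists (nC k * K), d; split=> // h hd.
rewrite [X in nC (X)](_ : _ = k * (f h - \sum_(i < n) a i * h ^+ i)).
  by rewrite nCM -mulrA ler_wpM2l ?nC_ge0 ?H.
by rewrite mulrBr mulr_sumr; congr (_ - _); apply: eq_bigr => i _; rewrite mulrA.
Qed.

Lemma taylor_sum (I : Type) (s : seq I) (f : I -> C -> C) (a : I -> nat -> C) :
  (forall i, taylor (f i) (a i)) ->
  taylor (fun h => \sum_(i <- s) f i h) (fun k => \sum_(i <- s) a i k).
Proof.
move=> fa; elim: s => [|i s IH].
  have := taylor_cst 0; rewrite (_ : (fun i => _) = (fun k => \sum_(i <- [::]) a i k)).
    by apply: taylor_ext => h; rewrite big_nil.
  by apply/funext => k; rewrite big_nil; case: eqP.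
have := taylorD (fa i) IH; rewrite (_ : (fun k => _) = (fun k => \sum_(j <- i :: s) a j k)).
  by apply: taylor_ext => h; rewrite big_cons.
by apply/funext => k; rewrite big_cons.
Qed.

Lemma taylor_bounded f a : taylor f a -> exists K d : R, 0 < d /\ forall h, nC h <= d -> nC (f h) <= K.
Proof.
move=> /(_ 0%N)[K [d [d0 H]]]; exists K, d; split=> // h /H.
by rewrite big_ord0 subr0 expr0 mulr1.
Qed.

Definition cauchy a b (k : nat) : C := \sum_(i < k.+1) a i * b (k - i)%N.

(** Only terms of degree at least [n] survive, so for small [h] the difference is of order
    [h ^+ n]. *)
Lemma cauchy_partial a b n h :
  (\sum_(k < n) a k * h ^+ k) * (\sum_(k < n) b k * h ^+ k) - \sum_(k < n) cauchy a b k * h ^+ k =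
  \sum_(i < n) \sum_(j < n | (n <= i + j)%N) (a i * b j) * h ^+ (i + j).
Proof.
apply/eqP; rewrite subr_eq; apply/eqP; rewrite big_distrlr/=.
have -> : \sum_(k < n) cauchy a b k * h ^+ k =
    \sum_(i < n) \sum_(j < n | (i + j < n)%N) (a i * b j) * h ^+ (i + j).
  transitivity (\sum_(k < n) \sum_(i < n | (i <= k)%N) a i * b (k - i)%N * h ^+ k).
    apply: eq_bigr => k _; rewrite /cauchy mulr_suml.
    rewrite (big_ord_widen_cond n xpredT (fun i => a i * b (k - i)%N * h ^+ k))//=.
  rewrite (exchange_big_dep xpredT)//=; apply: eq_bigr => i _.
  rewrite [LHS](eq_bigl (fun k : 'I_n => (i <= k)%N))//.
  rewrite -(big_mkord (fun k => (i <= k)%N) (fun k => a i * b (k - i)%N * h ^+ k)).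
  rewrite -(big_mkord (fun j => (i + j < n)%N) (fun j => a i * b j * h ^+ (i + j))).
  rewrite (big_cat_nat _ (n := i))//=; last exact: ltnW.
  rewrite big_nat_cond big1 ?add0r; last by move=> k /andP[/andP[_ ki] ik]; lia.
  rewrite -{1}[nat_of_ord i]add0n big_addn [RHS](big_cat_nat _ (n := (n - i)%N))//=; last exact: leq_subr.
  rewrite [X in _ = _ + X]big_nat_cond [X in _ = _ + X]big1 ?addr0; last first.
    by move=> k /andP[/andP[nk _]]; lia.
  rewrite big_nat_cond [RHS]big_nat_cond; apply: eq_big => k; first by lia.
  by move=> _; rewrite addnK addnC.
rewrite -big_split/=; apply: eq_bigr => i _.
rewrite [LHS](bigID (fun j : 'I_n => (n <= i + j)%N))/=; congr (_ + _).
  by apply: eq_bigr => j _; rewrite exprD mulrACA.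
by apply: eq_big => j; rewrite ?ltnNge// => _; rewrite exprD mulrACA.
Qed.

Lemma taylorM f g a b : taylor f a -> taylor g b -> taylor (fun h => f h * g h) (cauchy a b).
Proof.
move=> fa gb n; have [K [d [d0 H]]] := fa n; have [K' [d' [d0' H']]] := gb n.
have [G [d2 [d20 HG]]] := taylor_bounded gb.
pose A := \sum_(i < n) nC (a i); pose S := \sum_(i < n) \sum_(j < n) nC (a i * b j).
exists (S + A * `|K'| + `|K| * `|G|), (Num.min (Num.min d d') (Num.min d2 1)); split.
  by rewrite !lt_min d0 d0' d20 ltr01.
move=> h; rewrite !le_min => /andP[/andP[hd hd'] /andP[hd2 h1]].
set An := \sum_(k < n) a k * h ^+ k; set Bn := \sum_(k < n) b k * h ^+ k.
rewrite [X in nC (X)](_ : _ = (An * Bn - \sum_(k < n) cauchy a b k * h ^+ k) + An * (g h - Bn) +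
  (f h - An) * g h); last by ring.
have h0 := nC_ge0 h.
apply: le_trans (nCD _ _) _; rewrite [leRHS]mulrDl; apply: lerD; last first.
  rewrite nCM mulrAC; apply: ler_pM; rewrite ?nC_ge0//.
    by apply: le_trans (H h hd) _; rewrite ler_wpM2r ?ler_norm// exprn_ge0.
  by apply: le_trans (HG h hd2) (ler_norm _).
apply: le_trans (nCD _ _) _; rewrite [leRHS]mulrDl; apply: lerD; last first.
  rewrite nCM -mulrA; apply: ler_pM; rewrite ?nC_ge0//.
    apply: le_trans (nC_sum _ _ _) _; apply: ler_sum => i _; rewrite nCM nCX.
    by rewrite ler_piMr ?nC_ge0// exprn_ile1.
  by apply: le_trans (H' h hd') _; rewrite ler_wpM2r ?ler_norm// exprn_ge0.
rewrite cauchy_partial /S mulr_suml; apply: le_trans (nC_sum _ _ _) _; apply: ler_sum => i _.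
apply: le_trans (nC_sum _ _ _) _; rewrite mulr_suml [leLHS]big_mkcond; apply: ler_sum => j _.
case: ifPn => nij; last by rewrite mulr_ge0 ?nC_ge0 ?exprn_ge0.
by rewrite (nCM (a i * b j)) nCX ler_wpM2l ?nC_ge0// ler_wiXn2l.
Qed.

(** A Neumann series truncated after [n] powers has error [(1 - f h / a 0) ^+ n / f h], of order [n]
    in [h]. Since the [j]-th power starts in degree [j], coefficient [k] involves only [j <= k]. *)
Lemma taylor_inv f a (p : nat -> nat -> C) : taylor f a -> a 0%N != 0 ->
  (forall j, taylor (fun h => (1 - f h / a 0%N) ^+ j) (p j)) ->
  (forall j k, (k < j)%N -> p j k = 0) ->
  taylor (fun h => (f h)^-1) (fun k => (a 0%N)^-1 * \sum_(j < k.+1) p j k).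
Proof.
move=> fa a0 pT p0 n.
have [K1 [d1 [d10 H1]]] := fa 1%N.
have [Kn [dn [dn0 Hn]]] := pT n n.
have [K [d [d0 H]]] := taylorZ (a 0%N)^-1 (taylor_sum (index_enum 'I_n) (fun j : 'I_n => pT j)) n.
have na := nC_gt0 a0.
exists (`|K| + `|Kn| / (nC (a 0%N) / 2)), (Num.min (Num.min d dn) (Num.min d1 (nC (a 0%N) / 2 / (`|K1| + 1)))).
have k1 : 0 < `|K1| + 1 by rewrite ltr_wpDl.
split; first by rewrite !lt_min d0 dn0 d10 !divr_gt0.
move=> h; rewrite !le_min => /andP[/andP[hd hdn] /andP[hd1 hK1]].
have fh : nC (a 0%N) / 2 <= nC (f h).
  have := H1 h hd1; rewrite big_ord_recr big_ord0/= add0r expr0 mulr1 expr1 => H2.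
  have := nC_sub_le (a 0%N) (f h); rewrite nC_dist => H3.
  have : K1 * nC h <= nC (a 0%N) / 2.
    move: hK1; rewrite ler_pdivlMr// mulrC; apply: le_trans.
    by rewrite ler_wpM2r ?nC_ge0// (le_trans (ler_norm K1))// lerDl.
  lra.
have fh0 : f h != 0 by rewrite -nC_eq0 gt_eqF// (lt_le_trans _ fh)// divr_gt0.
set u := 1 - f h / a 0%N in H Hn *.
pose S := (a 0%N)^-1 * \sum_(j < n) (1 - f h / a 0%N) ^+ j.
have SE : (f h)^-1 - S = (1 - f h / a 0%N) ^+ n / f h.
  apply: (canRL (mulfK fh0)); rewrite mulrBl mulVf// /S mulrC mulrA.
  have := subrX1 (1 - f h / a 0%N) n; set s := \sum_(i < n) _ => E.
  have -> : f h / a 0%N * s = - (((1 - f h / a 0%N) - 1) * s) by ring.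
  by rewrite -E; ring.
have -> : \sum_(k < n) (a 0%N)^-1 * (\sum_(j < k.+1) p j k) * h ^+ k =
    \sum_(k < n) (a 0%N)^-1 * (\sum_(j <- index_enum 'I_n) p j k) * h ^+ k.
  apply: eq_bigr => k _; congr (_ * _ * _).
  rewrite [RHS](bigID (fun j : 'I_n => (j < k.+1)%N))/= [X in _ = _ + X]big1 ?addr0.
    by rewrite (big_ord_widen n (fun j => p j k)).
  by move=> j; rewrite -leqNgt => kj; exact: p0.
rewrite -(subrKA S) addrC.
apply: le_trans (nCD _ _) _; rewrite [leRHS]mulrDl; apply: lerD.
  by apply: le_trans (H h hd) _; rewrite ler_wpM2r ?ler_norm// exprn_ge0// nC_ge0.
rewrite SE nCM nCV mulrAC; apply: ler_pM; rewrite ?nC_ge0 ?invr_ge0 ?nC_ge0//.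
  have := Hn h hdn; rewrite big1 ?subr0; last by move=> k _; rewrite p0 ?mul0r.
  by move=> H4; apply: le_trans H4 _; rewrite ler_wpM2r ?ler_norm// exprn_ge0// nC_ge0.
by rewrite lef_pV2// posrE ?divr_gt0// (lt_le_trans _ fh)// divr_gt0.
Qed.

End taylor_algebra.

Section homogeneous_convolution.
Variables (K : numFieldType) (m : nat).
Local Notation mi := {ffun 'I_m -> nat}.
Implicit Types (c d : mi -> K) (w : 'rV[K]_m).

(** On a line through the centre, multivariate convolution becomes the one-variable Cauchy
    product. *)
Lemma hsum_mconv c d k w :
  hsum (mconv c d) k w = \sum_(i < k.+1) hsum c i w * hsum d (k - i)%N w.
Proof.
pose G b g := (c b * mon w b) * (d g * mon w g).
transitivity (\sum_(b <- mbox m k.+1)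
    \sum_(g <- mbox m k.+1 | (madd b g \in mbox m k.+1) && (mdeg (madd b g) == k)) G b g).
  rewrite -(@conv_sumE m K G _ _ (fun a => mdeg a == k)) ?mbox_uniq//; last first.
    by move=> a b aN _; exact: mbox_mle.
  apply: eq_bigr => a _; rewrite /mconv mulr_suml; apply: eq_bigr => b ba.
  have E : a = madd b (msub a b) by apply/eqP; rewrite mle_madd.
  have -> : mon w a = mon w b * mon w (msub a b) by rewrite -monD -E.
  by rewrite /G mulrACA.
transitivity (\sum_(i < k.+1) \sum_(b <- mbox m k.+1 | mdeg b == i)
    \sum_(g <- mbox m k.+1 | mdeg g == (k - i)%N) G b g); last first.
  apply: eq_bigr => i _.
  rewrite (hsum_mbox _ _ (ltn_ord i)) (@hsum_mbox _ _ _ _ _ k.+1) ?ltnS ?leq_subr//.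
  by rewrite big_distrlr.
under [RHS]eq_bigr => i _ do rewrite big_mkcond.
rewrite exchange_big/=; apply: eq_bigr => b _.
rewrite -big_mkcond/=.
case: (ltnP (mdeg b) k.+1) => bk; last first.
  rewrite [RHS]big1; last by move=> i /eqP bi; move: (ltn_ord i); rewrite -bi ltnNge bk.
  rewrite big1// => g /andP[_]; rewrite mdeg_madd => /eqP H.
  by move: bk; rewrite -H ltnNge leq_addr.
rewrite (big_pred1 (Ordinal bk)); last by move=> i /=; rewrite -(inj_eq val_inj)/= eq_sym.
apply: eq_bigl => g; rewrite mdeg_madd/=; apply/idP/idP => [/andP[_ /eqP <-]|/eqP gk].
  by rewrite addKn.
rewrite gk subnKC// eqxx andbT mbox_mdeg// mdeg_madd gk subnKC//.
Qed.

End homogeneous_convolution.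

(** * Expansions in several complex variables and Cauchy's estimates *)

Section multivariate_taylor.
Variables (R : realType) (m : nat).
Local Notation C := (R[i])%C.
Local Notation mi := {ffun 'I_m -> nat}.
Implicit Types (c d : mi -> C) (F G : 'rV[C]_m -> C) (w a : 'rV[C]_m).

(* Expansions along complex lines avoid Hartogs-type arguments: they are stable
   under products and inverses, and suffice for Cauchy's estimates. *)
Definition Tex c F a := forall w, taylor (fun h => F (a + h *: w)) (fun k => hsum c k w).

Lemma hsum_scale c (k : C) n w : hsum (fun b => k * c b) n w = k * hsum c n w.
Proof. by rewrite /hsum mulr_sumr; apply: eq_bigr => b _; rewrite mulrA. Qed.

Lemma TexM c d F G a : Tex c F a -> Tex d G a -> Tex (mconv c d) (fun x => F x * G x) a.
Proof.
move=> cF dG w; have := taylorM (cF w) (dG w); congr (taylor _ _).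
by apply/funext => k; rewrite hsum_mconv.
Qed.

Lemma TexZ c F a (k : C) : Tex c F a -> Tex (fun b => k * c b) (fun x => k * F x) a.
Proof.
move=> cF w; have := taylorZ k (cF w); congr (taylor _ _).
by apply/funext => n; rewrite hsum_scale.
Qed.

Lemma TexD c d F G a : Tex c F a -> Tex d G a -> Tex (fun b => c b + d b) (fun x => F x + G x) a.
Proof.
move=> cF dG w; have := taylorD (cF w) (dG w); congr (taylor _ _).
apply/funext => n; rewrite /hsum -big_split/=; apply: eq_bigr => b _.
by rewrite mulrDl.
Qed.

Definition mdelta (k : C) : mi -> C := fun b => if b == m0 then k else 0.

Lemma Tex_cst (k : C) a : Tex (mdelta k) (fun=> k) a.
Proof.
move=> w; have := taylor_cst k; congr (taylor _ _); apply/funext => n.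
case: eqP => [->|/eqP n0]; first by rewrite hsum0 /mdelta eqxx.
rewrite /hsum big1// => b /eqP bn; rewrite /mdelta; case: eqP => [b0|]; last by rewrite mul0r.
by move: n0; rewrite -bn b0 mdeg0.
Qed.

Lemma Tex_val c F a : Tex c F a -> F a = c m0.
Proof.
by move=> /(_ 0)/taylor_val; rewrite scaler0 addr0 hsum0.
Qed.

Fixpoint mpow c j : mi -> C := if j is j'.+1 then mconv c (mpow c j') else mdelta 1.

Lemma mpow_lt c j b : c m0 = 0 -> (mdeg b < j)%N -> mpow c j b = 0.
Proof.
move=> c0; elim: j b => [//|j IH] b bj /=; rewrite /mconv big1// => g gb.
have [->|g0] := eqVneq g m0; first by rewrite c0 mul0r.
rewrite IH ?mulr0//; have E : b = madd g (msub b g) by apply/eqP; rewrite mle_madd.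
move: bj; rewrite {1}E mdeg_madd ltnS => H.
have : (0 < mdeg g)%N by rewrite lt0n mdeg_eq0.
by move: H; lia.
Qed.

(** The Neumann series of [taylor_inv] at the level of multivariate coefficients, so that one family
    of coefficients serves all lines at once. By [mpow_lt] the sum is finite in each degree. *)
Lemma TexV c F a : Tex c F a -> F a != 0 -> exists d, Tex d (fun x => (F x)^-1) a.
Proof.
move=> cF Fa; have E := Tex_val cF.
pose u b := mdelta 1 b + - (c m0)^-1 * c b.
have u0 : u m0 = 0 by rewrite /u /mdelta eqxx mulNr mulVf ?subrr// -E.
have uT : Tex u (fun x => 1 - F x / c m0) a.
  have := TexD (Tex_cst 1 a) (TexZ (- (c m0)^-1) cF); congr (Tex _ _ _).
  by apply/funext => x; rewrite mulNr mulrC.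
have pT j : Tex (mpow u j) (fun x => (1 - F x / c m0) ^+ j) a.
  elim: j => [|j IH] /=; first by have := Tex_cst 1 a; congr (Tex _ _ _).
  have := TexM uT IH; congr (Tex _ _ _); apply/funext => x; by rewrite exprS.
exists (fun b => (c m0)^-1 * \sum_(j < (mdeg b).+1) mpow u j b) => w.
have := @taylor_inv _ _ _ (fun j k => hsum (mpow u j) k w) (cF w).
rewrite hsum0 -E => /(_ Fa); rewrite E => /(_ (fun j => pT j w)) H.
have /H : forall j k, (k < j)%N -> hsum (mpow u j) k w = 0.
  by move=> j k kj; rewrite /hsum big1// => b /eqP bk; rewrite mpow_lt ?mul0r ?bk.
congr (taylor _ _); apply/funext => k.
rewrite hsum_scale; congr (_ * _); rewrite exchange_big/=; apply: eq_bigr => b /eqP bk.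
by rewrite mulr_suml bk.
Qed.

(** The polynomial ['X^n - 1] splits and is separable in characteristic 0; the roots of unity
    provide the finite Fourier averages of [hsum_coef_le]. *)
Lemma prim_root_exists n : (n > 0)%N -> exists z : C, n.-primitive_root z.
Proof.
pose p : {poly C} := 'X^n - 1; have [r Dp] := closed_field_poly_normal p.
move=> n_gt0; rewrite (monicP _) ?monicXnsubC // scale1r in Dp.
have rn1: all n.-unity_root r by apply/allP=> z; rewrite -root_prod_XsubC -Dp.
have sz_r: (n < (size r).+1)%N.
  by rewrite -(size_prod_XsubC r id) -Dp size_XnsubC.
have [|z] := hasP (cyclic.has_prim_root n_gt0 rn1 _ sz_r); last by exists z.
by rewrite -separable.separable_prod_XsubC -Dp cyclotomic.separable_Xn_sub_1 // pnatr_eq0 -lt0n.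
Qed.

(** A coefficient is the average of the homogeneous polynomial against a character over the points
    with coordinates among the roots of unity of order [k.+1]. Exponents of degree [k] are below
    [k.+1], so distinct multi-indices give orthogonal characters. *)
Lemma hsum_coef_le c k (B : R) : (forall w, (forall i, nC (w ord0 i) <= 1) -> nC (hsum c k w) <= B) ->
  forall b, mdeg b = k -> nC (c b) <= B.
Proof.
move=> cB b bk.
have [z zP] := prim_root_exists (ltn0Sn k).
have zn : z ^+ k.+1 = 1 by exact: prim_expr_order.
have nz : nC z = 1.
  apply/eqP; rewrite -(@pexpr_eq1 _ _ k.+1) ?nC_ge0//.
  by rewrite -nCX zn nC1.
have z0 : z != 0 by rewrite -nC_eq0 nz oner_eq0.
pose w (f : {ffun 'I_m -> 'I_k.+1}) : 'rV[C]_m := \row_i z ^+ f i.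
pose ch (g : mi) (f : {ffun 'I_m -> 'I_k.+1}) := \prod_i z^-1 ^+ (f i * g i)%N.
have nch g f : nC (ch g f) = 1.
  rewrite /ch; elim/big_rec: _ => [|i y _ IH]; first exact: nC1.
  by rewrite nCM nCX nCV nz invr1 expr1n mul1r.
have orth (g : mi) : g \in mbox m k.+1 ->
    \sum_f mon (w f) g * ch b f = if g == b then k.+1%:R ^+ m else 0.
  rewrite mem_mbox => /forallP gk.
  have bk' i : (b i < k.+1)%N by rewrite ltnS -bk leq_mdeg.
  rewrite (eq_bigr (fun f : {ffun 'I_m -> 'I_k.+1} => \prod_i (z ^+ g i / z ^+ b i) ^+ f i)); last first.
    move=> f _; rewrite /mon /ch -big_split/=; apply: eq_bigr => i _.
    by rewrite mxE expr_div_n -!exprM exprVn (mulnC (f i) (g i)) (mulnC (f i) (b i)).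
  rewrite -(bigA_distr_bigA (fun i (j : 'I_k.+1) => (z ^+ g i / z ^+ b i) ^+ j))/=.
  case: eqP => [->|gb].
    rewrite (eq_bigr (fun=> k.+1%:R)); first by rewrite prodr_const card_ord.
    move=> i _; rewrite (eq_bigr (fun=> 1)); first by rewrite sumr_const card_ord.
    by move=> j _; rewrite divff ?expr1n// expf_neq0.
  have [i gbi] : exists i, g i != b i.
    apply/not_existsP => H; apply: gb; apply/ffunP => i; apply/eqP.
    by have /negP := H i; rewrite negbK.
  rewrite (bigD1 i)//= [X in X * _](_ : _ = 0) ?mul0r//.
  have q1 : z ^+ g i / z ^+ b i != 1.
    apply: contra gbi => /eqP /(congr1 (fun y => y * z ^+ b i)).
    rewrite divfK ?expf_neq0// mul1r => /eqP; rewrite (eq_prim_root_expr zP).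
    by rewrite !modn_small.
  have := subrX1 (z ^+ g i / z ^+ b i) k.+1.
  rewrite expr_div_n -!exprM ![(_ * k.+1)%N]mulnC !exprM zn !expr1n invr1 mulr1 subrr.
  by move/esym/eqP; rewrite mulf_eq0 subr_eq0 (negbTE q1)/= => /eqP.
have cE : c b * k.+1%:R ^+ m = \sum_f hsum c k (w f) * ch b f.
  rewrite /hsum; under eq_bigr => f _ do rewrite mulr_suml.
  rewrite exchange_big/= big_seq_cond.
  rewrite (eq_bigr (fun g => c g * (if g == b then k.+1%:R ^+ m else 0))); last first.
    move=> g /andP[gN _]; rewrite -orth// mulr_sumr; apply: eq_bigr => f _.
    by rewrite mulrA.
  rewrite -big_seq_cond big_mkcond (bigD1_seq b) ?mbox_uniq ?mbox_mdeg ?bk//= !eqxx.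
  by rewrite big1 ?addr0// => g /negbTE ->; rewrite mulr0 if_same.
have kpos : 0 < (k.+1%:R : R) ^+ m by rewrite exprn_gt0.
rewrite -(ler_pM2r kpos).
have -> : nC (c b) * k.+1%:R ^+ m = nC (c b * k.+1%:R ^+ m).
  rewrite nCM nCX; congr (_ * _ ^+ _).
  by rewrite -(rmorph_nat (real_complex R)) nC_real ger0_norm.
rewrite cE; apply: le_trans (nC_sum _ _ _) _.
apply: (@le_trans _ _ (\sum_(f : {ffun 'I_m -> 'I_k.+1}) B)).
  apply: ler_sum => f _; rewrite nCM nch mulr1; apply: cB => i.
  by rewrite mxE nCX nz expr1n.
by rewrite sumr_const card_ffun !card_ord -[leLHS]mulr_natr natrX.
Qed.

Definition cdisc a (r : R) : set 'rV[C]_m := [set x | forall i, nC (x ord0 i - a ord0 i) < r].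

(** [schwarz] applies on every line with direction in the unit polydisc; [hsum_coef_le] then passes
    from homogeneous parts to single coefficients. *)
Lemma cauchy_estimate c F a (r M : R) : 0 < r ->
  (forall x, cdisc a r x -> exists d, Tex d F x) -> Tex c F a ->
  (forall x, cdisc a r x -> nC (F x) <= M) ->
  (forall b, nC (c b) <= M * (4 / r) ^+ mdeg b) /\
  (forall x : 'rV[C]_m, (forall i, nC (x ord0 i - a ord0 i) <= r / 8) -> forall n,
     nC (F x - \sum_(k < n) hsum c k (x - a)) <= M * 2^-1 ^+ n).
Proof.
move=> r0 Fx Fa FM.
have S w : (forall i, nC (w ord0 i) <= 1) -> forall n, nC (hsum c n w) <= M * (4 / r) ^+ n /\
    forall t, square (r / 2) t ->
     nC (F (a + t *: w) - \sum_(k < n) hsum c k w * t ^+ k) <= nC t ^+ n * (M * (4 / r) ^+ n).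
  move=> w1.
  have inD t : nC t < r -> cdisc a r (a + t *: w).
    move=> tr i; rewrite !mxE addrAC subrr add0r nCM.
    by apply: le_lt_trans tr; rewrite ler_piMr ?nC_ge0.
  apply: (@schwarz _ (fun t => F (a + t *: w)) (fun k => hsum c k w)) => //.
    move=> t /inD/Fx[d /(_ w) /taylor_taylor3]; case=> b0 [b1 [b2 [K [delta [d0 H]]]]].
    exists b0, b1, b2, K, delta; split=> // h /H; rewrite add0r.
    by rewrite scalerDl addrA.
  by move=> t /inD/FM.
split=> [b|x xr n].
  by apply: (@hsum_coef_le c (mdeg b)) => // w w1; case: (S w w1 (mdeg b)).
(* At modulus [r / 8] the factor [4 / r] per degree becomes one half. *)
pose t : C := (r / 8)%:C%C.
have r8 : 0 < r / 8 by rewrite divr_gt0.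
have t0 : t != 0 by rewrite -nC_eq0 nC_real normr_eq0 gt_eqF.
pose w := t^-1 *: (x - a).
have w1 i : nC (w ord0 i) <= 1.
  by rewrite !mxE nCM nCV nC_real gtr0_norm// mulrC ler_pdivrMr// mul1r.
have [_ /(_ t)] := S w w1 n.
have -> : a + t *: w = x by rewrite /w scalerA divff// scale1r addrC subrK.
have -> : \sum_(k < n) hsum c k w * t ^+ k = \sum_(k < n) hsum c k (x - a).
  by apply: eq_bigr => k _; rewrite mulrC -hsumZ /w scalerA divff// scale1r.
move=> H; apply: le_trans (H _) _.
  split; rewrite /= ?normr0; first rewrite gtr0_norm//; lra.
rewrite nC_real gtr0_norm// mulrCA -exprMn le_eqVlt; apply/orP; left; apply/eqP.
by congr (_ * _ ^+ _); field; rewrite gt_eqF.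
Qed.

End multivariate_taylor.

(** * Complex analytic functions as line expansions with continuity *)

Section complex_analytic.
Variables (R : realType) (m : nat).
Local Notation C := (R[i])%C.
Local Notation mi := {ffun 'I_m -> nat}.
Implicit Types (F G : 'rV[C]_m -> C) (w a : 'rV[C]_m) (x h : 'rV[R]_m).

Definition ccont F w := forall e : R, 0 < e -> exists2 eta : R, 0 < eta &
  forall v : 'rV[C]_m, (forall i, nC (v ord0 i - w ord0 i) <= eta) -> nC (F v - F w) <= e.

(** The remainder in [Tex] is not uniform over lines; joint continuity is therefore recorded
    separately, and it yields boundedness on compact polydiscs. *)
Definition cana F w := (exists d, Tex d F w) /\ ccont F w.

Lemma ler_cplx (z u : C) : z <= u -> nC z <= nC u \/ ~ (0 <= z).
Proof.
case: (boolP (0 <= z)) => z0 zu; last by right; exact/negP.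
left; have u0 := le_trans z0 zu.
by rewrite -lecR -!normCE !ger0_norm.
Qed.

(** Restates [PS_line] with constants in [R]: a positive complex radius is real, and comparison of
    norms becomes comparison of moduli. *)
Lemma PS_cplx_bound (F : 'rV[Cplx R]_m -> Cplx R) w (rho B : Cplx R) (c : mi -> Cplx R) :
  0 < rho -> PS w rho B F c -> exists rho0 B0 : R, 0 < rho0 /\
  forall (h : 'rV[C]_m) (s : R), 0 <= s <= rho0 -> (forall i, nC (h ord0 i) <= s) ->
  forall n, nC (F (w + h) - \sum_(k < n) hsum (c : mi -> C) k h) <= (s / rho0) ^+ n * B0.
Proof.
move=> r0 cF; exists (nC rho), (nC B); split; first by apply: nC_gt0; exact: lt0r_neq0.
have rE : rho = (nC rho)%:C%C :> C by rewrite -normCE ger0_norm// ltW.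
move=> h s /andP[s0 sr] hs n.
pose sc : C := s%:C%C; pose v : 'rV[C]_m := sc^-1 *: h.
have hE : h = sc *: v.
  have [s00|s00] := eqVneq s 0; last first.
    by rewrite scalerA divff ?scale1r// -nC_eq0 nC_real normr_eq0.
  apply/rowP => i; rewrite /v /sc s00 scale0r mxE; apply/eqP; rewrite -nC_eq0 eq_le nC_ge0 andbT.
  by have := hs i; rewrite s00.
have v1 i : `|(v : 'rV[Cplx R]_m) ord0 i| <= 1.
  rewrite [`|_|](normCE (v ord0 i)) -[1]/((1 : R)%:C%C) lecR !mxE nCM nCV nC_real ger0_norm//.
  have [->|s00] := eqVneq s 0; first by rewrite invr0 mul0r.
  by rewrite mulrC ler_pdivrMr ?mul1r// lt_def s00.
have s0r : 0 <= (sc : Cplx R) <= rho.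
  by rewrite {1}rE -[0]/((0 : R)%:C%C) !lecR s0.
have := @PS_line (Cplx R) m w rho B F c v sc n r0 cF s0r v1.
rewrite [X in `|X| <= _](_ : _ = F (w + h) - \sum_(k < n) hsum (c : mi -> C) k h); last first.
  rewrite hE; congr (_ - _); apply: eq_bigr => k _.
  exact: (esym (hsumZ (c : mi -> C) k sc v)).
rewrite (normCE (F (w + h) - \sum_(k < n) hsum (c : mi -> C) k h)) => H.
have [] := ler_cplx H; last by case; rewrite -[0]/((0 : R)%:C%C) lecR; exact: nC_ge0.
rewrite nC_real ger0_norm ?nC_ge0// => H'; apply: le_trans H' _.
rewrite [nC _](nCM ((sc / rho : C) ^+ n) B) nCX [nC (_ / _)](nCM (sc : C) _) nCV nC_real.
by rewrite (ger0_norm s0).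
Qed.

Lemma analytic_cana (F : 'rV[Cplx R]_m -> Cplx R) w : analytic_at F w -> cana F w.
Proof.
move=> /analytic_at_PS[rho [B [c [r0 cF]]]].
have [rho0 [B0 [r00 H]]] := PS_cplx_bound r0 cF.
split.
  exists c => u n.
  pose W : R := 1 + \sum_i nC (u ord0 i).
  have W0 : 0 < W by rewrite ltr_pwDl// sumr_ge0// => i _; exact: nC_ge0.
  have uW i : nC (u ord0 i) <= W.
    rewrite /W (bigD1 i)//= addrCA lerDl addr_ge0// sumr_ge0// => j _; exact: nC_ge0.
  exists ((W / rho0) ^+ n * B0), (rho0 / W); split; first by rewrite divr_gt0.
  move=> h; rewrite ler_pdivlMr// => hW.
  have := H (h *: u) (nC h * W) _ _ n.
  rewrite mulr_ge0 ?nC_ge0 ?(ltW W0)//= hW => /(_ isT) H1.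
  have /H1 H2 : forall i, nC ((h *: u) ord0 i) <= nC h * W.
    by move=> i; rewrite mxE nCM ler_wpM2l ?nC_ge0.
  under eq_bigr => k _ do rewrite mulrC -hsumZ.
  apply: le_trans H2 _; rewrite -mulrA exprMn le_eqVlt; apply/orP; left; apply/eqP; ring.
move=> e e0; exists (Num.min rho0 (e * rho0 / (2 * (`|B0| + 1)))).
  by rewrite lt_min r00 !divr_gt0 ?mulr_gt0// ltr_wpDl.
set s := Num.min _ _ => v vs.
have s0 : 0 <= s.
  by rewrite le_min (ltW r00) divr_ge0 ?mulr_ge0 ?(ltW e0) ?(ltW r00)// addr_ge0.
have sr : s <= rho0 by rewrite ge_min lexx.
have H1 := H (v - w) s _ _ 1%N; rewrite s0 sr in H1.
have {H1}: nC (F v - c m0) <= s / rho0 * B0.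
  have := H1 isT _; rewrite big_ord1 hsum0 expr1 [w + _]addrC subrK; apply.
  by move=> i; rewrite !mxE.
have := H 0 0 _ _ 1%N; rewrite lexx (ltW r00) big_ord1 hsum0 expr1 mul0r mul0r addr0 => /(_ isT).
have z0 : forall i, nC ((0 : 'rV[C]_m) ord0 i) <= 0 by move=> i; rewrite mxE nC0.
move=> /(_ z0) E; have {E}-> : c m0 = F w :> C.
  by apply/eqP; rewrite eq_sym -subr_eq0 -nC_eq0 eq_le nC_ge0 andbT.
move=> H1; apply: le_trans H1 _.
apply: (@le_trans _ _ (s / rho0 * (`|B0| + 1))).
  by rewrite ler_wpM2l ?divr_ge0 ?(ltW r00)// (le_trans (ler_norm _))// lerDl.
have b0 : 0 < `|B0| + 1 by rewrite ltr_wpDl.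
rewrite mulrAC ler_pdivrMr// -ler_pdivlMr//.
rewrite /s ge_min; apply/orP; right; rewrite ler_wpM2l ?mulr_ge0 ?(ltW e0) ?(ltW r00)//.
rewrite lef_pV2 ?posrE ?mulr_gt0//. lra.
Qed.

Lemma cana_mul F G w : cana F w -> cana G w -> cana (fun v => F v * G v) w.
Proof.
move=> [[c cF] Fc] [[d dG] Gc]; split; first by exists (mconv c d); exact: TexM.
move=> e e0; pose L := nC (F w) + nC (G w) + 1 + 1.
have L0 : 0 < L by rewrite /L !ltr_wpDl ?addr_ge0 ?nC_ge0.
pose e' := Num.min 1 (e / 2 / L).
have e'0 : 0 < e' by rewrite lt_min ltr01 !divr_gt0.
have [eta1 eta10 H1] := Fc e' e'0; have [eta2 eta20 H2] := Gc e' e'0.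
exists (Num.min eta1 eta2); first by rewrite lt_min eta10.
move=> v vw.
have m1 : Num.min eta1 eta2 <= eta1 by rewrite ge_min lexx.
have m2 : Num.min eta1 eta2 <= eta2 by rewrite ge_min lexx orbT.
have {}H1 := H1 v (fun i => le_trans (vw i) m1).
have {}H2 := H2 v (fun i => le_trans (vw i) m2).
rewrite (_ : _ - _ = F v * (G v - G w) + (F v - F w) * G w); last by ring.
apply: le_trans (nCD _ _) _; rewrite (nCM (F v)) (nCM (F v - F w)).
have e1 : e' <= 1 by rewrite ge_min lexx.
have eL : e' * L <= e / 2 by rewrite -ler_pdivlMr// ge_min lexx orbT.
have fv : nC (F v) <= nC (F w) + 1.
  by have := nC_sub_le (F v) (F w); lra.
have := nC_ge0 (F v); have := nC_ge0 (G w); have := nC_ge0 (F w) => f0 g0 v0.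
have k1 : nC (F v) * nC (G v - G w) <= L * e'.
  by apply: ler_pM; rewrite ?nC_ge0// /L; lra.
have k2 : nC (F v - F w) * nC (G w) <= e' * L.
  by apply: ler_pM; rewrite ?nC_ge0// /L; lra.
lra.
Qed.

Lemma cana_inv F w : cana F w -> F w != 0 -> cana (fun v => (F v)^-1) w.
Proof.
move=> [[c cF] Fc] Fw; split; first exact: TexV cF Fw.
move=> e e0; pose L := nC (F w); have L0 : 0 < L := nC_gt0 Fw.
have e'0 : 0 < Num.min (L / 2) (e * (L * L / 2)) by rewrite lt_min !mulr_gt0 ?invr_gt0.
have [eta eta0 H] := Fc _ e'0; exists eta => // v /H.
rewrite le_min => /andP[h1 h2].
have fv : L / 2 <= nC (F v).
  by have := nC_sub_le (F w) (F v); rewrite nC_dist -/L; lra.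
have fv0 : F v != 0 by rewrite -nC_eq0 gt_eqF// (lt_le_trans _ fv)// divr_gt0.
rewrite (_ : _ - _ = (F w - F v) / (F v * F w)); last by field; rewrite fv0 Fw.
rewrite (nCM (F w - F v)) nCV nC_dist (nCM (F v)) ler_pdivrMr ?mulr_gt0 ?nC_gt0//.
apply: le_trans h2 _; rewrite ler_wpM2l ?(ltW e0)// -/L mulrAC.
by rewrite ler_wpM2r ?(ltW L0).
Qed.

Lemma cana_sub F (k : C) w : cana F w -> cana (fun v => F v - k) w.
Proof.
move=> [[c cF] Fc]; split.
  by eexists; have := TexD cF (Tex_cst (- k) w); apply.
move=> e /Fc[eta eta0 H]; exists eta => // v /H.
by rewrite (_ : _ - _ - _ = F v - F w)//; ring.
Qed.

(** Compactness is applied in real coordinates: real and imaginary parts bounded by [r / 2] form a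
    compact set that contains the polydisc of radius [r / 2] and stays inside that of radius [r]. *)
Lemma cana_bounded F a (r : R) : 0 < r -> (forall w, cdisc a r w -> cana F w) ->
  exists M, forall w, cdisc a (r / 2) w -> nC (F w) <= M.
Proof.
move=> r0 Fr; pose s := r / 2; have s0 : 0 < s by rewrite divr_gt0.
pose T (p : 'rV[R]_m * 'rV[R]_m) : 'rV[C]_m := a + \row_i (p.1 ord0 i +i* p.2 ord0 i)%C.
pose A1 : set 'rV[R]_m := [set v | forall i, `[- s, s]%classic (v ord0 i)].
have cA1 : compact A1 by apply: (@rV_compact R m (fun=> `[- s, s]%classic)) => i; exact: segment_compact.
have cA : compact (A1 `*` A1) by exact: compact_setX.
have A0 : (A1 `*` A1) !=set0.
  by exists (0, 0); split=> i /=; rewrite mxE in_itv/= oppr_le0 (ltW s0).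
pose psi p : R := nC (F (T p)).
have TA p : (A1 `*` A1) p -> cdisc a r (T p).
  move=> [p1 p2] i; rewrite !mxE addrAC subrr add0r; apply: square_nC => //.
  by split; rewrite /= ler_norml; have := p1 i; have := p2 i; rewrite /= !in_itv.
have cpsi : {within A1 `*` A1, continuous psi}.
  apply: continuous_in_subspaceT => p; rewrite inE => pA.
  have [_ Fc] := Fr _ (TA p pA).
  rewrite /continuous_at; apply/(@cvgrPdist_le _ _ _ (nbhs p)) => e e0.
  have [eta eta0 H] := Fc e e0; have e2 : 0 < eta / 2 by rewrite divr_gt0.
  have F1 : \forall q \near nbhs p, `|p.1 - q.1| <= eta / 2.
    by apply: (@cvgr_dist_le _ _ _ (nbhs p) _ (fst : 'rV[R]_m * 'rV[R]_m -> 'rV[R]_m)) => //; exact: cvg_fst.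
  have F2 : \forall q \near nbhs p, `|p.2 - q.2| <= eta / 2.
    by apply: (@cvgr_dist_le _ _ _ (nbhs p) _ (snd : 'rV[R]_m * 'rV[R]_m -> 'rV[R]_m)) => //; exact: cvg_snd.
  near=> q; have h1 : `|p.1 - q.1| <= eta / 2 by near: q.
  have h2 : `|p.2 - q.2| <= eta / 2 by near: q.
  have hh i : nC (T q ord0 i - T p ord0 i) <= eta.
    rewrite !mxE; apply: le_trans (nC_le_ReIm _) _.
    have g1 := le_trans (rV_entry_le (p.1 - q.1) i) h1; rewrite !mxE distrC in g1.
    have g2 := le_trans (rV_entry_le (p.2 - q.2) i) h2; rewrite !mxE distrC in g2.
    rewrite [Re _](_ : _ = q.1 ord0 i - p.1 ord0 i); last first.
      by case: (a ord0 i) => a1 a2 /=; ring.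
    rewrite [Im _](_ : _ = q.2 ord0 i - p.2 ord0 i); last first.
      by case: (a ord0 i) => a1 a2 /=; ring.
    by rewrite (le_trans (lerD g1 g2))// -splitr.
  have K := H _ hh.
  rewrite ler_distl /psi; have := nC_sub_le (F (T q)) (F (T p)).
  have := nC_sub_le (F (T p)) (F (T q)); rewrite [nC (F (T p) - _)]nC_dist; lra.
have [p pA pmax] := compact_EVT_max A0 cA cpsi.
exists (psi p) => w wr.
pose q : 'rV[R]_m * 'rV[R]_m := (\row_i Re (w ord0 i - a ord0 i), \row_i Im (w ord0 i - a ord0 i)).
have Tq : T q = w.
  have cE (z : C) : (Re z +i* Im z)%C = z by case: z.
  by apply/rowP => i; rewrite !mxE /= cE addrC subrK.
have qA : (A1 `*` A1) q.
  split=> i /=; rewrite mxE in_itv/= -ler_norml.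
    by apply: le_trans (nC_Re _) _; exact/ltW/wr.
  by apply: le_trans (nC_Im _) _; exact/ltW/wr.
by have := pmax q; rewrite inE => /(_ qA); rewrite /psi Tq.
Unshelve. all: by end_near. Qed.

End complex_analytic.

(** * From complex bounds to real power series *)

Section real_restriction.
Variables (R : realType) (m : nat).
Local Notation C := (R[i])%C.
Local Notation mi := {ffun 'I_m -> nat}.
Implicit Types (F : 'rV[C]_m -> C) (x h : 'rV[R]_m).

Lemma geom_mbox N : \sum_(b <- mbox m N) (2^-1 : R) ^+ mdeg b <= 2 ^+ m.
Proof.
rewrite big_map big_enum/=.
rewrite (eq_bigr (fun f : {ffun 'I_m -> 'I_N} => \prod_i (2^-1 : R) ^+ f i)); last first.
  by move=> f _; rewrite /mdeg -prodrXr; apply: eq_bigr => i _; rewrite ffunE.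
rewrite -(bigA_distr_bigA (fun (i : 'I_m) (j : 'I_N) => (2^-1 : R) ^+ j))/=.
have S0 : 0 <= \sum_(j < N) (2^-1 : R) ^+ j.
  by apply: sumr_ge0 => i _; rewrite exprn_ge0// invr_ge0.
have S2 : \sum_(j < N) (2^-1 : R) ^+ j <= 2.
  apply: le_trans (geom_partial_le N _) _; first by rewrite invr_ge0 ler0n invf_lt1// ltr1n.
  by rewrite (_ : 1 - 2^-1 = 2^-1 :> R) ?invrK//; lra.
by rewrite prodr_const card_ord lerXn2r ?nnegrE.
Qed.

(** At radius [r / 8] each degree contributes at most one half, and the powers of one half over all
    multi-indices sum to at most [2 ^+ m]. A supremum bound thus becomes an l^1 bound. *)
Lemma pnorm_geom (c : mi -> R) (rho r M : R) N : 0 < r -> 0 <= rho <= r / 8 -> 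
  (forall b, `|c b| <= M * (4 / r) ^+ mdeg b) -> pnorm rho c N <= M * 2 ^+ m.
Proof.
move=> r0 /andP[rho0 rhor] cM.
have M0 : 0 <= M by have := cM m0; rewrite mdeg0 expr0 mulr1; exact: le_trans.
apply: (@le_trans _ _ (M * \sum_(b <- mbox m N) (2^-1 : R) ^+ mdeg b)); last first.
  by rewrite ler_wpM2l// geom_mbox.
rewrite mulr_sumr; apply: ler_sum => b _.
apply: le_trans (ler_wpM2r (exprn_ge0 _ rho0) (cM b)) _.
have K0 : 0 <= 4 / r * rho by apply: mulr_ge0 => //; rewrite divr_ge0// ltW.
have K : 4 / r * rho <= 2^-1 by rewrite mulrAC ler_pdivrMr//; lra.
by rewrite -mulrA -exprMn ler_wpM2l// lerXn2r ?nnegrE ?invr_ge0.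
Qed.

Definition cplx x : 'rV[C]_m := map_mx (real_complex R) x.

Lemma mon_cplx h (b : mi) : mon (cplx h) b = (mon h b)%:C%C.
Proof.
rewrite /mon rmorph_prod/=; apply: eq_bigr => i _.
by rewrite mxE rmorphXn.
Qed.

Lemma Re_hsum (c : mi -> C) k h : Re (hsum c k (cplx h)) = hsum (fun b => Re (c b)) k h.
Proof.
rewrite /hsum raddf_sum; apply: eq_bigr => b _; rewrite mon_cplx.
by case: (c b) => u v /=; rewrite mulr0 subr0.
Qed.

(** The real parts of the complex coefficients, chosen before any radius or bound. The first
    property is quantitative for whatever bound is supplied; the second takes its bound from
    compactness and serves to establish convergence to the real function. *)
Lemma real_coefficients F (x0 : 'rV[R]_m) (r : R) : 0 < r ->
  (forall w, cdisc (cplx x0) r w -> cana F w) ->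
  exists c : mi -> R,
  (forall r' M : R, 0 < r' <= r -> (forall w, cdisc (cplx x0) r' w -> nC (F w) <= M) ->
     forall b, `|c b| <= M * (4 / r') ^+ mdeg b) /\
  (forall rho (f : 'rV[R]_m -> R), 0 < rho <= r / 32 ->
     (forall x, pdisc x0 rho x -> F (cplx x) = (f x)%:C%C) ->
     exists B, PS x0 rho B f c).
Proof.
move=> r0 Fr.
have x0r : cdisc (cplx x0) r (cplx x0) by move=> i; rewrite subrr nC0.
have [[c cF] _] := Fr _ x0r.
have sub (r' : R) : 0 < r' <= r -> forall w, cdisc (cplx x0) r' w -> exists d, Tex d F w.
  move=> /andP[_ r'r] w wr; have [] // : cana F w by apply: Fr => i; exact: lt_le_trans (wr i) r'r.
exists (fun b => Re (c b)); split=> [r' M r'r FM b|rho f /andP[rho0 rhor] Ff].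
  have r'0 : 0 < r' by case/andP: r'r.
  have [H _] := cauchy_estimate r'0 (sub r' r'r) cF FM.
  by apply: le_trans (nC_Re _) _; exact: H.
have [M FM] := cana_bounded r0 Fr.
have r2 : 0 < r / 2 <= r by rewrite divr_gt0//= ler_pdivrMr// ler_peMr ?(ltW r0)// ler1n.
have r2' : 0 < r / 2 by rewrite divr_gt0.
have [H1 H2] := cauchy_estimate r2' (sub _ r2) cF FM.
have H1' b : `|Re (c b)| <= M * (4 / (r / 2)) ^+ mdeg b.
  by apply: le_trans (nC_Re _) _; exact: H1.
exists (M * 2 ^+ m); split=> [N|x xr].
  by apply: (pnorm_geom _ r2') => //; rewrite (ltW rho0)/=; lra.
have M0 : 0 <= M by have := H1' m0; rewrite mdeg0 expr0 mulr1; exact: le_trans.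
(* [F] is bounded on radius [r / 2], which controls the norm at an eighth of it, [r / 16]. Halving
   once more, to [r / 32], makes the part of the box of degree at least [N] decay like
   [2^-1 ^+ N]. *)
have P N : pnorm (r / 16) (fun b => Re (c b)) N <= M * 2 ^+ m.
  by apply: (pnorm_geom _ r2') => //; apply/andP; split; lra.
apply: (@cvg_dominated _ _ (fun N => (M + M * 2 ^+ m) * 2^-1 ^+ N)).
  rewrite -(mulr0 (M + M * 2 ^+ m)); apply: cvgM; first exact: cvg_cst.
  by apply: cvg_pow0; rewrite ger0_norm ?invr_ge0// invf_lt1// ltr1n.
move=> N; rewrite (psum_hsum _ _ (leqnn N)) mulrDl addrAC.
set S := \sum_(k < N) _; set T := \sum_(b <- _ | _) _.
apply: le_trans (ler_normD _ _) _; apply: lerD.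
  have xc i : nC (cplx x ord0 i - cplx x0 ord0 i) <= r / 2 / 8.
    rewrite !mxE -rmorphB nC_real; apply: le_trans (xr i) _; lra.
  have SE : S = Re (\sum_(k < N) hsum c k (cplx x - cplx x0)).
    rewrite raddf_sum; apply: eq_bigr => k _; rewrite -Re_hsum; congr (Re (hsum _ _ _)).
    by apply/rowP => i; rewrite !mxE rmorphB.
  have := H2 _ xc N; rewrite (Ff x xr) nC_dist; apply: le_trans.
  apply: le_trans (nC_Re _); rewrite [X in _ <= `|X|](_ : _ = S - f x)// SE.
  by case: (\sum_(k < N) hsum c k (cplx x - cplx x0)).
pose w : 'rV[R]_m := rho^-1 *: (x - x0).
have w1 i : `|w ord0 i| <= 1.
  rewrite !mxE normrM normfV (gtr0_norm rho0) mulrC ler_pdivrMr// mul1r.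
  by have := xr i.
have r16 : 0 < r / 16 by rewrite divr_gt0.
have rr : 0 <= rho <= r / 16 by rewrite ltW//=; lra.
have TE : `|T| <= (rho / (r / 16)) ^+ N * pnorm (r / 16) (fun b => Re (c b)) N.
  apply: le_trans (line_rem (fun b => Re (c b)) N N r16 rr w1).
  apply: le_trans (ler_norm_sum _ _ _) _; apply: ler_sum => b _.
  by rewrite -monZ /w scalerA divff ?gt_eqF// scale1r.
apply: le_trans TE _; rewrite mulrC; apply: ler_pM; rewrite ?pnorm_ge0 ?(ltW r16)//.
  by rewrite exprn_ge0// divr_ge0 ?ltW.
have q0 : 0 <= rho / (r / 16) by rewrite divr_ge0// ltW.
have q1 : rho / (r / 16) <= 2^-1 by rewrite ler_pdivrMr//; lra.
by rewrite lerXn2r ?nnegrE ?invr_ge0.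
Qed.

End real_restriction.

(** * Contraction of positive matrix products *)

Section oscillation.
Variables (R : realType) (m : nat) (x0 : 'rV[R]_m) (rho : R).
Hypothesis rho0 : 0 < rho.
Local Notation An := (An x0 rho).
Local Notation pdisc := (pdisc x0 rho).
Variable l : nat.
Variable I0 : 'I_l.
Implicit Types (a b : 'I_l -> R) (f g r : 'I_l -> 'rV[R]_m -> R).
Let rho0' : 0 <= rho := ltW rho0.

Definition prob a := (forall i, 0 <= a i) /\ \sum_i a i = 1.

Definition osc f (O : R) := forall i j, An (fun x => f i x - f j x) O.

Lemma An_avg a f (b : R) : prob a -> (forall i, An (f i) b) ->
  An (fun x => \sum_i a i * f i x) b.
Proof.
move=> [a0 a1] fb; have H := An_sum (index_enum 'I_l) rho0' (fun i (_ : xpredT i) => AnZ (a i) (fb i)).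
apply: An_le H; rewrite -mulr_suml (eq_bigr a) ?a1 ?mul1r// => i _.
by rewrite ger0_norm.
Qed.

(** In the independent coupling of [a] and [b] the diagonal contributes nothing, and the mass off
    the diagonal is at most [1 - k]. *)
Lemma osc_coupling a b f (O k : R) : prob a -> prob b -> k <= \sum_i a i * b i ->
  osc f O -> An (fun x => \sum_i a i * f i x - \sum_i b i * f i x) ((1 - k) * O).
Proof.
move=> [a0 a1] [b0 b1] ab fO.
have O0 : 0 <= O by apply: An_ge0 (fO I0 I0).
have H i : An (fun x => \sum_(j | j != i) a i * b j * (f i x - f j x))
    (\sum_(j | j != i) a i * b j * O).
  apply: An_sum => // j _; have := AnZ (a i * b j) (fO i j).
  by rewrite ger0_norm// mulr_ge0.
have {}H := An_sum (index_enum 'I_l) rho0' (fun i (_ : xpredT i) => H i).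
apply: An_le (An_ext _ H) => [|x _].
  under eq_bigr => i _ do rewrite -mulr_suml -mulr_sumr.
  rewrite -mulr_suml ler_wpM2r// lerBrDr.
  rewrite (eq_bigr (fun i => a i - a i * b i)); last first.
    move=> i _; rewrite (_ : \sum_(j | j != i) b j = 1 - b i) ?mulrBr ?mulr1//.
    by rewrite -b1 [in RHS](bigD1 i)//= addrAC subrr add0r.
  by rewrite sumrB a1; lra.
transitivity (\sum_i (a i * f i x - a i * \sum_j b j * f j x)).
  apply: eq_bigr => i _.
  transitivity (\sum_j a i * b j * (f i x - f j x)).
    by rewrite [RHS](bigD1 i)//= subrr mulr0 add0r.
  transitivity (\sum_j (b j * (a i * f i x) - a i * (b j * f j x))).
    by apply: eq_bigr => j _; ring.
  by rewrite sumrB -mulr_suml b1 mul1r mulr_sumr.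
by rewrite sumrB -mulr_suml a1 mul1r.
Qed.

(** The overlap of two rows is at least [k ^+ 2], from the state [I0] alone. As the perturbation has
    row sum zero, [r j] may be replaced by [r j - r I0], so it costs [d * O] for each of the two
    rows, whatever the size of [r]. *)
Lemma osc_step (B0 : 'I_l -> 'I_l -> R) (b : 'I_l -> 'I_l -> 'rV[R]_m -> R) r (k d O : R) :
  0 <= k -> (forall i, prob (B0 i)) -> (forall i j, k <= B0 i j) ->
  (forall i j, An (b i j) d) ->
  (forall i x, pdisc x -> \sum_j B0 i j * b i j x = 0) ->
  osc r O ->
  osc (fun i x => \sum_j B0 i j * (1 + b i j x) * r j x) ((1 - k ^+ 2 + 2 * d) * O).
Proof.
move=> k0 B0p kB bd bs rO i j.
have H1 : An (fun x => \sum_j B0 i j * r j x - \sum_k B0 j k * r k x) ((1 - k ^+ 2) * O).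
  apply: osc_coupling => //; rewrite (bigD1 I0)//= -[leLHS]addr0; apply: lerD.
    by rewrite expr2 ler_pM.
  by apply: sumr_ge0 => h _; rewrite mulr_ge0// (le_trans k0).
have H2 h : An (fun x => \sum_j B0 h j * (b h j x * (r j x - r I0 x))) (d * O).
  by apply: An_avg => // j'; apply: AnM.
have := AnD rho0' H1 (AnB rho0' (H2 i) (H2 j)).
rewrite (_ : (1 - k ^+ 2) * O + _ = (1 - k ^+ 2 + 2 * d) * O); last by ring.
apply: An_ext => x xr.
have E h : \sum_j B0 h j * (1 + b h j x) * r j x =
    \sum_j B0 h j * r j x + \sum_j B0 h j * (b h j x * (r j x - r I0 x)).
  have -> : \sum_j B0 h j * (b h j x * (r j x - r I0 x)) =
      \sum_j B0 h j * b h j x * r j x - (\sum_j B0 h j * b h j x) * r I0 x.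
    by rewrite mulr_suml -sumrB; apply: eq_bigr => k' _; ring.
  rewrite bs// mul0r subr0 -big_split/=; apply: eq_bigr => k' _; ring.
by rewrite !E; ring.
Qed.

(** By the same centring, one step adds only [d * O] to the distance from the value at the centre;
    with geometrically decaying oscillations the total drift stays bounded. *)
Lemma drift_step (B0 : 'I_l -> R) (b r : 'I_l -> 'rV[R]_m -> R) (d O E : R) :
  prob B0 -> (forall j, An (b j) d) ->
  (forall x, pdisc x -> \sum_j B0 j * b j x = 0) ->
  osc r O -> (forall j, An (fun x => r j x - r j x0) E) ->
  An (fun x => \sum_j B0 j * (1 + b j x) * r j x - \sum_j B0 j * r j x0) (E + d * O).
Proof.
move=> B0p bd bs rO rE.
have H1 := An_avg B0p rE.
have H2 : An (fun x => \sum_j B0 j * (b j x * (r j x - r I0 x))) (d * O).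
  by apply: An_avg => // j'; apply: AnM.
apply: An_ext (AnD rho0' H1 H2) => x xr.
have -> : \sum_j B0 j * (b j x * (r j x - r I0 x)) =
    \sum_j B0 j * b j x * r j x - (\sum_j B0 j * b j x) * r I0 x.
  by rewrite mulr_suml -sumrB; apply: eq_bigr => k' _; ring.
rewrite bs// mul0r subr0 -big_split -sumrB/=; apply: eq_bigr => k' _; ring.
Qed.

End oscillation.

(** * Estimates uniform in the word for products of positive matrices *)

Section random_products.
Variables (R : realType) (m : nat) (x0 : 'rV[R]_m) (rho : R).
Hypothesis rho0 : 0 < rho.
Local Notation An := (An x0 rho).
Local Notation pdisc := (pdisc x0 rho).
Local Notation osc := (osc x0 rho).
Variables (l : nat) (I0 : 'I_l) (Z : Type).
Variable M : Z -> 'I_l -> 'I_l -> 'rV[R]_m -> R.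
Variables (m1 m2 eta : R).
Let rho0' : 0 <= rho := ltW rho0.
Let px0 : pdisc x0 := pdisc0 x0 rho0'.

(* [U s] is the matrix product [M z_1 ... M z_n] applied to the vector 1. *)
Fixpoint U (s : seq Z) (i : 'I_l) (x : 'rV[R]_m) : R :=
  if s is z :: s' then \sum_j M z i j x * U s' j x else 1.

Lemma U_cons z s i x : U (z :: s) i x = \sum_j M z i j x * U s j x.
Proof. by []. Qed.

(** A lower bound for all entries of the kernels [step_prob]: one factor [m1 / m2] compares entries
    of [M], the other compares entries of [U s]. *)
Definition doeblin : R := (m1 / m2) ^+ 2 / l%:R.
Local Notation k := doeblin.

Hypothesis m10 : 0 < m1.
Hypothesis m12 : m1 <= m2.
Hypothesis M0 : forall z i j, m1 <= M z i j x0 <= m2.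
Hypothesis Mpos : forall z i j x, pdisc x -> 0 < M z i j x.
Hypothesis eta0 : 0 < eta.
Hypothesis etak : 20 * eta <= k ^+ 2.
Hypothesis eta_drift : 82 * l%:R * m2 * eta <= m1 * k ^+ 2.
Hypothesis Me : forall z i j, An (fun x => M z i j x / M z i j x0 - 1) (eta ^+ 2).

Let m20 : 0 < m2 := lt_le_trans m10 m12.
Let l0 : 0 < l%:R :> R.
Proof. by rewrite ltr0n; case: (l) I0 => [[]|]. Qed.
Let k0 : 0 < k.
Proof. by rewrite /k divr_gt0// exprn_gt0// divr_gt0. Qed.
Let l1 : 1 <= l%:R :> R.
Proof. by move: l0; rewrite ltr0n -(ler_nat R 1). Qed.
Let k1 : k <= 1.
Proof.
rewrite /k ler_pdivrMr// mul1r; apply: le_trans l1.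
by rewrite exprn_ile1// ?divr_ge0 ?(ltW m10) ?(ltW m20)// ler_pdivrMr// mul1r.
Qed.
Let k21 : k ^+ 2 <= 1.
Proof. by rewrite exprn_ile1// ltW. Qed.
Let eta1 : eta <= 1 / 16.
Proof. by have := etak; have := k21; lra. Qed.

Lemma U_gt0 s i x : pdisc x -> 0 < U s i x.
Proof.
move=> xr; elim: s i => [|z s IH] i //=.
rewrite (bigD1 I0)//= ltr_pwDl ?mulr_gt0 ?Mpos// sumr_ge0// => j _.
by rewrite mulr_ge0// ltW ?Mpos.
Qed.

Local Notation U0 s i := (U s i x0).

Lemma U0_ratio s i j : m1 * U0 s i <= m2 * U0 s j.
Proof.
case: s => [|z s] /=; first by rewrite !mulr1.
rewrite !mulr_sumr; apply: ler_sum => h _; rewrite !mulrA ler_wpM2r ?(ltW (U_gt0 _ _ px0))//.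
have /andP[a1 a2] := M0 z i h; have /andP[b1 b2] := M0 z j h.
apply: (@le_trans _ _ (m1 * m2)); first by rewrite ler_wpM2l// ltW.
by rewrite mulrC ler_wpM2l// ltW.
Qed.

(** The Doob transform at the centre: conjugation by the vectors [U0] makes the matrix of each
    letter stochastic. *)
Definition step_prob z s i j : R := M z i j x0 * U0 s j / U0 (z :: s) i.

Let U0_gt0 s i : 0 < U0 s i. Proof. exact: U_gt0. Qed.
Let M0_gt0 z i j : 0 < M z i j x0. Proof. exact: Mpos. Qed.

Lemma B0_prob z s i : prob (step_prob z s i).
Proof.
split=> [j|]; last by rewrite /step_prob -mulr_suml mulfV//; exact/lt0r_neq0/(U0_gt0 (z :: s)).
by rewrite /step_prob ltW// divr_gt0// mulr_gt0.
Qed.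

Lemma U0_sum_le s j : \sum_i U0 s i <= l%:R * (m2 / m1 * U0 s j).
Proof.
apply: (@le_trans _ _ (\sum_(i < l) (m2 / m1 * U0 s j))).
  by apply: ler_sum => i _; rewrite mulrAC ler_pdivlMr// mulrC U0_ratio.
by rewrite sumr_const card_ord -[leLHS]mulr_natl.
Qed.

Lemma B0_ge z s i j : k <= step_prob z s i j.
Proof.
have /andP[a1 a2] := M0 z i j.
rewrite /step_prob ler_pdivlMr//.
apply: (@le_trans _ _ (k * (m2 * (l%:R * (m2 / m1 * U0 s j))))).
  rewrite ler_wpM2l ?(ltW k0)//=; apply: le_trans (ler_wpM2l (ltW m20) (U0_sum_le s j)).
  rewrite mulr_sumr; apply: ler_sum => h _; rewrite ler_wpM2r ?(ltW (U0_gt0 _ _))//.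
  by have /andP[] := M0 z i h.
rewrite (_ : _ * _ = m1 * U0 s j); first by rewrite ler_wpM2r// ltW.
by rewrite /k; field; rewrite !gt_eqF.
Qed.

Definition entry_err z i j x := M z i j x / M z i j x0 - 1.
Definition growth s i x := U s i x / U0 s i.
(** [growth] may be exponentially large in the length of the word; its direction, normalised at
    [I0], is the quantity that stays uniformly small. *)
Definition dir_err s i x := growth s i x / growth s I0 x - 1.
Definition avg_err z s i x := \sum_j step_prob z s i j * ((1 + entry_err z i j x) * (1 + dir_err s j x)) - 1.

Let growth_gt0 s i x : pdisc x -> 0 < growth s i x.
Proof. by move=> xr; rewrite divr_gt0// U_gt0. Qed.

Lemma growth_cons z s i x : pdisc x ->
  growth (z :: s) i x = growth s I0 x * (1 + avg_err z s i x).
Proof.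
move=> xr; rewrite /avg_err addrCA subrr addr0 mulr_sumr {1}/growth (U_cons z s i x) mulr_suml.
have gN : growth s I0 x != 0 by rewrite gt_eqF ?growth_gt0.
apply: eq_bigr => j _; rewrite /step_prob /entry_err /dir_err; move: gN; set gI := growth s I0 x => gN.
rewrite [growth s j x]/growth; field.
by rewrite gN !gt_eqF ?U0_gt0.
Qed.

Let xiI s x : pdisc x -> dir_err s I0 x = 0.
Proof. by move=> xr; rewrite /dir_err divff ?subrr// gt_eqF ?growth_gt0. Qed.

Let avg1 z s i : \sum_j step_prob z s i j = 1.
Proof. by case: (B0_prob z s i). Qed.

Lemma zetaE z s i x : avg_err z s i x =
  \sum_j step_prob z s i j * dir_err s j x + \sum_j step_prob z s i j * (entry_err z i j x * (1 + dir_err s j x)).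
Proof.
rewrite /avg_err -[X in _ - X](avg1 z s i) -sumrB -big_split/=; apply: eq_bigr => j _; ring.
Qed.

Lemma An_xi_of_osc s (O : R) : osc (dir_err s) O -> forall i, An (dir_err s i) O.
Proof. by move=> H i; apply: An_ext (H i I0) => x xr; rewrite xiI// subr0. Qed.

Let one_xi s : osc (dir_err s) eta -> forall i, An (fun x => 1 + dir_err s i x) (1 + eta).
Proof.
move=> H i; have := AnD rho0' (An_cst x0 1 rho0') (An_xi_of_osc H i).
by rewrite normr1.
Qed.

Let eta2 : eta ^+ 2 * (1 + eta) <= eta.
Proof.
rewrite expr2 -mulrA ler_piMr ?(ltW eta0)//.
have := eta1; have := eta0; nra.
Qed.

Lemma An_zeta z s i : osc (dir_err s) eta -> An (avg_err z s i) (2 * eta).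
Proof.
move=> H; have H1 := An_avg rho0 (B0_prob z s i) (An_xi_of_osc H).
have H2 : An (fun x => \sum_j step_prob z s i j * (entry_err z i j x * (1 + dir_err s j x))) (eta ^+ 2 * (1 + eta)).
  apply: An_avg => //; first exact: B0_prob.
  by move=> j; apply: AnM => //; [exact: Me|exact: one_xi].
apply: An_le (An_ext _ (AnD rho0' H1 H2)); first by have := eta2; lra.
by move=> x xr; rewrite zetaE.
Qed.

Let k2B z s z' s' i j : k ^+ 2 <= \sum_h step_prob z s i h * step_prob z' s' j h.
Proof.
rewrite (bigD1 I0)//= -[leLHS]addr0; apply: lerD.
  by rewrite expr2 ler_pM ?B0_ge ?(ltW k0).
by apply: sumr_ge0 => h _; rewrite mulr_ge0// (le_trans (ltW k0))// B0_ge.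
Qed.

Lemma osc_zeta z s : osc (dir_err s) eta -> osc (avg_err z s) ((1 - k ^+ 2) * eta + 2 * (eta ^+ 2 * (1 + eta))).
Proof.
move=> H i j; have H1 := osc_coupling rho0 I0 (B0_prob z s i) (B0_prob z s j) (k2B _ _ _ _ _ _) H.
have H2 i' : An (fun x => \sum_j step_prob z s i' j * (entry_err z i' j x * (1 + dir_err s j x))) (eta ^+ 2 * (1 + eta)).
  apply: An_avg => //; first exact: B0_prob.
  by move=> j'; apply: AnM => //; [exact: Me|exact: one_xi].
apply: An_le (An_ext _ (AnD rho0' H1 (AnB rho0' (H2 i) (H2 j)))); first by lra.
by move=> x xr; rewrite !zetaE; ring.
Qed.

Let inv_zeta z s i : osc (dir_err s) eta ->
  An (fun x => (1 + avg_err z s i x)^-1) (1 - 2 * eta)^-1.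
Proof.
by move=> H; apply: An_inv => //; [exact: An_zeta|have := eta1; lra].
Qed.

Let zeta_neq0 z s i x : pdisc x -> 1 + avg_err z s i x != 0.
Proof.
move=> xr; have H := growth_cons z s i xr.
apply/negP => /eqP E; have := growth_gt0 (z :: s) i xr.
by rewrite H E mulr0 ltxx.
Qed.

(** The bound [eta] reproduces itself. One step contracts it to [(1 - k ^+ 2) * eta], the entries
    add an error of order [eta ^+ 2], normalisation divides by [1 - 2 * eta], and
    [20 * eta <= k ^+ 2] absorbs both losses. *)
Lemma osc_xi s : osc (dir_err s) eta.
Proof.
elim: s => [|z s IH] i j.
  have := An_cst x0 0 rho0'; rewrite normr0 => /(An_le (ltW eta0)); apply: An_ext => x xr.
  by rewrite /dir_err /growth /= !divr1 subrr.
have H := AnM rho0' (osc_zeta z IH i j) (inv_zeta z I0 IH).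
apply: An_le (An_ext _ H).
  rewrite ler_pdivrMr; last by have := eta1; lra.
  have := etak; have := eta0; have := eta1; nra.
move=> x xr; rewrite /dir_err !growth_cons//; field.
by rewrite zeta_neq0 ?andbT// gt_eqF ?growth_gt0.
Qed.

(** The relative deviation at [x] of the Doob kernel from [step_prob]. Both kernels are stochastic,
    which is why it has weighted row sum zero. *)
Definition bcoef z s i j x := (1 + entry_err z i j x) * (1 + dir_err s j x) / (1 + avg_err z s i x) - 1.

Lemma An_bcoef z s i j : An (bcoef z s i j) (5 * eta).
Proof.
have ox := osc_xi s.
have H1 : An (fun x => dir_err s j x + entry_err z i j x * (1 + dir_err s j x) - avg_err z s i x) (4 * eta).
  apply: An_le (AnB rho0' (AnD rho0' (An_xi_of_osc ox j) (AnM rho0' (Me z i j) (one_xi ox j))) (An_zeta z i ox)).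
  by have := eta2; lra.
apply: An_le (An_ext _ (AnM rho0' H1 (inv_zeta z i ox))).
  rewrite ler_pdivrMr; last by have := eta1; lra.
  have := eta0; have := eta1; nra.
move=> x xr; rewrite /bcoef; field; exact: zeta_neq0.
Qed.

Lemma bcoefE z s i j x : pdisc x ->
  step_prob z s i j * (1 + bcoef z s i j x) = M z i j x * U s j x / U (z :: s) i x.
Proof.
move=> xr; rewrite /bcoef addrCA subrr addr0.
have uU t h : U t h x = growth t h x * U0 t h by rewrite /growth divfK// gt_eqF.
rewrite [in RHS]uU [U (z :: s) i x]uU growth_cons// /entry_err addrCA subrr addr0 /dir_err addrCA subrr addr0 /step_prob.
field; rewrite zeta_neq0// !gt_eqF ?growth_gt0//.
Qed.

Lemma bcoef_sum z s i x : pdisc x -> \sum_j step_prob z s i j * bcoef z s i j x = 0.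
Proof.
move=> xr; have : \sum_j step_prob z s i j * (1 + bcoef z s i j x) = 1.
  under eq_bigr => j _ do rewrite bcoefE//.
  by rewrite -mulr_suml mulfV//; exact/lt0r_neq0/(U_gt0 (z :: s)).
under eq_bigr => j _ do rewrite mulrDr mulr1.
by rewrite big_split/= avg1 => /eqP; rewrite eq_sym addrC -subr_eq subrr => /eqP.
Qed.

(** The effect of appending a last letter. By [ratio_cons], adding letters at the head averages it
    under the Doob kernels, so its dependence on the state dies out. *)
Definition ratio s z' i x := U (rcons s z') i x / U s i x.

Lemma ratio_cons z s z' i x : pdisc x ->
  ratio (z :: s) z' i x = \sum_j step_prob z s i j * (1 + bcoef z s i j x) * ratio s z' j x.
Proof.
move=> xr; rewrite {1}/ratio rcons_cons (U_cons z (rcons s z')) mulr_suml.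
apply: eq_bigr => j _; rewrite bcoefE// /ratio; field.
by rewrite !gt_eqF// U_gt0.
Qed.

(** [osc_step] with [d = 5 * eta] gives the rate [1 - k ^+ 2 + 10 * eta], and [20 * eta <= k ^+ 2].
    The result depends on neither [eta] nor the radius. *)
Definition gamma := 1 - k ^+ 2 / 2.

Let gamma0 : 0 < gamma. Proof. by rewrite /gamma; have := k21; lra. Qed.
Let kk0 : 0 < k ^+ 2. Proof. by rewrite exprn_gt0. Qed.
Let gamma1 : gamma < 1.
Proof. by rewrite /gamma; have := kk0; lra. Qed.

Lemma gamma_range : 0 < gamma < 1.
Proof. by rewrite gamma0 gamma1. Qed.

Definition osc_bound : R := 4 * l%:R * m2.
Let O00 : 0 < osc_bound. Proof. by rewrite !mulr_gt0. Qed.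

Let An_M z i j : An (M z i j) (2 * m2).
Proof.
have H := AnZ (M z i j x0) (AnD rho0' (An_cst x0 1 rho0') (Me z i j)).
apply: An_le (An_ext _ H); last by move=> x xr; field; rewrite gt_eqF.
rewrite normr1 gtr0_norm// mulrC ler_pM ?(ltW (M0_gt0 _ _ _))//.
- by rewrite addr_ge0// sqr_ge0.
- by have := eta1; have := eta0; nra.
- by have /andP[] := M0 z i j.
Qed.

Let ratio_nil z' i x : ratio [::] z' i x = \sum_j M z' i j x.
Proof. by rewrite /ratio /= divr1; apply: eq_bigr => j _; rewrite mulr1. Qed.

Lemma osc_ratio s z' : osc (ratio s z') (osc_bound * gamma ^+ size s).
Proof.
elim: s => [|z s IH].
  move=> i j; rewrite expr0 mulr1.
  have H i' := An_sum (index_enum 'I_l) rho0' (fun j (_ : xpredT j) => An_M z' i' j).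
  apply: An_le (An_ext _ (AnB rho0' (H i) (H j))); last by move=> x _; rewrite !ratio_nil.
  by rewrite sumr_const card_ord -mulr_natl /osc_bound; lra.
have H := osc_step rho0 I0 (ltW k0) (B0_prob z s) (B0_ge z s) (An_bcoef z s) (bcoef_sum z s) IH.
move=> i j; apply: An_le (An_ext _ (H i j)); last by move=> x xr; rewrite !ratio_cons.
rewrite /= (exprS gamma) [leRHS]mulrCA; apply: ler_wpM2r.
  by rewrite mulr_ge0 ?exprn_ge0 ?(ltW O00) ?(ltW gamma0).
by rewrite /gamma; have := etak; lra.
Qed.

Let ratio_x0 z s z' i : ratio (z :: s) z' i x0 = \sum_j step_prob z s i j * ratio s z' j x0.
Proof.
by rewrite ratio_cons//; apply: eq_bigr => j _; rewrite bcoefE.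
Qed.

Let drift n : R := l%:R * m2 * eta ^+ 2 + 5 * eta * osc_bound * \sum_(i < n) gamma ^+ i.

Lemma An_drift s z' i : An (fun x => ratio s z' i x - ratio s z' i x0) (drift (size s)).
Proof.
elim: s i => [|z s IH] i.
  rewrite /drift big_ord0 mulr0 addr0.
  have H j := AnZ (M z' i j x0) (Me z' i j).
  have {}H := An_sum (index_enum 'I_l) rho0' (fun j (_ : xpredT j) => H j).
  apply: An_le (An_ext _ H) => [|x _].
    apply: (@le_trans _ _ (\sum_(j < l) m2 * eta ^+ 2)).
      apply: ler_sum => j _; rewrite ler_wpM2r ?sqr_ge0// gtr0_norm//.
      by have /andP[] := M0 z' i j.
    by rewrite sumr_const card_ord -[leLHS]mulr_natl mulrA.
  rewrite !ratio_nil -sumrB; apply: eq_bigr => j _; field; exact: lt0r_neq0.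
have H := drift_step rho0 I0 (B0_prob z s i) (An_bcoef z s i) (fun x => bcoef_sum z s i (x := x)) (osc_ratio s z') IH.
apply: An_le (An_ext _ H); last by move=> x xr; rewrite ratio_x0 ratio_cons.
by rewrite /drift/= big_ord_recr/=; lra.
Qed.

(** The geometric sum is at most [2 / k ^+ 2], so the second term is at most 40 times
    [l%:R * m2 * eta / k ^+ 2] and the first at most once that quantity; [eta_drift] has 82 as twice
    41. *)
Lemma drift_le n : drift n <= m1 / 2.
Proof.
have H := geom_partial_le n (introT andP (conj (ltW gamma0) gamma1)).
have ok0 : 0 <= 5 * eta * osc_bound.
  by apply: mulr_ge0; [apply: mulr_ge0 => //; exact: ltW|exact: ltW].
apply: (@le_trans _ _ (l%:R * m2 * eta ^+ 2 + 5 * eta * osc_bound * (1 - gamma)^-1)).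
  by rewrite lerD2l ler_wpM2l.
have -> : 1 - gamma = k ^+ 2 / 2 by rewrite /gamma; lra.
have lm : 0 < l%:R * m2 by rewrite mulr_gt0.
have e2k : eta ^+ 2 <= eta / k ^+ 2.
  rewrite ler_pdivlMr// expr2 -mulrA ler_piMr ?(ltW eta0)//.
  by rewrite mulr_ile1 ?(ltW eta0) ?(ltW kk0)//; have := eta1; lra.
apply: (@le_trans _ _ (l%:R * m2 * (41 * (eta / k ^+ 2)))).
  have := ler_wpM2l (ltW lm) e2k.
  have -> : 5 * eta * osc_bound * (k ^+ 2 / 2)^-1 = 40 * (l%:R * m2 * (eta / k ^+ 2)).
    by rewrite /osc_bound; field; rewrite gt_eqF.
  lra.
have := eta_drift; rewrite -(ler_pM2r (_ : 0 < (k ^+ 2)^-1)) ?invr_gt0//.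
by rewrite -[X in _ <= X -> _]mulrA mulfV ?gt_eqF// mulr1; lra.
Qed.

Let ratio_ge s z' i : m1 <= ratio s z' i x0.
Proof.
elim: s i => [|z s IH] i.
  rewrite ratio_nil (bigD1 I0)//= -[leLHS]addr0; apply: lerD.
    by have /andP[] := M0 z' i I0.
  by apply: sumr_ge0 => j _; exact: ltW.
rewrite ratio_x0 -[leLHS]mul1r -(avg1 z s i) mulr_suml; apply: ler_sum => j _.
by rewrite ler_wpM2l//; case: (B0_prob z s i).
Qed.

(** The drift is at most half of the value at the centre, which is at least [m1], so the Neumann
    series has ratio one half. *)
Lemma An_ratio_inv s z' i : An (fun x => (ratio s z' i x)^-1) (2 / m1).
Proof.
set r0 := ratio s z' i x0; have r00 : 0 < r0 := lt_le_trans m10 (ratio_ge s z' i).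
have H : An (fun x => r0^-1 * (ratio s z' i x - r0)) (1 / 2).
  apply: An_le (AnZ r0^-1 (An_drift s z' i)).
  rewrite gtr0_norm ?invr_gt0// mulrC ler_pdivrMr//; apply: le_trans (drift_le _) _.
  by have := ratio_ge s z' i; rewrite -/r0; lra.
have h2 : 1 / 2 < 1 :> R by lra.
have H2 := AnZ r0^-1 (An_inv rho0 H h2).
apply: An_le (An_ext _ H2).
  rewrite gtr0_norm ?invr_gt0// (_ : 1 - 1 / 2 = 2^-1); last by field.
  rewrite invrK mulrC ler_wpM2l// lef_pV2 ?posrE//.
  exact: ratio_ge.
move=> x xr; have := U_gt0 (rcons s z') i xr; have := U_gt0 s i xr => u1 u2.
have rx : 0 < ratio s z' i x by rewrite divr_gt0.
field; rewrite !gt_eqF//=.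
Qed.

(** These increments telescope along the word to [ln (U s I0 x)]. *)
Definition logincr z s x := ln (U (z :: s) I0 x / U s I0 x).
Definition logbound : R := `|ln m1| + `|ln (l%:R * (m2 * (m2 / m1)))| + 1.

Lemma An_logincr z s : An (logincr z s) logbound.
Proof.
pose S := U0 (z :: s) I0 / U0 s I0.
have S0 : 0 < S by rewrite divr_gt0.
have S1 : m1 <= S.
  rewrite /S ler_pdivlMr// U_cons (bigD1 I0)//= -[leLHS]addr0; apply: lerD.
    by rewrite ler_wpM2r ?(ltW (U0_gt0 _ _))//; have /andP[] := M0 z I0 I0.
  by apply: sumr_ge0 => j _; rewrite mulr_ge0 ?ltW.
have S2 : S <= l%:R * (m2 * (m2 / m1)).
  rewrite /S ler_pdivrMr// U_cons.
  apply: (@le_trans _ _ (m2 * \sum_j U0 s j)).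
    rewrite mulr_sumr; apply: ler_sum => j _; rewrite ler_wpM2r ?(ltW (U0_gt0 _ _))//.
    by have /andP[] := M0 z I0 j.
  by apply: le_trans (ler_wpM2l (ltW m20) (U0_sum_le s I0)) _; rewrite le_eqVlt; apply/orP; left; apply/eqP; ring.
have lS : `|ln S| <= `|ln m1| + `|ln (l%:R * (m2 * (m2 / m1)))|.
  have h1 : ln m1 <= ln S by rewrite ler_ln.
  have h2 : ln S <= ln (l%:R * (m2 * (m2 / m1))).
    by rewrite ler_ln ?posrE// (lt_le_trans S0).
  have := ler_norm (ln (l%:R * (m2 * (m2 / m1)))); have := ler_norm (- ln m1); rewrite normrN.
  have := normr_ge0 (ln m1); have := normr_ge0 (ln (l%:R * (m2 * (m2 / m1)))).
  rewrite ler_norml; lra.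
have e1 : 2 * eta < 1 by have := eta1; lra.
have H1 := An_ln rho0 (An_zeta z I0 (osc_xi s)) e1.
apply: An_le (An_ext _ (AnD rho0' (An_cst x0 (ln S) rho0') H1)) => [|x xr].
  rewrite /logbound lerD// ler_pdivrMr; last by lra.
  by have := eta1; lra.
have z1 : 0 < 1 + avg_err z s I0 x.
  by have := growth_gt0 (z :: s) I0 xr; rewrite growth_cons// pmulr_rgt0// growth_gt0.
rewrite -lnM ?posrE// /logincr; congr ln.
have := growth_cons z s I0 xr; rewrite /growth => E.
have us := U_gt0 s I0 xr; have u0 := U0_gt0 s I0; have u0' := U0_gt0 (z :: s) I0.
have -> : U (z :: s) I0 x = U s I0 x / U0 s I0 * (1 + avg_err z s I0 x) * U0 (z :: s) I0.
  by rewrite -E divfK// gt_eqF.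
by rewrite /S; field; rewrite !gt_eqF.
Qed.

Let logbound0 : 0 <= logbound. Proof. by rewrite !addr_ge0. Qed.

Definition logdiff_const : R := 8 * osc_bound / m1 * (1 + 2 * logbound).

(** The difference is the logarithm of [ratio (z :: s) z' I0 / ratio s z' I0]. The numerator is an
    average of the numbers [ratio s z' j], so the quotient differs from 1 by an oscillation of order
    [gamma ^+ size s]. *)
Lemma An_logdiff z s z' :
  An (fun x => logincr z (rcons s z') x - logincr z s x) (logdiff_const * gamma ^+ size s).
Proof.
have g0 : 0 < gamma ^+ size s by rewrite exprn_gt0.
pose b := 4 * osc_bound / m1 * gamma ^+ size s.
have b0 : 0 < b by rewrite mulr_gt0// divr_gt0// mulr_gt0.
have bE : logdiff_const * gamma ^+ size s = 2 * b * (1 + 2 * logbound).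
  by rewrite /logdiff_const /b; ring.
(* For [b > 1 / 2] the two increments are bounded separately by [2 * logbound], which the constant
   exceeds. Otherwise [An_ln] applies and [b / (1 - b) <= 2 * b]. *)
have [bl|bl] := leP b (1 / 2); last first.
  apply: An_le (AnB rho0' (An_logincr z (rcons s z')) (An_logincr z s)).
  rewrite bE; have := logbound0; nra.
pose u x := (ratio (z :: s) z' I0 x - ratio s z' I0 x) / ratio s z' I0 x.
have uA : An u b.
  have H1 : An (fun x => \sum_j step_prob z s I0 j * ((1 + bcoef z s I0 j x) * (ratio s z' j x - ratio s z' I0 x)))
      (2 * (osc_bound * gamma ^+ size s)).
    apply: An_avg => //; first exact: B0_prob.
    move=> j; apply: AnM => //; last exact: osc_ratio.
    have := AnD rho0' (An_cst x0 1 rho0') (An_bcoef z s I0 j); apply: An_le.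
    by rewrite normr1; have := eta1; lra.
  apply: An_le (An_ext _ (AnM rho0' H1 (An_ratio_inv s z' I0))).
    by rewrite le_eqVlt; apply/orP; left; apply/eqP; rewrite /b; ring.
  move=> x xr; rewrite /u; congr (_ * _).
  have E1 : \sum_j step_prob z s I0 j * (1 + bcoef z s I0 j x) = 1.
    under eq_bigr => j _ do rewrite mulrDr mulr1.
    by rewrite big_split/= avg1 bcoef_sum// addr0.
  rewrite ratio_cons//; set r := ratio s z' I0 x.
  transitivity (\sum_j step_prob z s I0 j * (1 + bcoef z s I0 j x) * ratio s z' j x -
    (\sum_j step_prob z s I0 j * (1 + bcoef z s I0 j x)) * r); last by rewrite E1 mul1r.
  by rewrite mulr_suml -sumrB; apply: eq_bigr => j _; ring.
have b1 : b < 1 by lra.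
apply: An_le (An_ext _ (An_ln rho0 uA b1)).
  rewrite bE ler_pdivrMr; last by lra.
  have h2 : b <= b * (1 + 2 * logbound) by rewrite ler_peMr ?(ltW b0)//; have := logbound0; lra.
  rewrite [leRHS](_ : _ = b * (1 + 2 * logbound) * (2 * (1 - b))); last by ring.
  apply: le_trans h2 _; rewrite ler_peMr//; last by lra.
  by rewrite mulr_ge0 ?(ltW b0)//; have := logbound0; lra.
move=> x xr; rewrite /logincr /u.
have p1 := U_gt0 (z :: rcons s z') I0 xr; have p2 := U_gt0 (rcons s z') I0 xr.
have p3 := U_gt0 (z :: s) I0 xr; have p4 := U_gt0 s I0 xr.
rewrite -ln_div ?posrE ?divr_gt0//; congr ln; rewrite /ratio rcons_cons.
field; rewrite !gt_eqF//.
Qed.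

Lemma U_ratio_bounds s i x : pdisc x ->
  m1 / m2 / 2 <= U s i x / U s I0 x <= 2 * (m2 / m1).
Proof.
move=> xr; have xb := An_bound rho0' (An_xi_of_osc (osc_xi s) i) xr.
have -> : U s i x / U s I0 x = (U0 s i / U0 s I0) * (1 + dir_err s i x).
  have p3 := U_gt0 s i xr; have p4 := U_gt0 s I0 xr.
  by rewrite /dir_err /growth; field; rewrite !gt_eqF.
have lo : m1 / m2 <= U0 s i / U0 s I0.
  by rewrite ler_pdivlMr// mulrAC ler_pdivrMr// [leRHS]mulrC U0_ratio.
have hi : U0 s i / U0 s I0 <= m2 / m1.
  by rewrite ler_pdivrMr// mulrAC ler_pdivlMr// mulrC U0_ratio.
have h0 : 0 < m1 / m2 by rewrite divr_gt0.
move: xb; rewrite ler_norml => /andP[h1 h2]; have := eta1 => h3.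
by apply/andP; split; nra.
Qed.

End random_products.

(** * The stationary vector *)

Section stationary.
Variables (R : realType) (m : nat) (x0 : 'rV[R]_m) (rho : R).
Hypothesis rho0 : 0 < rho.
Local Notation An := (An x0 rho).
Local Notation pdisc := (pdisc x0 rho).
Variables (l : nat) (I0 : 'I_l).
Variables (P : 'I_l -> 'I_l -> 'rV[R]_m -> R) (v : 'I_l -> 'rV[R]_m -> R) (a delta : R).
Let rho0' : 0 <= rho := ltW rho0.
Let px0 : pdisc x0 := pdisc0 x0 rho0'.
Hypothesis a0 : 0 < a.
Hypothesis Pa : forall i j, a <= P i j x0.
Hypothesis P1 : forall x i, pdisc x -> \sum_j P i j x = 1.
Hypothesis v0 : forall x i, pdisc x -> 0 <= v i x.
Hypothesis v1 : forall x, pdisc x -> \sum_i v i x = 1.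
Hypothesis vP : forall x j, pdisc x -> \sum_i v i x * P i j x = v j x.
Hypothesis deltaa : 4 * delta <= a ^+ 2.
Hypothesis delta1 : delta <= 1.
Hypothesis Pe : forall i j, An (fun x => P i j x / P i j x0 - 1) delta.

Let a1 : a <= 1.
Proof.
rewrite -(P1 I0 px0) (bigD1 I0)//= -[leLHS]addr0 lerD// sumr_ge0// => j _.
by rewrite (le_trans (ltW a0)).
Qed.

Let P0_gt0 i j : 0 < P i j x0. Proof. exact: lt_le_trans a0 (Pa i j). Qed.
Let g : R := 1 - a ^+ 2 / 2.
Let aa : 0 < a ^+ 2 <= 1.
Proof. by rewrite exprn_gt0//= exprn_ile1// ltW. Qed.
Let g0 : 0 < g. Proof. by rewrite /g; case/andP: aa; lra. Qed.
Let g1 : g < 1. Proof. by rewrite /g; case/andP: aa; lra. Qed.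

Fixpoint pow_col (j : 'I_l) n (i : 'I_l) (x : 'rV[R]_m) : R :=
  if n is n'.+1 then \sum_k P i k x * pow_col j n' k x else (i == j)%:R.

Let b i j x := P i j x / P i j x0 - 1.
Let PE i j x : P i j x = P i j x0 * (1 + b i j x).
Proof. by rewrite /b; field; exact: lt0r_neq0. Qed.

Let P0p i : prob (fun j => P i j x0).
Proof. by split=> [j|]; [exact: ltW|exact: P1]. Qed.

Let bs i x : pdisc x -> \sum_j P i j x0 * b i j x = 0.
Proof.
move=> xr; transitivity (\sum_j P i j x - \sum_j P i j x0); last by rewrite !P1// subrr.
by rewrite -sumrB; apply: eq_bigr => j _; rewrite (PE i j x); ring.
Qed.

Lemma osc_pow_col j n : osc x0 rho (pow_col j n) (2 * g ^+ n).
Proof.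
elim: n => [|n IH] i i'.
  have H h := An_cst x0 (h == j)%:R rho0'.
  apply: An_le (An_ext _ (AnB rho0' (H i) (H i'))) => //.
  have B h : `|(h == j)%:R| <= 1 :> R by rewrite normr_nat lern1 leq_b1.
  by rewrite expr0 mulr1; have := B i; have := B i'; lra.
have H := osc_step rho0 I0 (ltW a0) P0p Pa Pe bs IH.
apply: An_le (An_ext _ (H i i')).
  rewrite (exprS g) [leRHS]mulrCA ler_wpM2r ?mulr_ge0 ?exprn_ge0 ?(ltW g0)//.
  by rewrite /g; have := deltaa; lra.
by move=> x xr /=; congr (_ - _); apply: eq_bigr => k _; congr (_ * _); exact/esym/PE.
Qed.

Let v_pow j n x : pdisc x -> v j x = \sum_i v i x * pow_col j n i x.
Proof.
move=> xr; elim: n => [|n IH] /=.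
  rewrite (bigD1 j)//= eqxx mulr1 big1 ?addr0// => i /negbTE ->; exact: mulr0.
rewrite {1}IH; under [RHS]eq_bigr => i _ do rewrite mulr_sumr.
rewrite exchange_big/=; apply: eq_bigr => k _.
by rewrite -(vP k xr) mulr_suml; apply: eq_bigr => i _; rewrite mulrA.
Qed.

(** Row [I0] of the powers of the matrix converges to the stationary vector. Consecutive powers
    differ by an average of oscillations of a column, so the telescoped series converges in norm
    like [g ^+ n]; invariance of [v] identifies the limit at each point. *)
Lemma An_stationary j : An (v j) (1 + 4 * (1 - g)^-1).
Proof.
pose f n := if n is n'.+1 then (fun x => pow_col j n'.+1 I0 x - pow_col j n' I0 x) else pow_col j 0 I0.
pose B n : R := if n is n'.+1 then 4 * g ^+ n' else 1.
apply: (@An_series _ _ _ _ f B) => //.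
- case=> [|n].
    apply: An_le (An_cst x0 (I0 == j)%:R rho0').
    by rewrite normr_nat lern1 leq_b1.
  have H : An (fun x => \sum_k P I0 k x0 * ((1 + b I0 k x) * (pow_col j n k x - pow_col j n I0 x))) (4 * g ^+ n).
    apply: An_avg => // k.
    apply: An_le (AnM rho0' (AnD rho0' (An_cst x0 1 rho0') (Pe I0 k)) (osc_pow_col j n k I0)).
    rewrite normr1 mulrA ler_wpM2r ?exprn_ge0 ?(ltW g0)//; have := delta1; lra.
  apply: An_ext H => x xr; rewrite /f /=.
  transitivity (\sum_k P I0 k x * pow_col j n k x - (\sum_k P I0 k x) * pow_col j n I0 x); last first.
    by rewrite P1// mul1r.
  rewrite mulr_suml -sumrB; apply: eq_bigr => k _; rewrite [in RHS](PE _ k x); ring.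
- case=> [|n].
    rewrite big_ord0 addr_ge0// mulr_ge0// invr_ge0 subr_ge0; exact: ltW.
  rewrite big_ord_recl/= lerD2l -mulr_sumr ler_wpM2l// geom_partial_le//.
  by rewrite (ltW g0).
move=> x xr; rewrite -(cvg_shiftn 1)/=.
have E n : \sum_(i < n + 1) f i x = pow_col j n I0 x.
  rewrite addn1; elim: n => [|n IH]; first by rewrite big_ord1.
  by rewrite big_ord_recr IH/= addrC subrK.
rewrite (_ : (fun _ => _) = (fun n => pow_col j n I0 x)); last by apply/funext => n; rewrite /= E.
apply: (@cvg_dominated _ _ (fun n => 2 * g ^+ n)).
  rewrite -(mulr0 2); apply: cvgM; first exact: cvg_cst.
  by apply: cvg_pow0; rewrite gtr0_norm.
move=> n; rewrite distrC (v_pow j n xr).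
have -> : pow_col j n I0 x = \sum_i v i x * pow_col j n I0 x by rewrite -mulr_suml v1// mul1r.
rewrite -sumrB; apply: le_trans (ler_norm_sum _ _ _) _.
apply: (@le_trans _ _ (\sum_i v i x * (2 * g ^+ n))); last by rewrite -mulr_suml v1// mul1r.
apply: ler_sum => i _; rewrite -mulrBr normrM ger0_norm ?v0// ler_wpM2l ?v0//.
exact: (An_bound rho0' (osc_pow_col j n i I0) xr).
Qed.

End stationary.

(** * Integration over words *)

Section tuple_integrals.
Variable R : realType.
Local Notation rT := (measurableTypeR R).
Local Notation leb := (@lebesgue_measure R).
Implicit Types (f g : seq R -> R) (n : nat).

(** Functions live on sequences, so that adding and deleting letters changes no type; the length
    enters only through measurability and integration. *)
Definition tmeas n f := measurable_fun [set: n.-tuple rT] (fun t : n.-tuple rT => f t).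
Definition tint n f : \bar R := (\int[lebesgue_tuple R n]_t (f (tval t))%:E)%E.

Lemma tmeas_prod n f : tmeas n.+1 f ->
  measurable_fun [set: rT * n.-tuple rT] (fun p => f (p.1 :: p.2)).
Proof.
move=> mf; have := measurableT_comp mf (@measurable_tuple_cons R n); exact.
Qed.

Lemma tmeas_cons n f (z : R) : tmeas n.+1 f -> tmeas n (fun s => f (z :: s)).
Proof.
move=> /tmeas_prod mf.
by apply: (measurableT_comp mf (measurable_pair1 z)).
Qed.

Lemma tmeas_behead n f : tmeas n f -> tmeas n.+1 (fun s => f (behead s)).
Proof.
move=> mf.
have mb : measurable_fun [set: n.+1.-tuple rT]
    (fun t : n.+1.-tuple rT => [tuple of behead t] : n.-tuple rT) by exact: measurable_behead.
by have := measurableT_comp mf mb; exact.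
Qed.

Lemma tmeas_head n (g : R -> R) : measurable_fun [set: rT] g ->
  tmeas n.+1 (fun s => g (head 0 s)).
Proof.
move=> mg; rewrite /tmeas (_ : (fun _ => _) = (fun t : n.+1.-tuple rT => g (tnth t ord0))).
  by have := measurableT_comp mg (@measurable_tnth _ rT n.+1 ord0); exact.
by apply/funext => t; rewrite (tnth_nth 0) nth0.
Qed.

Definition front (s : seq R) := take (size s).-1 s.

Lemma front_cons z s : s != [::] -> front (z :: s) = z :: front s.
Proof. by case: s. Qed.

Lemma front_rcons s z : front (rcons s z) = s.
Proof. by rewrite /front size_rcons/= -cats1 take_size_cat. Qed.

Lemma tmeas_front n f : tmeas n f -> tmeas n.+1 (fun s => f (front s)).
Proof.
move=> mf.
have P (t : n.+1.-tuple rT) : size (front t) == n.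
  by rewrite /front size_take_min (size_tuple t)/=; apply/eqP/minn_idPl.
pose h (t : n.+1.-tuple rT) : n.-tuple rT := Tuple (P t).
suff mh : measurable_fun [set: n.+1.-tuple rT] h by have := measurableT_comp mf mh; exact.
apply/measurable_fun_tnthP => i.
rewrite (_ : _ \o _ = (fun t : n.+1.-tuple rT => tnth t (widen_ord (leqnSn n) i))).
  exact: measurable_tnth.
apply/funext => t /=; rewrite (tnth_nth 0) (tnth_nth 0)/=.
by rewrite /front nth_take// size_tuple.
Qed.

Lemma tint0 f : tint 0 f = (f [::])%:E.
Proof.
rewrite /tint (_ : (fun _ => _) = cst (f [::])%:E); last first.
  by apply/funext => t; rewrite tuple0.
by rewrite /= integral_dirac//= diracT mul1e.
Qed.

Lemma tintS n f : tmeas n.+1 f -> (forall s, 0 <= f s) ->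
  tint n.+1 f = (\int[leb]_z tint n (fun s => f (z :: s)))%E.
Proof.
move=> mf f0.
have H := @ge0_integral_pushforward _ _ _ _ R _ (@measurable_tuple_cons R n)
  (leb \x lebesgue_tuple R n)%E setT (fun t => (f (tval t))%:E) measurableT.
have {}H := H ((measurable_EFinP _ _).2 mf) (fun t _ => f0 (tval t)).
etransitivity; last (etransitivity; first exact: H).
  by apply: eq_measure_integral => //; exact: measurable_tuple_cons.
rewrite preimage_setT (@fubini_tonelli1 _ _ _ _ _ _ _ (fun p : rT * n.-tuple rT => (f (p.1 :: p.2))%:E))//.
  apply/measurable_EFinP; exact: tmeas_prod.
by move=> p; rewrite lee_fin.
Qed.

Lemma tint_swap n f : tmeas n.+1 f -> (forall s, 0 <= f s) ->
  tint n.+1 f = (\int[lebesgue_tuple R n]_t \int[leb]_z (f (z :: t))%:E)%E.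
Proof.
move=> mf f0; rewrite tintS// /tint.
rewrite (@fubini_tonelli _ _ _ _ _ _ _ (fun p : rT * n.-tuple rT => (f (p.1 :: p.2))%:E))//.
  apply/measurable_EFinP; exact: tmeas_prod.
by move=> p; rewrite lee_fin.
Qed.

End tuple_integrals.

(** * Densities of words and their consistency *)

Section weights.
Variables (R : realType) (l : nat).
Local Notation rT := (measurableTypeR R).
Local Notation leb := (@lebesgue_measure R).
Variables (q : 'I_l -> R -> R) (P : 'I_l -> 'I_l -> R).
Implicit Types (f g : seq R -> R) (n : nat).
Hypothesis mq : forall i, measurable_fun [set: rT] (q i).
Hypothesis q0 : forall i z, 0 <= q i z.
Hypothesis P0 : forall i j, 0 <= P i j.

(* [W s i] is the density of the word [s] given that the chain starts in [i]. *)
Fixpoint W (s : seq R) (i : 'I_l) : R :=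
  if s is z :: s' then q i z * \sum_j P i j * W s' j else 1.

Lemma W_ge0 s i : 0 <= W s i.
Proof.
elim: s i => [//|z s IH] i /=.
by rewrite mulr_ge0// sumr_ge0// => j _; rewrite mulr_ge0.
Qed.

Lemma tmeas_W n i : tmeas n (W ^~ i).
Proof.
elim: n i => [|n IH] i.
  rewrite /tmeas (_ : (fun _ => _) = cst 1)//.
  by apply/funext => t; rewrite tuple0.
have H : tmeas n.+1 (fun s => q i (head 0 s) * \sum_j P i j * W (behead s) j).
  have H1 := @tmeas_head R n _ (mq i).
  apply: (measurable_funM H1); apply: measurable_sum => j; apply: measurable_funM => //.
  exact: (tmeas_behead (IH j)).
rewrite /tmeas (_ : (fun _ => _) = (fun t : n.+1.-tuple rT => q i (head 0 t) * \sum_j P i j * W (behead t) j))//.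
by apply/funext => -[[|z s] st].
Qed.

Lemma tint_sumZ n (c : 'I_l -> R) (f : 'I_l -> seq R -> R) : (forall j, 0 <= c j) ->
  (forall j, tmeas n (f j)) -> (forall j s, 0 <= f j s) ->
  tint n (fun s => \sum_j c j * f j s) = (\sum_j (c j)%:E * tint n (f j))%E.
Proof.
move=> c0 mf f0; rewrite /tint.
under eq_integral => t _ do rewrite -sumEFin.
rewrite ge0_integral_sum//.
- apply: eq_bigr => j _; under eq_integral => t _ do rewrite EFinM.
  rewrite ge0_integralZl_EFin//; [by move=> t _; rewrite lee_fin|].
  by apply/measurable_EFinP; exact: mf.
- move=> j; apply/measurable_EFinP; apply: measurable_funM => //; exact: mf.
- by move=> j t _; rewrite lee_fin mulr_ge0.
Qed.

Lemma tintZ n (c : R) f : 0 <= c -> tmeas n f -> (forall s, 0 <= f s) ->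
  tint n (fun s => c * f s) = (c%:E * tint n f)%E.
Proof.
move=> c0 mf f0; rewrite /tint; under eq_integral => t _ do rewrite EFinM.
rewrite ge0_integralZl_EFin//; [by move=> t _; rewrite lee_fin|].
by apply/measurable_EFinP; exact: mf.
Qed.

Lemma tmeasM n f g : tmeas n f -> tmeas n g -> tmeas n (fun s => f s * g s).
Proof. exact: measurable_funM. Qed.

Lemma tint_ge0 n f : (forall s, 0 <= f s) -> (0 <= tint n f)%E.
Proof. by move=> f0; apply: integral_ge0 => t _; rewrite lee_fin. Qed.

Lemma tint_W n i f : tmeas n.+1 f -> (forall s, 0 <= f s) ->
  tint n.+1 (fun s => W s i * f s) =
  (\int[leb]_z ((q i z)%:E * \sum_j (P i j)%:E * tint n (fun s => (W s j * f (z :: s))%R)))%E.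
Proof.
move=> mf f0; rewrite tintS; last 2 first.
- by apply: tmeasM => //; exact: tmeas_W.
- by move=> s; rewrite mulr_ge0 ?W_ge0.
apply: eq_integral => z _.
have mz j : tmeas n (fun s => W s j * f (z :: s)).
  by apply: tmeasM; [exact: tmeas_W|exact: tmeas_cons].
have z0 j s : 0 <= W s j * f (z :: s) by rewrite mulr_ge0 ?W_ge0.
rewrite -tint_sumZ// -tintZ//.
- by congr (tint _ _); apply/funext => s /=; rewrite -mulrA mulr_suml; congr (_ * _);
    apply: eq_bigr => j _; rewrite mulrA.
- apply: measurable_sum => j; apply: measurable_funM => //; exact: mz.
- by move=> s; apply: sumr_ge0 => j _; rewrite mulr_ge0.
Qed.

(** Meant for the norm majorants of the densities and of the transition probabilities, whose masses
    may exceed 1; this is the source of [kappa ^+ n]. *)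
Lemma tint_W_le (c : 'I_l -> R) (kappa : R) n i : 0 <= kappa ->
  (forall i, (\int[leb]_z (q i z)%:E <= (c i)%:E)%E) ->
  (forall i, 0 <= c i) -> (forall i, c i * \sum_j P i j <= kappa) ->
  (tint n (W ^~ i) <= (kappa ^+ n)%:E)%E.
Proof.
move=> kappa0 qc c0 cP; elim: n i => [|n IH] i; first by rewrite tint0 expr0.
have -> : tint n.+1 (W ^~ i) = tint n.+1 (fun s => W s i * 1).
  by congr tint; apply/funext => s; rewrite mulr1.
have m1 : tmeas n.+1 (fun=> 1 : R) by exact: measurable_cst.
rewrite tint_W//; have S0 : 0 <= \sum_j P i j by apply: sumr_ge0.
apply: (@le_trans _ _ (\int[leb]_z ((\sum_j P i j * kappa ^+ n)%:E * (q i z)%:E))%E).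
  apply: ge0_le_integral => //.
  - move=> z _; rewrite mule_ge0 ?lee_fin// sume_ge0// => j _.
    by rewrite mule_ge0 ?lee_fin// tint_ge0// => s; rewrite mulr1 W_ge0.
  - apply: emeasurable_funM; first exact/measurable_EFinP.
    by apply: measurable_cst.
  - by apply: emeasurable_funM => //; exact/measurable_EFinP.
  - move=> z _; rewrite muleC lee_wpmul2r ?lee_fin// -sumEFin; apply: lee_sum => j _.
    rewrite EFinM lee_wpmul2l ?lee_fin//; apply: le_trans (IH j).
    by rewrite (_ : (fun s => W s j * 1) = W ^~ j)//; apply/funext => s; rewrite mulr1.
rewrite ge0_integralZl_EFin//; last 3 first.
- by move=> z _; rewrite lee_fin.
- exact/measurable_EFinP.
- by apply: sumr_ge0 => j _; rewrite mulr_ge0// exprn_ge0.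
apply: (@le_trans _ _ ((\sum_j P i j * kappa ^+ n)%:E * (c i)%:E)%E).
  by rewrite lee_wpmul2l ?lee_fin// sumr_ge0// => j _; rewrite mulr_ge0// exprn_ge0.
rewrite -EFinM lee_fin -mulr_suml exprS mulrAC ler_wpM2r ?exprn_ge0//.
by rewrite mulrC.
Qed.

Hypothesis q1 : forall i, (\int[leb]_z (q i z)%:E = 1)%E.
Hypothesis P1 : forall i, \sum_j P i j = 1.

(** The last letter integrates out because the densities and the rows have total mass 1. *)
Lemma tint_W_front n i f : (forall k, tmeas k f) -> (forall s, 0 <= f s) ->
  tint n.+1 (fun s => W s i * f (front s)) = tint n (fun s => W s i * f s).
Proof.
elim: n i f => [|n IH] i f mf f0.
  rewrite tint_W//; last exact: tmeas_front.
  rewrite tint0 mul1r -[RHS]mule1 -(q1 i) -ge0_integralZl_EFin//; last 2 first.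
  - by move=> z _; rewrite lee_fin.
  - exact/measurable_EFinP.
  apply: eq_integral => z _; rewrite muleC; congr (_ * _)%E.
  rewrite (eq_bigr (fun j => (P i j * f [::])%:E)); last first.
    by move=> j _; rewrite tint0 mul1r -EFinM.
  by rewrite sumEFin -mulr_suml P1 mul1r.
rewrite tint_W//; last exact: tmeas_front.
rewrite tint_W//; apply: eq_integral => z _; congr (_ * _)%E; apply: eq_bigr => j _.
congr (_ * _)%E; rewrite -(IH j (fun s => f (z :: s)))//; last by move=> k; exact: tmeas_cons.
apply: eq_integral => t _; congr ((_ * _)%:E); congr f.
by rewrite front_cons//; case: t => -[].
Qed.

Lemma tint_W1 n i : tint n (W ^~ i) = 1%E.
Proof.
have E k : tint k (W ^~ i) = tint k (fun s => W s i * 1).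
  by congr tint; apply/funext => s; rewrite mulr1.
elim: n => [|n IH]; first by rewrite tint0.
have m1 k : tmeas k (fun=> 1 : R) by exact: measurable_cst.
by rewrite E (tint_W_front n i (f := fun=> 1))// -E.
Qed.

Variable v : 'I_l -> R.
Hypothesis v0 : forall i, 0 <= v i.
Hypothesis vP : forall j, \sum_i v i * P i j = v j.

Definition pdens (s : seq R) : R := \sum_i v i * W s i.

Lemma pdens_ge0 s : 0 <= pdens s.
Proof. by apply: sumr_ge0 => i _; rewrite mulr_ge0 ?W_ge0. Qed.

Lemma tmeas_pdens n : tmeas n pdens.
Proof.
apply: measurable_sum => j; apply: measurable_funM => //; exact: tmeas_W.
Qed.

Lemma tint_pdens n f : tmeas n f -> (forall s, 0 <= f s) ->
  tint n (fun s => pdens s * f s) = (\sum_i (v i)%:E * tint n (fun s => (W s i * f s)%R))%E.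
Proof.
move=> mf f0; rewrite -tint_sumZ//.
- congr tint; apply/funext => s; rewrite /pdens mulr_suml; apply: eq_bigr => i _.
  by rewrite mulrA.
- by move=> j; apply: tmeasM => //; exact: tmeas_W.
- by move=> j s; rewrite mulr_ge0 ?W_ge0.
Qed.

Lemma tint_pdens_front n f : (forall k, tmeas k f) -> (forall s, 0 <= f s) ->
  tint n.+1 (fun s => pdens s * f (front s)) = tint n (fun s => pdens s * f s).
Proof.
move=> mf f0; rewrite !tint_pdens//; last exact: tmeas_front.
by apply: eq_bigr => i _; rewrite tint_W_front.
Qed.

(** Integrating out the first letter replaces the initial vector by its image under the transition
    matrix; stationarity enters here. *)
Lemma tint_pdens_behead n f : tmeas n f -> (forall s, 0 <= f s) ->
  tint n.+1 (fun s => pdens s * f (behead s)) = tint n (fun s => pdens s * f s).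
Proof.
move=> mf f0; rewrite tint_swap; last 2 first.
- by apply: tmeasM; [exact: tmeas_pdens|exact: tmeas_behead].
- by move=> s; rewrite mulr_ge0 ?pdens_ge0.
apply: eq_integral => t _ /=.
pose c i := v i * (\sum_j P i j * W t j) * f t.
have c0 i : 0 <= c i.
  rewrite /c mulr_ge0// mulr_ge0// sumr_ge0// => j _; by rewrite mulr_ge0 ?W_ge0.
transitivity (\int[leb]_z (\sum_i (c i)%:E * (q i z)%:E))%E.
  apply: eq_integral => z _; rewrite /pdens mulr_suml -sumEFin.
  by apply: eq_bigr => i _; rewrite -EFinM /c /=; congr EFin; ring.
rewrite ge0_integral_sum//; last 2 first.
- by move=> i; apply: emeasurable_funM => //; exact/measurable_EFinP.
- by move=> i z _; rewrite mule_ge0 ?lee_fin.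
transitivity (\sum_i (c i)%:E)%E.
  apply: eq_bigr => i _; rewrite ge0_integralZl_EFin ?q1 ?mule1//.
    by move=> z _; rewrite lee_fin.
  exact/measurable_EFinP.
rewrite sumEFin; congr EFin; rewrite /c -mulr_suml; congr (_ * _).
under eq_bigr => i _ do rewrite mulr_sumr.
rewrite exchange_big/=; apply: eq_bigr => j _.
by rewrite -vP mulr_suml; apply: eq_bigr => i _; rewrite mulrA.
Qed.

Lemma tint_pdens_head n (g : R -> R) : measurable_fun [set: rT] g -> (forall z, 0 <= g z) ->
  tint n.+1 (fun s => pdens s * g (head 0 s)) =
  (\int[leb]_z ((\sum_i v i * q i z) * g z)%:E)%E.
Proof.
move=> mg g0; rewrite tint_pdens//; last exact: tmeas_head.
transitivity (\sum_i (v i)%:E * \int[leb]_z (q i z * g z)%:E)%E.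
  apply: eq_bigr => i _; congr (_ * _)%E; rewrite tint_W//; last exact: tmeas_head.
  apply: eq_integral => z _; rewrite EFinM; congr (_ * _)%E.
  rewrite (eq_bigr (fun j => (P i j)%:E * (g z)%:E)%E); last first.
    move=> j _; congr (_ * _)%E; rewrite /= (_ : (fun s => _) = (fun s => (g z * W s j)%R)).
      by rewrite tintZ ?tint_W1 ?mule1//; [exact: tmeas_W|move=> s; exact: W_ge0].
    by apply/funext => s; rewrite mulrC.
  under eq_bigr => j _ do rewrite -EFinM.
  by rewrite sumEFin -mulr_suml P1 mul1r.
have mi i : measurable_fun [set: rT] (fun z => (q i z * g z)%:E).
  by apply/measurable_EFinP; exact: measurable_funM.
transitivity (\int[leb]_z (\sum_i (v i)%:E * (q i z * g z)%:E))%E.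
  rewrite ge0_integral_sum//.
  - apply: eq_bigr => i _; rewrite ge0_integralZl_EFin//.
    by move=> z _; rewrite lee_fin mulr_ge0.
  - by move=> i; apply: emeasurable_funM.
  - by move=> i z _; rewrite mule_ge0 ?lee_fin// mulr_ge0.
apply: eq_integral => z _; rewrite mulr_suml -sumEFin; apply: eq_bigr => i _.
by rewrite -EFinM mulrA.
Qed.

End weights.

Section transfer.
Variable R : realType.

Lemma rintegrable_ge0 d (T : measurableType d) (mu : {measure set T -> \bar R}) (f : T -> R) :
  measurable_fun [set: T] f -> (forall t, 0 <= f t) ->
  (\int[mu]_t (f t)%:E < +oo)%E -> rintegrable mu f.
Proof.
move=> mf f0 fi; apply/integrableP; split; first exact/measurable_EFinP.
by under eq_integral => t _ do rewrite /= ger0_norm//.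
Qed.

Lemma rintegrable_lty d (T : measurableType d) (mu : {measure set T -> \bar R}) (f : T -> R) :
  (forall t, 0 <= f t) -> rintegrable mu f -> (\int[mu]_t (f t)%:E < +oo)%E.
Proof.
move=> f0 /integrableP[_]; by under eq_integral => t _ do rewrite /= ger0_norm//.
Qed.

(** The identities above are Tonelli statements for nonnegative functions; signed functions follow
    from their positive and negative parts. *)
Lemma rintegrable_transfer d1 d2 (T1 : measurableType d1) (T2 : measurableType d2)
    (mu : {measure set T1 -> \bar R}) (nu : {measure set T2 -> \bar R})
    (a b : T1 -> R) (a' b' : T2 -> R) :
  measurable_fun [set: T1] a -> measurable_fun [set: T1] b ->
  (forall t, 0 <= a t) -> (forall t, 0 <= b t) ->
  (forall t, 0 <= a' t) -> (forall t, 0 <= b' t) ->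
  rintegrable nu a' -> rintegrable nu b' ->
  (\int[mu]_t (a t)%:E = \int[nu]_t (a' t)%:E)%E ->
  (\int[mu]_t (b t)%:E = \int[nu]_t (b' t)%:E)%E ->
  rintegrable mu (fun t => a t - b t) /\
  \int[mu]_t (a t - b t) = \int[nu]_t (a' t - b' t).
Proof.
move=> ma mb a0 b0 a'0 b'0 ia' ib' Ea Eb.
have ia : rintegrable mu a by apply: rintegrable_ge0 => //; rewrite Ea; exact: rintegrable_lty.
have ib : rintegrable mu b by apply: rintegrable_ge0 => //; rewrite Eb; exact: rintegrable_lty.
split.
  have := rintegrableD ia (rintegrableZl (-1) ib); congr (rintegrable _ _).
  by apply/funext => t; rewrite mulN1r.
by rewrite !RintegralB// /Rintegral Ea Eb.
Qed.

Definition posr (x : R) := Num.max x 0.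
Definition negr (x : R) := Num.max (- x) 0.

Lemma pos_negE x : x = posr x - negr x.
Proof.
rewrite /posr /negr; have [x0|x0] := leP x 0.
  by rewrite max_l ?oppr_ge0// sub0r opprK.
by rewrite max_r ?subr0// oppr_le0 ltW.
Qed.

Lemma posr_ge0 x : 0 <= posr x. Proof. by rewrite le_max lexx orbT. Qed.
Lemma negr_ge0 x : 0 <= negr x. Proof. by rewrite le_max lexx orbT. Qed.
Lemma posr_le x : posr x <= `|x|. Proof. by rewrite ge_max ler_norm normr_ge0. Qed.
Lemma negr_le x : negr x <= `|x|. Proof. by rewrite ge_max -normrN ler_norm normr_ge0. Qed.

Lemma measurable_posr d (T : measurableType d) (f : T -> R) :
  measurable_fun [set: T] f -> measurable_fun [set: T] (fun t => posr (f t)).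
Proof. by move=> mf; apply: measurable_maxr. Qed.

Lemma measurable_negr d (T : measurableType d) (f : T -> R) :
  measurable_fun [set: T] f -> measurable_fun [set: T] (fun t => negr (f t)).
Proof.
by move=> mf; apply: measurable_maxr => //; exact: measurableT_comp.
Qed.

End transfer.

(** * Decomposition of the expected log-density of a block *)

Section entropy_decomposition.
Variables (R : realType) (l : nat).
Local Notation rT := (measurableTypeR R).
Local Notation leb := (@lebesgue_measure R).
Variables (q : 'I_l -> R -> R) (P : 'I_l -> 'I_l -> R) (v : 'I_l -> R).
Implicit Types (f g : seq R -> R) (n : nat).
Hypothesis mq : forall i, measurable_fun [set: rT] (q i).
Hypothesis q0 : forall i z, 0 <= q i z.
Hypothesis P0 : forall i j, 0 <= P i j.
Hypothesis q1 : forall i, (\int[leb]_z (q i z)%:E = 1)%E.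
Hypothesis P1 : forall i, \sum_j P i j = 1.
Hypothesis v0 : forall i, 0 <= v i.
Hypothesis vP : forall j, \sum_i v i * P i j = v j.
Hypothesis v1 : \sum_i v i = 1.
Local Notation p := (pdens q P v).

Let p0 s : 0 <= p s. Proof. exact: pdens_ge0. Qed.
Let mp n : tmeas n p. Proof. exact: tmeas_pdens. Qed.

Definition expect n f : R := \int[lebesgue_tuple R n]_t (p (tval t) * f (tval t)).
Definition eint n f := rintegrable (lebesgue_tuple R n) (fun t : n.-tuple rT => p t * f t).

Lemma tint_pdens1 n : tint n p = 1%E.
Proof.
have m1 : tmeas n (fun=> 1 : R) by exact: measurable_cst.
have -> : tint n p = tint n (fun s => p s * 1).
  by congr tint; apply/funext => s; rewrite mulr1.
rewrite tint_pdens// (eq_bigr (fun i => (v i)%:E)); last first.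
  move=> i _; rewrite (_ : (fun s => _) = (W q P)^~ i); last by apply/funext => s; rewrite mulr1.
  by rewrite tint_W1// mule1.
by rewrite sumEFin v1.
Qed.

Lemma eint_bounded n f (K : R) : tmeas n f -> (forall t : n.-tuple rT, `|f t| <= K) -> eint n f.
Proof.
move=> mf fK.
have pi : rintegrable (lebesgue_tuple R n) (fun t : n.-tuple rT => p t).
  apply: rintegrable_ge0 => //; first exact: mp.
  by rewrite [X in (X < _)%E](tint_pdens1 n) ltry.
have := rintegrableZl K pi; apply: rintegrable_le; first exact: tmeasM.
by move=> t; rewrite normrM ger0_norm// mulrC ler_wpM2r.
Qed.

Lemma expect_bounded n f (K : R) : tmeas n f -> (forall t : n.-tuple rT, `|f t| <= K) ->
  `|expect n f| <= K.
Proof.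
move=> mf fK; have H := eint_bounded mf fK.
have K0 : 0 <= K by exact: le_trans (fK [tuple of nseq n 0]).
have mK : tmeas n (fun=> K) by exact: measurable_cst.
have H1 : eint n (fun=> K) by apply: (eint_bounded (K := K) mK) => t; rewrite ger0_norm.
apply: le_trans (le_normr_Rintegral measurableT H) _.
apply: (@le_trans _ _ (expect n (fun=> K))).
  apply: le_Rintegral => //; first exact: integrable_norm.
  by move=> t _; rewrite normrM (ger0_norm (p0 _)) ler_wpM2l.
rewrite /expect; under eq_Rintegral => t _ do rewrite mulrC.
rewrite RintegralZl//; last first.
  apply: rintegrable_ge0 => //; first exact: mp.
  by rewrite [X in (X < _)%E](tint_pdens1 n) ltry.
by rewrite /Rintegral [X in fine X](tint_pdens1 n)/= mulr1.
Qed.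

Let eint_posr n f : tmeas n f -> eint n f -> eint n (fun s => posr (f s)).
Proof.
move=> mf fi; apply: rintegrable_le (integrable_norm fi).
  exact: (measurable_funM (@mp n) (measurable_posr mf)).
by move=> t /=; rewrite !normrM ler_wpM2l// (ger0_norm (posr_ge0 _)) posr_le.
Qed.

Let eint_negr n f : tmeas n f -> eint n f -> eint n (fun s => negr (f s)).
Proof.
move=> mf fi; apply: rintegrable_le (integrable_norm fi).
  exact: (measurable_funM (@mp n) (measurable_negr mf)).
by move=> t /=; rewrite !normrM ler_wpM2l// (ger0_norm (negr_ge0 _)) negr_le.
Qed.

Let split_posr n f : (fun t : n.-tuple rT => p t * f t) =
  (fun t : n.-tuple rT => p t * posr (f t) - p t * negr (f t)).
Proof. by apply/funext => t; rewrite -mulrBr -pos_negE. Qed.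

Lemma expect_behead n f : tmeas n f -> eint n f ->
  eint n.+1 (fun s => f (behead s)) /\ expect n.+1 (fun s => f (behead s)) = expect n f.
Proof.
move=> mf fi; rewrite /eint /expect.
rewrite (split_posr n f) (split_posr n.+1 (fun s => f (behead s))).
apply: (rintegrable_transfer (mu := lebesgue_tuple R n.+1) (nu := lebesgue_tuple R n)
  (a := fun t : n.+1.-tuple rT => p t * posr (f (behead t)))
  (b := fun t : n.+1.-tuple rT => p t * negr (f (behead t)))
  (a' := fun t : n.-tuple rT => p t * posr (f t))
  (b' := fun t : n.-tuple rT => p t * negr (f t))).
- exact: (measurable_funM (@mp n.+1) (@tmeas_behead _ _ (fun s => posr (f s)) (measurable_posr mf))).
- exact: (measurable_funM (@mp n.+1) (@tmeas_behead _ _ (fun s => negr (f s)) (measurable_negr mf))).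
- by move=> t; rewrite mulr_ge0 ?posr_ge0.
- by move=> t; rewrite mulr_ge0 ?negr_ge0.
- by move=> t; rewrite mulr_ge0 ?posr_ge0.
- by move=> t; rewrite mulr_ge0 ?negr_ge0.
- exact: eint_posr.
- exact: eint_negr.
- exact: (@tint_pdens_behead R l q P mq q0 P0 q1 v v0 vP n
    (fun s => posr (f s)) (measurable_posr mf) (fun s => posr_ge0 _)).
- exact: (@tint_pdens_behead R l q P mq q0 P0 q1 v v0 vP n
    (fun s => negr (f s)) (measurable_negr mf) (fun s => negr_ge0 _)).
Qed.

Lemma expect_front n f : (forall k, tmeas k f) -> eint n f ->
  eint n.+1 (fun s => f (front s)) /\ expect n.+1 (fun s => f (front s)) = expect n f.
Proof.
move=> mf fi; rewrite /eint /expect.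
rewrite (split_posr n f) (split_posr n.+1 (fun s => f (front s))).
apply: (rintegrable_transfer (mu := lebesgue_tuple R n.+1) (nu := lebesgue_tuple R n)
  (a := fun t : n.+1.-tuple rT => p t * posr (f (front t)))
  (b := fun t : n.+1.-tuple rT => p t * negr (f (front t)))
  (a' := fun t : n.-tuple rT => p t * posr (f t))
  (b' := fun t : n.-tuple rT => p t * negr (f t))).
- exact: (measurable_funM (@mp n.+1) (@tmeas_front _ _ (fun s => posr (f s)) (measurable_posr (@mf n)))).
- exact: (measurable_funM (@mp n.+1) (@tmeas_front _ _ (fun s => negr (f s)) (measurable_negr (@mf n)))).
- by move=> t; rewrite mulr_ge0 ?posr_ge0.
- by move=> t; rewrite mulr_ge0 ?negr_ge0.
- by move=> t; rewrite mulr_ge0 ?posr_ge0.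
- by move=> t; rewrite mulr_ge0 ?negr_ge0.
- exact: eint_posr.
- exact: eint_negr.
- exact: (@tint_pdens_front R l q P mq q0 P0 q1 P1 v v0 n
    (fun s => posr (f s)) (fun k => measurable_posr (@mf k)) (fun s => posr_ge0 _)).
- exact: (@tint_pdens_front R l q P mq q0 P0 q1 P1 v v0 n
    (fun s => negr (f s)) (fun k => measurable_negr (@mf k)) (fun s => negr_ge0 _)).
Qed.

Lemma expect_head n (g : R -> R) : measurable_fun [set: rT] g ->
  rintegrable leb (fun z => (\sum_i v i * q i z) * g z) ->
  eint n.+1 (fun s => g (head 0 s)) /\
  expect n.+1 (fun s => g (head 0 s)) = \int[leb]_z ((\sum_i v i * q i z) * g z).
Proof.
move=> mg gi; rewrite /eint /expect.
have w0 z : 0 <= \sum_i v i * q i z by apply: sumr_ge0 => i _; rewrite mulr_ge0.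
have mw : measurable_fun [set: rT] (fun z => \sum_i v i * q i z).
  by apply: measurable_sum => i; apply: measurable_funM.
rewrite (split_posr n.+1 (fun s => g (head 0 s))).
rewrite (_ : (fun z => _) =
    (fun z => (\sum_i v i * q i z) * posr (g z) - (\sum_i v i * q i z) * negr (g z))); last first.
  by apply/funext => z; rewrite -mulrBr -pos_negE.
apply: (rintegrable_transfer (mu := lebesgue_tuple R n.+1) (nu := leb)
  (a := fun t : n.+1.-tuple rT => p t * posr (g (head 0 t)))
  (b := fun t : n.+1.-tuple rT => p t * negr (g (head 0 t)))
  (a' := fun z => (\sum_i v i * q i z) * posr (g z))
  (b' := fun z => (\sum_i v i * q i z) * negr (g z))).
- exact: (measurable_funM (@mp n.+1) (@tmeas_head _ _ (fun s => posr (g s)) (measurable_posr mg))).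
- exact: (measurable_funM (@mp n.+1) (@tmeas_head _ _ (fun s => negr (g s)) (measurable_negr mg))).
- by move=> t; rewrite mulr_ge0 ?posr_ge0.
- by move=> t; rewrite mulr_ge0 ?negr_ge0.
- by move=> t; rewrite mulr_ge0 ?posr_ge0.
- by move=> t; rewrite mulr_ge0 ?negr_ge0.
- apply: rintegrable_le (integrable_norm gi); first by apply: measurable_funM => //; exact: measurable_posr.
  by move=> t /=; rewrite !normrM ler_wpM2l// (ger0_norm (posr_ge0 _)) posr_le.
- apply: rintegrable_le (integrable_norm gi); first by apply: measurable_funM => //; exact: measurable_negr.
  by move=> t /=; rewrite !normrM ler_wpM2l// (ger0_norm (negr_ge0 _)) negr_le.
- exact: (@tint_pdens_head R l q P mq q0 P0 q1 P1 v v0 n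
    (fun s => posr (g s)) (measurable_posr mg) (fun s => posr_ge0 _)).
- exact: (@tint_pdens_head R l q P mq q0 P0 q1 P1 v v0 n
    (fun s => negr (g s)) (measurable_negr mg) (fun s => negr_ge0 _)).
Qed.

Variables (G : R -> seq R -> R) (rem : seq R -> R) (lq : R -> R) (K K' : R).
Hypothesis GK : forall z s, `|G z s| <= K.
Hypothesis mG : forall n, tmeas n (fun s => if s is z :: s' then G z s' else 0).
Hypothesis remK : forall s, `|rem s| <= K'.
Hypothesis mrem : forall n, tmeas n rem.
Hypothesis mlq : measurable_fun [set: rT] lq.
Hypothesis ilq : rintegrable leb (fun z => (\sum_i v i * q i z) * lq z).

Fixpoint lsum (s : seq R) : R := if s is z :: s' then G z s' + lsum s' else 0.
Definition lqsum (s : seq R) : R := \sum_(z <- s) lq z.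
Definition incr (s : seq R) : R := if s is z :: s' then G z s' else 0.

Hypothesis lnp : forall s, ln (p s) = lqsum s + lsum s + rem s.

Let cons_head n (t : n.+1.-tuple rT) : tval t = head 0 t :: behead t.
Proof. by case: t => -[]. Qed.

Lemma expectD n f g : eint n f -> eint n g ->
  eint n (fun s => f s + g s) /\ expect n (fun s => f s + g s) = expect n f + expect n g.
Proof.
move=> fi gi; have E : (fun t : n.-tuple rT => p t * (f t + g t)) = (fun t : n.-tuple rT => p t * f t + p t * g t).
  by apply/funext => t; rewrite mulrDr.
by split; [rewrite /eint E; exact: rintegrableD|rewrite /expect E; exact: RintegralD].
Qed.

Lemma eint_lsum n : tmeas n lsum /\ (forall t : n.-tuple rT, `|lsum t| <= n%:R * K).
Proof.
elim: n => [|n [IH1 IH2]].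
  by split=> [|t]; [rewrite /tmeas (_ : (fun _ => _) = cst 0)//; apply/funext => t|];
    rewrite tuple0/= ?normr0 ?mul0r.
split=> [|t].
  rewrite /tmeas (_ : (fun _ => _) = (fun t : n.+1.-tuple rT => incr t + lsum (behead t))).
    by apply: measurable_funD; [exact: mG|exact: tmeas_behead].
  by apply/funext => t; rewrite (cons_head t).
have -> : n.+1%:R * K = K + n%:R * K by rewrite -addn1 natrD; ring.
rewrite (cons_head t)/=; apply: le_trans (ler_normD _ _) _.
by apply: lerD => //; exact: (IH2 [tuple of behead t]).
Qed.

(** Removing the head letter splits off one increment; [expect_behead] rewrites what is left as an
    expectation over a shorter block. *)
Lemma expect_lsum n : expect n lsum = \sum_(k < n) expect k.+1 incr.
Proof.
elim: n => [|n IH].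
  rewrite big_ord0 /expect; transitivity (\int[lebesgue_tuple R 0]_t (0 : R)).
    by apply: eq_Rintegral => t _; rewrite tuple0/= mulr0.
  by rewrite /Rintegral integral0.
have [m1 b1] := eint_lsum n.
have i1 := eint_bounded m1 b1.
have [i2 e2] := expect_behead m1 i1.
have i3 : eint n.+1 incr.
  apply: (@eint_bounded _ _ K); first exact: mG.
  by move=> t; rewrite (cons_head t)/=.
have [_ E] := expectD i3 i2.
rewrite big_ord_recr/= -IH -e2 addrC -E; apply: eq_Rintegral => t _.
by rewrite (cons_head t).
Qed.

Lemma expect_lqsum n : [/\ tmeas n lqsum, eint n lqsum &
  expect n lqsum = n%:R * \int[leb]_z ((\sum_i v i * q i z) * lq z)].
Proof.
elim: n => [|n [IH1 IH2 IH3]].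
  have m0 : tmeas 0 lqsum.
    rewrite /tmeas (_ : (fun _ => _) = cst 0)//; apply/funext => t.
    by rewrite tuple0 /lqsum big_nil.
  split=> //.
    apply: (@eint_bounded _ _ 0) => // t; by rewrite tuple0 /lqsum big_nil normr0.
  rewrite /expect mul0r; transitivity (\int[lebesgue_tuple R 0]_t (0 : R)).
    by apply: eq_Rintegral => t _; rewrite tuple0/= /lqsum big_nil mulr0.
  by rewrite /Rintegral integral0.
have E : (fun t : n.+1.-tuple rT => lqsum t) =
    (fun t : n.+1.-tuple rT => lq (head 0 t) + lqsum (behead t)).
  by apply/funext => t; rewrite {1}(cons_head t) /lqsum big_cons.
have [i1 e1] := expect_behead IH1 IH2.
have [i2 e2] := expect_head n mlq ilq.
have [i3 e3] := expectD i2 i1.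
have E2 : (fun t : n.+1.-tuple rT => p t * lqsum t) =
    (fun t : n.+1.-tuple rT => p t * (lq (head 0 t) + lqsum (behead t))).
  by apply/funext => t; rewrite {2}(cons_head t) /lqsum big_cons.
split.
- by rewrite /tmeas E; apply: measurable_funD; [exact: tmeas_head|exact: tmeas_behead].
- by rewrite /eint E2.
- by rewrite /expect E2 [LHS]e3 e2 e1 IH3 -[in RHS]addn1 natrD; ring.
Qed.

(** The first term is exactly linear in [n], and [r] is bounded independently of [n], so it
    disappears after division by the length. *)
Lemma entropy_decomposition n : exists2 r : R, `|r| <= K' &
  (\int[lebesgue_tuple R n]_t (p (tval t) * ln (p (tval t)))%:E)%E =
  (n%:R * (\int[leb]_z ((\sum_i v i * q i z) * lq z)) + \sum_(k < n) expect k.+1 incr + r)%:E.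
Proof.
have [m1 i1 e1] := expect_lqsum n; have [m2 b2] := eint_lsum n.
have i2 := eint_bounded m2 b2; have i3 := eint_bounded (@mrem n) (fun t : n.-tuple rT => remK t).
exists (expect n rem); first by apply: expect_bounded; [exact: mrem|move=> t; exact: remK].
have [i4 e4] := expectD i1 i2; have [i5 e5] := expectD i4 i3.
under eq_integral => t _ do rewrite lnp.
have := integrable_fin_num measurableT i5 => /fineK <-.
by congr EFin; rewrite [LHS]e5 e4 e1 expect_lsum.
Qed.

End entropy_decomposition.

(** * The entropy rate of a family of hidden Markov chains *)

Section hidden_markov_density.
Variables (R : realType) (l : nat) (g : 'I_l -> R -> R) (P : 'M[R]_l).
Local Notation rT := (measurableTypeR R).

Lemma big_tuple_cons n (F : n.+1.-tuple 'I_l -> R) :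
  \sum_y F y = \sum_i \sum_(y : n.-tuple 'I_l) F [tuple of i :: y].
Proof.
rewrite pair_big/= (reindex (fun p : 'I_l * n.-tuple 'I_l => [tuple of p.1 :: p.2]))//=.
exists (fun y => (thead y, [tuple of behead y])) => [[i y] _|y _] /=.
  by congr pair; apply/val_inj.
by rewrite -tuple_eta.
Qed.

Let chain n (y : n.+1.-tuple 'I_l) : R :=
  \prod_(i < n) P (tnth y (widen_ord (leqnSn n) i)) (tnth y (lift ord0 i)).

Hypothesis P1 : forall i, \sum_j P i j = 1.

(** The initial weight is arbitrary for the sake of the induction: for each first state, its weight,
    emission factor and transition row form the initial weight of the remaining chain. *)
Lemma sum_chain_channel n (a : 'I_l -> R) (z : n.+1.-tuple rT) :
  \sum_y a (tnth y ord0) * chain y * channel_pdf g y z =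
  \sum_i a i * W g (fun i j => P i j) z i.
Proof.
elim: n a z => [|n IH] a z; case/tupleP: z => z0 z; rewrite big_tuple_cons.
  apply: eq_bigr => i _; rewrite (big_pred1 [tuple]); last first.
    by move=> y; apply/esym/eqP; exact: tuple0.
  rewrite /chain /channel_pdf big_ord0 mulr1 big_ord_recl big_ord0 mulr1 /=.
  rewrite !(tnth_nth 0)/= (tnth_nth i)/= tuple0/=.
  (* [W] carries one transition after the last letter; it sums to 1. *)
  by under eq_bigr => j _ do rewrite mulr1; rewrite P1 mulr1.
pose b i j := a i * g i z0 * P i j.
transitivity (\sum_i \sum_(y : n.+1.-tuple 'I_l) b i (tnth y ord0) * chain y * channel_pdf g y z).
  apply: eq_bigr => i _; apply: eq_bigr => y _.
  rewrite /channel_pdf [in LHS]big_ord_recl {1}/chain big_ord_recl.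
  have E (j : 'I_n.+1) : tnth [tuple of i :: y] (lift ord0 j) = tnth y j.
    by rewrite !(tnth_nth i).
  have E' (j : 'I_n.+1) : tnth [tuple of z0 :: z] (lift ord0 j) = tnth z j.
    by rewrite !(tnth_nth 0).
  rewrite (eq_bigr (fun j => g (tnth y j) (tnth z j))); last by move=> j _; rewrite E E'.
  rewrite (eq_bigr (fun j : 'I_n => P (tnth y (widen_ord (leqnSn n) j)) (tnth y (lift ord0 j)))); last first.
    move=> j _; rewrite E; congr (P _ _).
    by rewrite !(tnth_nth i)/=.
  rewrite E (_ : tnth _ ord0 = i)// (_ : tnth _ ord0 = z0)//.
  rewrite (_ : tnth _ (widen_ord _ _) = i); last by rewrite (tnth_nth i).
  by rewrite /b /chain; ring.
under eq_bigr => i _ do rewrite IH.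
apply: eq_bigr => i _ /=; rewrite mulr_sumr mulr_sumr.
by apply: eq_bigr => j _; rewrite /b; ring.
Qed.

Lemma hmc_pdfE (v : 'rV[R]_l) n (z : n.+1.-tuple rT) :
  hmc_pdf v P g z = pdens g (fun i j => P i j) (fun i => v ord0 i) z.
Proof. exact: (sum_chain_channel (fun i => v ord0 i)). Qed.

End hidden_markov_density.

Lemma measurable_inv_gt0 (R : realType) d (T : measurableType d) (f : T -> R) :
  (forall t, 0 < f t) -> measurable_fun [set: T] f -> measurable_fun [set: T] (fun t => (f t)^-1).
Proof.
move=> f0 mf.
have -> : (fun t => (f t)^-1) = (fun t => expR (- ln (f t))).
  by apply/funext => t; rewrite expRN lnK// posrE.
by apply: (measurableT_comp (@measurable_expR R)); apply: measurableT_comp => //;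
  exact: (measurableT_comp (@measurable_ln R)).
Qed.

(** * Analyticity of the entropy rate from norm bounds on the model *)

Section entropy_family.
Variables (R : realType) (m : nat) (x0 : 'rV[R]_m) (rho : R).
Hypothesis rho0 : 0 < rho.
Local Notation pdisc := (pdisc x0 rho).
Local Notation An := (An x0 rho).
Local Notation rT := (measurableTypeR R).
Local Notation leb := (@lebesgue_measure R).
Variables (l : nat) (I0 : 'I_l).
Variables (P : 'rV[R]_m -> 'M[R]_l) (v : 'rV[R]_m -> 'rV[R]_l) (q : 'rV[R]_m -> 'I_l -> R -> R).
Hypothesis Ppos : forall x i j, pdisc x -> 0 < P x i j.
Hypothesis Psto : forall x, pdisc x -> stochastic_mx (P x).
Hypothesis vsta : forall x, pdisc x -> stationary_vector (P x) (v x).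
Hypothesis qpos : forall x i z, pdisc x -> 0 < q x i z.
Hypothesis qdens : forall x i, pdisc x -> probability_density (q x i).

Definition trans z i j x : R := q x i z / q x I0 z * P x i j.
Local Notation M := trans.
Variables (m1 m2 eta : R).
Hypothesis m10 : 0 < m1.
Hypothesis m12 : m1 <= m2.
Hypothesis M0 : forall z i j, m1 <= M z i j x0 <= m2.
Hypothesis eta0 : 0 < eta.
Hypothesis etak : 20 * eta <= (doeblin l m1 m2) ^+ 2.
Hypothesis eta_drift : 82 * l%:R * m2 * eta <= m1 * (doeblin l m1 m2) ^+ 2.
Hypothesis Me : forall z i j, An (fun x => M z i j x / M z i j x0 - 1) (eta ^+ 2).

Let Mpos z i j x : pdisc x -> 0 < M z i j x.
Proof. by move=> xr; rewrite mulr_gt0 ?divr_gt0 ?qpos ?Ppos. Qed.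

Local Notation Px x := (fun i j => P x i j).
Local Notation vx x := (fun i => v x ord0 i).
Local Notation p x := (pdens (q x) (Px x) (vx x)).
Local Notation K := (logbound l m1 m2).
Definition cond_log x : seq R -> R := incr (fun z s => logincr I0 M z s x).

Section pointwise.
Variable x : 'rV[R]_m.
Hypothesis xr : pdisc x.

Let mq i : measurable_fun [set: rT] (q x i). Proof. by have [] := qdens i xr. Qed.
Let q0 i z : 0 <= q x i z. Proof. exact/ltW/qpos. Qed.
Let q1 i : (\int[leb]_z (q x i z)%:E = 1)%E. Proof. by have [] := qdens i xr. Qed.
Let P0 i j : 0 <= P x i j. Proof. exact/ltW/Ppos. Qed.
Let P1 i : \sum_j P x i j = 1. Proof. by have [_] := Psto xr. Qed.
Let v0 i : 0 <= v x ord0 i. Proof. by have [] := vsta xr. Qed.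
Let v1 : \sum_i v x ord0 i = 1. Proof. by have [] := vsta xr. Qed.
Let vP j : \sum_i v x ord0 i * P x i j = v x ord0 j.
Proof. by have [_ _ {2}<-] := vsta xr; rewrite mxE. Qed.

Lemma W_U s i : W (q x) (Px x) s i = (\prod_(z <- s) q x I0 z) * U M s i x.
Proof.
elim: s i => [|z s IH] i /=; first by rewrite big_nil mul1r.
rewrite big_cons mulr_sumr mulr_sumr; apply: eq_bigr => j _; rewrite IH /M.
by have := qpos I0 z xr; move=> h; field; rewrite gt_eqF.
Qed.

Lemma tmeas_U n i : tmeas n (fun s => U M s i x).
Proof.
have E s : forall i, U M s i x = W (fun i z => q x i z / q x I0 z) (Px x) s i.
  elim: s => [//|z s IH] k /=; rewrite mulr_sumr; apply: eq_bigr => j _.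
  by rewrite IH /M mulrA.
rewrite (_ : (fun s => _) = (W (fun i z => q x i z / q x I0 z) (Px x))^~ i); last first.
  by apply/funext => s; rewrite E.
have mr j : measurable_fun [set: rT] (fun z => q x j z / q x I0 z).
  by apply: measurable_funM => //; apply: measurable_inv_gt0 => // z; exact: qpos.
exact: (@tmeas_W R l (fun i z => q x i z / q x I0 z) (Px x) mr n i).
Qed.

Lemma tmeas_cond_log n : tmeas n (cond_log x).
Proof.
case: n => [|n].
  rewrite /tmeas (_ : (fun _ => _) = cst 0)//.
  by apply/funext => t; rewrite tuple0.
rewrite /tmeas (_ : (fun _ => _) =
    (fun t : n.+1.-tuple rT => ln (U M t I0 x * (U M (behead t) I0 x)^-1))).
  apply: (measurableT_comp (@measurable_ln R)); apply: measurable_funM; first exact: tmeas_U.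
  apply: (measurable_inv_gt0 (f := fun t : n.+1.-tuple rT => U M (behead t) I0 x)).
    by move=> t; exact: (U_gt0 I0 Mpos).
  exact: (@tmeas_behead R n (fun s => U M s I0 x) (@tmeas_U n I0)).
by apply/funext => t; case/tupleP: t => z t.
Qed.

Lemma cond_log_bound s : `|cond_log x s| <= K.
Proof.
have h z s' : `|logincr I0 M z s' x| <= K.
  exact: An_bound (ltW rho0) (An_logincr rho0 I0 m10 m12 M0 Mpos eta0 etak Me z s') xr.
by case: s => [|z s]; rewrite /cond_log/= ?normr0// (le_trans _ (h 0 [::])).
Qed.

(** The correction for starting from the stationary vector instead of the state [I0]; it is bounded
    since the entries of [U] are comparable. *)
Definition log_rem s : R := ln (\sum_i v x ord0 i * (U M s i x / U M s I0 x)).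

Let avg_bounds s :
  m1 / m2 / 2 <= \sum_i v x ord0 i * (U M s i x / U M s I0 x) <= 2 * (m2 / m1).
Proof.
have h i := U_ratio_bounds rho0 I0 m10 m12 M0 Mpos eta0 etak Me s i xr.
have E c : c = \sum_i v x ord0 i * c by rewrite -mulr_suml v1 mul1r.
rewrite {1}[X in X <= _]E [X in _ && (_ <= X)]E; apply/andP; split.
  by apply: ler_sum => i _; apply: ler_wpM2l => //; have /andP[] := h i.
by apply: ler_sum => i _; apply: ler_wpM2l => //; have /andP[] := h i.
Qed.

Lemma log_rem_bound s : `|log_rem s| <= `|ln (m1 / m2 / 2)| + `|ln (2 * (m2 / m1))|.
Proof.
have m20 : 0 < m2 by exact: lt_le_trans m12.
have c0 : 0 < m1 / m2 / 2 by rewrite !divr_gt0.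
have /andP[h1 h2] := avg_bounds s.
have s0 := lt_le_trans c0 h1.
have {}h1 : ln (m1 / m2 / 2) <= log_rem s by rewrite ler_ln ?posrE.
have {}h2 : log_rem s <= ln (2 * (m2 / m1)) by rewrite ler_ln ?posrE// (lt_le_trans s0).
rewrite ler_norml; apply/andP; split.
  by rewrite (le_trans _ h1)// lerNl (le_trans (ler_norm _))// normrN lerDl.
by rewrite (le_trans h2)// (le_trans (ler_norm _))// lerDr.
Qed.

Lemma tmeas_log_rem n : tmeas n log_rem.
Proof.
apply: (measurableT_comp (@measurable_ln R)); apply: measurable_sum => i.
apply: measurable_funM => //; apply: measurable_funM; first exact: tmeas_U.
apply: (measurable_inv_gt0 (f := fun t : n.-tuple rT => U M t I0 x)); last exact: tmeas_U.
by move=> t; exact: (U_gt0 I0 Mpos).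
Qed.

Lemma ln_pdens s : ln (p x s) =
  lqsum (fun z => ln (q x I0 z)) s + lsum (fun z s => logincr I0 M z s x) s + log_rem s.
Proof.
have U0 t i : 0 < U M t i x by exact: (U_gt0 I0 Mpos).
have m20 : 0 < m2 by exact: lt_le_trans m12.
have c0 : 0 < m1 / m2 / 2 by rewrite !divr_gt0.
have a0 := lt_le_trans c0 (proj1 (andP (avg_bounds s))).
have pr0 : 0 < \prod_(z <- s) q x I0 z by apply: prodr_gt0 => z _; exact: qpos.
have -> : p x s = (\prod_(z <- s) q x I0 z) *
    (U M s I0 x * \sum_i v x ord0 i * (U M s i x / U M s I0 x)).
  rewrite !mulr_sumr; apply: eq_bigr => i _; rewrite W_U.
  by have := U0 s I0 => h; field; rewrite gt_eqF.
rewrite lnM ?posrE ?mulr_gt0// lnM ?posrE// addrA; congr (_ + _ + _).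
  elim: s pr0 {a0} => [|z s IH]; first by rewrite /lqsum !big_nil ln1.
  rewrite /lqsum !big_cons => pr0; have qz := qpos I0 z xr.
  have s0 : 0 < \prod_(z <- s) q x I0 z by apply: prodr_gt0 => y _; exact: qpos.
  by rewrite lnM ?posrE// IH.
elim: s {a0 pr0} => [|z s IH]; first by rewrite /= ln1.
rewrite /= -IH /logincr -lnM ?posrE ?divr_gt0//; congr ln.
by rewrite mulfVK ?gt_eqF.
Qed.

Lemma entropy_at n : rintegrable leb (fun z => (\sum_i v x ord0 i * q x i z) * ln (q x I0 z)) ->
  exists2 r : R, `|r| <= `|ln (m1 / m2 / 2)| + `|ln (2 * (m2 / m1))| &
  (\int[lebesgue_tuple R n]_t (p x (tval t) * ln (p x (tval t)))%:E)%E =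
  (n%:R * (\int[leb]_z ((\sum_i v x ord0 i * q x i z) * ln (q x I0 z))) +
   \sum_(k < n) expect (q x) (Px x) (vx x) k.+1 (cond_log x) + r)%:E.
Proof.
move=> iq.
apply: (entropy_decomposition mq q0 P0 q1 P1 v0 vP v1 (G := fun z s => logincr I0 M z s x)
  (rem := log_rem) (lq := fun z => ln (q x I0 z)) (K := K)) => //.
- by move=> z s; exact: (cond_log_bound (z :: s)).
- by move=> k; exact: tmeas_cond_log.
- exact: log_rem_bound.
- exact: tmeas_log_rem.
- exact: (measurableT_comp (@measurable_ln R)).
- exact: ln_pdens.
Qed.

(** Consistency at the tail puts both expectations on words of one length, where [An_logdiff]
    compares the integrands. *)
Lemma expect_cond_log n :
  expect (q x) (Px x) (vx x) n.+2 (cond_log x) - expect (q x) (Px x) (vx x) n.+1 (cond_log x) =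
  expect (q x) (Px x) (vx x) n.+2 (fun s => cond_log x s - cond_log x (front s)).
Proof.
have i1 := eint_bounded mq q0 P0 q1 P1 v0 v1 (@tmeas_cond_log n.+1) (fun t => cond_log_bound t).
have i2 := eint_bounded mq q0 P0 q1 P1 v0 v1 (@tmeas_cond_log n.+2) (fun t => cond_log_bound t).
have [i3 <-] := expect_front mq q0 P0 q1 P1 v0 (fun k => @tmeas_cond_log k) i1.
rewrite /expect -RintegralB//.
by apply: eq_Rintegral => t _; rewrite mulrBr.
Qed.

End pointwise.

Variables (N : 'I_l -> 'I_l -> R) (V : R) (b : 'I_l -> R -> R) (c : 'I_l -> R) (kappa : R).
Hypothesis PN : forall i j, An (fun x => P x i j) (N i j).
Hypothesis vV : forall i, An (fun x => v x ord0 i) V.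
Hypothesis qb : forall i z, An (fun x => q x i z) (b i z).
Hypothesis mb : forall i, measurable_fun [set: rT] (b i).
Hypothesis bc : forall i, (\int[leb]_z (b i z)%:E <= (c i)%:E)%E.
Hypothesis ck : forall i, c i * \sum_j N i j <= kappa.

Let r0 : 0 <= rho. Proof. exact: ltW. Qed.
Let N0 i j : 0 <= N i j. Proof. exact: An_ge0 r0 (PN i j). Qed.
Let b0 i z : 0 <= b i z. Proof. exact: An_ge0 r0 (qb i z). Qed.
Let V0 : 0 <= V. Proof. exact: An_ge0 r0 (vV I0). Qed.
Let c0 i : 0 <= c i.
Proof. by rewrite -lee_fin (le_trans _ (bc i))// integral_ge0// => z _; rewrite lee_fin. Qed.
Let kappa0 : 0 <= kappa.
Proof. by rewrite (le_trans _ (ck I0))// mulr_ge0// sumr_ge0. Qed.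

(** The norm is submultiplicative, so the recursion for densities of words holds for their norm
    majorants and can be integrated by [tint_W_le]. *)
Lemma An_W s i : An (fun x => W (q x) (Px x) s i) (W b N s i).
Proof.
elim: s i => [|z s IH] i /=; first by have := @An_cst R m x0 rho 1 r0; rewrite normr1.
apply: AnM => //; apply: An_sum => // j _; exact: AnM.
Qed.

Let rint_Wb n i : rintegrable (lebesgue_tuple R n) (fun t : n.-tuple rT => W b N t i) /\
  \int[lebesgue_tuple R n]_t W b N (tval t) i <= kappa ^+ n.
Proof.
have h := tint_W_le mb b0 N0 n i kappa0 bc c0 ck.
have h1 : rintegrable (lebesgue_tuple R n) (fun t : n.-tuple rT => W b N t i).
  apply: rintegrable_ge0; [exact: (@tmeas_W R l b N mb n i)|by move=> t; exact: W_ge0|].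
  exact: le_lt_trans h (ltry _).
split=> //; rewrite -lee_fin /Rintegral fineK//.
exact: integrable_fin_num h1.
Qed.

Lemma An_expect n (f : 'rV[R]_m -> seq R -> R) B :
  (forall t : n.-tuple rT, An (f^~ t) B) -> (forall x, pdisc x -> tmeas n (f x)) ->
  An (fun x => expect (q x) (Px x) (vx x) n (f x)) (l%:R * V * kappa ^+ n * B).
Proof.
move=> fB mf; have B0 : 0 <= B by exact: An_ge0 r0 (fB [tuple of nseq n 0]).
have iW i : rintegrable (lebesgue_tuple R n) (fun t : n.-tuple rT => B * V * W b N t i).
  by apply: rintegrableZl; case: (rint_Wb n i).
have H : An (fun x => expect (q x) (Px x) (vx x) n (f x))
    (\int[lebesgue_tuple R n]_t (\sum_i B * V * W b N (tval t) i)).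
  apply: (An_integral rho0) => [t|x xr|].
  - apply: (@An_le _ _ _ _ _ ((\sum_i V * W b N t i) * B)).
      by rewrite mulr_suml; apply: ler_sum => i _; rewrite mulrC mulrA.
    apply: AnM => //; apply: An_sum => // i _; apply: AnM => //; exact: An_W.
  - apply: tmeasM; last exact: mf.
    apply: tmeas_pdens => i; by have [] := qdens i xr.
  - exact: rintegrable_sum.
apply: An_le H; rewrite Rintegral_sum//.
apply: (@le_trans _ _ (\sum_(i < l) B * V * kappa ^+ n)).
  apply: ler_sum => i _; have [h1 h2] := rint_Wb n i.
  by rewrite RintegralZl// ler_wpM2l// mulr_ge0.
by rewrite sumr_const card_ord -mulr_natl le_eqVlt; apply/orP; left; apply/eqP; ring.
Qed.

Local Notation h k := (fun x => expect (q x) (Px x) (vx x) k.+1 (cond_log x)).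
Local Notation G := (gamma l m1 m2).
Hypothesis kG : kappa * G < 1.

Lemma An_expect_cond_log k : An (h k) (l%:R * V * kappa ^+ k.+1 * K).
Proof.
apply: An_expect => [t|x xr]; last exact: tmeas_cond_log.
by case/tupleP: t => z t; exact: (An_logincr rho0 I0 m10 m12 M0 Mpos eta0 etak Me z t).
Qed.

Let D : R := logdiff_const l m1 m2.

Lemma An_expect_cond_log_diff k :
  An (fun x => h k.+1 x - h k x) (l%:R * V * kappa ^+ k.+2 * (D * G ^+ k)).
Proof.
have : An (fun x => expect (q x) (Px x) (vx x) k.+2 (fun s => cond_log x s - cond_log x (front s)))
    (l%:R * V * kappa ^+ k.+2 * (D * G ^+ k)).
  apply: An_expect => [t|x xr].
    case/tupleP: t => z t.
    have [s [y [sy sk]]] : exists s y, tval t = rcons s y /\ size s = k.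
      have := size_tuple t; case/lastP: (tval t) => // s y; rewrite size_rcons => -[sk].
      by exists s, y.
    have E : tval [tuple of z :: t] = z :: rcons s y by rewrite /= sy.
    have Ef : front (z :: rcons s y) = z :: s.
      by rewrite front_cons ?front_rcons//; case: (s).
    have := An_logdiff rho0 I0 m10 m12 M0 Mpos eta0 etak eta_drift Me z s y; rewrite sk.
    apply: An_ext.
    by move=> x xr; rewrite E Ef.
  apply: measurable_funB; first exact: tmeas_cond_log.
  exact: (tmeas_front (@tmeas_cond_log x xr k.+1)).
apply: An_ext => x xr; exact/esym/expect_cond_log.
Qed.

(** Consecutive expectations differ in norm by a constant times [(kappa * G) ^+ k]: the integrated
    weights grow at rate [kappa], the integrand decays at rate [G]. Telescoping and [An_series] give
    the limit. *)
Lemma expect_cond_log_cvg : exists g B, An g B /\ forall x, pdisc x -> (fun k => h k x) @ \oo --> g x.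
Proof.
pose C := l%:R * V * kappa ^+ 2 * D.
have [/andP[G0 G1]] : 0 < G < 1 /\ True by split=> //; exact: (gamma_range I0 m10 m12).
pose u k := C * (kappa * G) ^+ k.
have uE k : l%:R * V * kappa ^+ k.+2 * (D * G ^+ k) = u k.
  by rewrite /u /C exprMn !exprS; ring.
have dh k : An (fun x => h k.+1 x - h k x) (u k) by rewrite -uE; exact: An_expect_cond_log_diff.
have C0 : 0 <= C by have := An_ge0 r0 (dh 0%N); rewrite /u expr0 mulr1.
have uS n : \sum_(k < n) u k <= C * (1 - kappa * G)^-1.
  rewrite -mulr_sumr ler_wpM2l// geom_partial_le// kG andbT.
  by rewrite mulr_ge0// ltW.
have tel x n : \sum_(k < n) (h k.+1 x - h k x) = h n x - h 0%N x.
  elim: n => [|n IH]; first by rewrite big_ord0 subrr.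
  by rewrite big_ord_recr/= IH; ring.
pose s x := limn (fun n => \sum_(k < n) (h k.+1 x - h k x)).
have sP x : pdisc x -> (fun n => \sum_(k < n) (h k.+1 x - h k x)) @ \oo --> s x.
  move=> xr; have ub n : `|h n.+1 x - h n x| <= u n by exact: An_bound r0 (dh n) xr.
  exact: (abs_series_cvg ub uS).
have sA := An_series rho0 dh uS sP.
exists (fun x => h 0%N x + s x), (l%:R * V * kappa ^+ 1 * K + C * (1 - kappa * G)^-1); split.
  by apply: AnD => //; exact: An_expect_cond_log.
move=> x xr; rewrite (_ : (fun k => _) = (fun k => h 0%N x + \sum_(j < k) (h j.+1 x - h j x))).
  by apply: cvgD; [exact: cvg_cst|exact: sP].
by apply/funext => k; rewrite tel addrC subrK.
Qed.

Variable bL : 'I_l -> R -> R.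
Hypothesis qL : forall i z, An (fun x => q x i z * ln (q x I0 z)) (bL i z).
Hypothesis ibL : forall i, rintegrable leb (bL i).

(** The mean entropy is minus the sum of a fixed integral, a Cesaro mean of convergent expectations
    and a bounded remainder over [n.+1]. All three converge pointwise, and the limit is a sum of
    power series already constructed. *)
Theorem An_entropy : exists H B, An H B /\
  forall x, pdisc x -> mean_entropy (v x) (P x) (q x) @ \oo --> (H x)%:E.
Proof.
have [g [B [gB gl]]] := expect_cond_log_cvg.
pose e x := \sum_i v x ord0 i * \int[leb]_z (q x i z * ln (q x I0 z)).
have mqL x i : pdisc x -> measurable_fun [set: rT] (fun z => q x i z * ln (q x I0 z)).
  move=> xr; have [m1' _ _] := qdens i xr; have [m2' _ _] := qdens I0 xr.
  by apply: measurable_funM => //; exact: (measurableT_comp (@measurable_ln R)).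
have eB : An e (\sum_i V * \int[leb]_z bL i z).
  apply: An_sum => // i _; apply: AnM => //; apply: (An_integral rho0) => // x xr; exact: mqL.
exists (fun x => - (e x + g x)), (\sum_i V * \int[leb]_z bL i z + B); split.
  by apply: AnN; apply: AnD.
move=> x xr.
have iqL i : rintegrable leb (fun z => q x i z * ln (q x I0 z)).
  apply: rintegrable_le (ibL i); first exact: mqL.
  by move=> z; exact: An_bound r0 (qL i z) xr.
have E0 : (fun z => (\sum_i v x ord0 i * q x i z) * ln (q x I0 z)) =
    (fun z => \sum_i v x ord0 i * (q x i z * ln (q x I0 z))).
  by apply/funext => z; rewrite mulr_suml; apply: eq_bigr => i _; rewrite mulrA.
have iq : rintegrable leb (fun z => (\sum_i v x ord0 i * q x i z) * ln (q x I0 z)).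
  by rewrite E0; apply: rintegrable_sum => i _; exact: rintegrableZl.
have eE : \int[leb]_z ((\sum_i v x ord0 i * q x i z) * ln (q x I0 z)) = e x.
  rewrite [LHS](_ : _ = \int[leb]_z (\sum_i v x ord0 i * (q x i z * ln (q x I0 z)))); last first.
    by congr Rintegral.
  rewrite Rintegral_sum; last by move=> i _; exact: rintegrableZl.
  by apply: eq_bigr => i _; rewrite RintegralZl//; exact: iqL.
pose rbd := `|ln (m1 / m2 / 2)| + `|ln (2 * (m2 / m1))|.
have ent n : exists r : R, `|r| <= rbd /\ mean_entropy (v x) (P x) (q x) n =
    (- (e x + n.+1%:R^-1 * (\sum_(k < n.+1) h k x) + r * n.+1%:R^-1))%:E.
  have [r rb rE] := entropy_at xr n.+1 iq; exists r; split=> //.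
  rewrite /mean_entropy /block_entropy.
  have [_ P1] := Psto xr.
  under eq_integral => z _ do rewrite (hmc_pdfE (q x) P1).
  rewrite rE eE -EFinN -EFinM; congr EFin.
  have n0 : (n.+1%:R : R) != 0 by rewrite pnatr_eq0.
  by move: (\sum_(k < n.+1) _) => S; field.
have [r rP] := choice ent.
have -> : mean_entropy (v x) (P x) (q x) =
    (fun n => (- (e x + n.+1%:R^-1 * (\sum_(k < n.+1) h k x) + r n * n.+1%:R^-1))%:E).
  by apply/funext => n; case: (rP n).
apply: cvg_EFin; first by near=> n.
rewrite -[- _]/(- (e x + g x)).
rewrite (_ : _ \o _ = (fun n => - (e x + n.+1%:R^-1 * (\sum_(k < n.+1) h k x) + r n * n.+1%:R^-1)))//.
rewrite -[e x + g x]addr0; apply: cvgN; apply: cvgD.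
  apply: cvgD; first exact: cvg_cst.
  have E1 : arithmetic_mean (fun k => h k x) = (fun n => n.+1%:R^-1 * (\sum_(k < n.+1) h k x)).
    by apply/funext => n; rewrite /arithmetic_mean /series /= big_mkord.
  by have := cesaro (gl x xr); rewrite E1.
apply: (cvg_dominated (v := fun n => rbd * n.+1%:R^-1)).
  by rewrite -[X in _ --> X](mulr0 rbd); apply: cvgMr; exact: cvg_harmonic.
by move=> n; rewrite subr0 normrM [X in _ * X]ger0_norm// ler_wpM2r//; case: (rP n).
Unshelve. all: by end_near.
Qed.

End entropy_family.

(** * From the complex extensions to real power series *)

Section near_zero.
Variable R : realType.

Lemma near_right0 (e : R) (Q : R -> Prop) : 0 < e ->
  (forall rho, 0 < rho <= e -> Q rho) -> \forall rho \near 0^'+, Q rho.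
Proof.
move=> e0 H; near=> rho; apply: H; apply/andP; split.
  by near: rho; exact: nbhs_right_gt.
by near: rho; exact: nbhs_right_le.
Unshelve. all: by end_near. Qed.

Lemma near_right0_fin (I : finType) (Q : I -> R -> Prop) :
  (forall i, \forall rho \near 0^'+, Q i rho) -> \forall rho \near 0^'+, forall i, Q i rho.
Proof. exact: filter_forall. Qed.

Lemma near_open m (D : set 'rV[R]_m) x0 : open D -> D x0 ->
  \forall rho \near 0^'+, forall x, pdisc x0 rho x -> D x.
Proof.
move=> oD Dx; have /nbhs_ballP[/= e e0 eD] := open_nbhs_nbhs (conj oD Dx).
apply: (@near_right0 (e / 2)) => [|rho /andP[r0 re] x xr]; first by rewrite divr_gt0.
apply: eD; split=> // i j; rewrite !ord1 /ball/= distrC.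
by apply: le_lt_trans (xr j) _; apply: le_lt_trans re _; rewrite ltr_pdivrMr// ltr_pMr// ltr1n.
Qed.

Lemma near_An_small m (f : 'rV[R]_m -> R) x0 d : 0 < d -> analytic_at f x0 -> 0 < f x0 ->
  \forall rho \near 0^'+, An x0 rho (fun x => f x / f x0 - 1) d.
Proof.
move=> d0 /analytic_at_PS[r [B [c [r0 cf]]]] f0.
have fA : An x0 r f B by exists c.
have B0 : 0 <= B by exact: An_ge0 (ltW r0) fA.
have B1 : 0 < B + 1 by rewrite ltr_wpDl.
pose e := Num.min r (d * f x0 * r / (B + 1)).
apply: (@near_right0 e) => [|rho /andP[rho0]].
  by rewrite lt_min r0/= divr_gt0// !mulr_gt0.
rewrite le_min => /andP[rr re]; have rho0' := ltW rho0.
have rr' : 0 <= rho <= r by rewrite rho0'.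
have := AnZ (f x0)^-1 (An_small r0 rr' fA) => H.
apply: (@An_le _ _ _ _ _ (`|(f x0)^-1| * (rho / r * B))).
  rewrite ger0_norm ?invr_ge0 ?(ltW f0)// mulrC ler_pdivrMr//.
  rewrite mulrAC ler_pdivrMr//; rewrite ler_pdivlMr// in re; apply: le_trans re.
  by rewrite ler_wpM2l// lerDl.
by apply: An_ext H => x _; field; rewrite gt_eqF.
Qed.

End near_zero.

(** * Norm bounds, integrable or uniform in the letter, from the complex hypotheses *)

Section complex_families.
Variables (R : realType) (m : nat).
Local Notation C := (R[i])%C.
Local Notation leb := (@lebesgue_measure R).
Local Notation rT := (measurableTypeR R).
Implicit Types r rho : R.

Lemma Cball_cdisc (x0 : 'rV[R]_m) r w : 0 < r -> Cball x0 r w <-> cdisc (cplx x0) r w.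
Proof.
move=> r0; split=> [[_ h] i|h].
  by have := h ord0 i; rewrite /ball/= -normrN opprB ltr_nC.
split=> [|i j]; first by rewrite ltcR.
by rewrite !ord1 /ball/= -normrN opprB ltr_nC; exact: h.
Qed.

Lemma pdisc_cdisc (x0 : 'rV[R]_m) r rho x : rho < r -> pdisc x0 rho x -> cdisc (cplx x0) r (cplx x).
Proof.
move=> rr xr i; rewrite !mxE -rmorphB nC_real; exact: le_lt_trans (xr i) rr.
Qed.

Lemma An_of_cana (F : 'rV[C]_m -> C) (x0 : 'rV[R]_m) r rho B f : 0 < rho <= r / 32 ->
  (forall w, cdisc (cplx x0) r w -> cana F w) ->
  (forall w, cdisc (cplx x0) r w -> nC (F w) <= B) ->
  (forall x, pdisc x0 rho x -> F (cplx x) = (f x)%:C%C) ->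
  An x0 rho f (B * 2 ^+ m).
Proof.
move=> rr FA FB Ff; have /andP[rho0 rhor] := rr.
have r0 : 0 < r by lra.
have [c [H1 H2]] := real_coefficients r0 FA; have [B' [_ cf]] := H2 _ _ rr Ff.
exists c; split=> // N; apply: (pnorm_geom _ r0); first by rewrite ltW//=; lra.
by apply: H1 => //; rewrite r0 lexx.
Qed.

(* [S] need not be measurable: its integral bounds that of every measurable
   minorant. *)
Lemma integral_lower_bound (N : R -> R) (S : R -> \bar R) (k : R) : 0 <= k ->
  measurable_fun [set: rT] N -> (forall z, 0 <= N z) ->
  (forall z, (0 <= S z)%E) -> (forall z, ((N z)%:E <= k%:E * S z)%E) ->
  (\int[leb]_(z in [set: rT]) S z < +oo)%E -> rintegrable leb N.
Proof.
move=> k0 mN N0 S0 NS iS; pose k1 := k + 1; have k10 : 0 < k1 by rewrite ltr_wpDl.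
have le1 : (\int[leb]_(z in [set: rT]) (k1^-1 * N z)%:E <= \int[leb]_(z in [set: rT]) S z)%E.
  have NS1 z : ((k1^-1 * N z)%:E <= S z)%E.
    have : ((N z)%:E <= k1%:E * S z)%E.
      by apply: le_trans (NS z) _; apply: lee_wpmul2r => //; rewrite lee_fin /k1 lerDl.
    case: (S z) => [s| |]; rewrite ?leey//.
      by rewrite -EFinM !lee_fin ler_pdivrMl.
    by rewrite mulrNy gtr0_sg// mul1e leeNy_eq.
  rewrite !ge0_integralTE//; last by move=> z; rewrite lee_fin mulr_ge0// invr_ge0 ltW.
  apply: le_ereal_sup => _ [h hN <-]; exists h => // z.
  by apply: le_trans (hN z) _; exact: NS1.
have h1 : rintegrable leb (fun z => k1^-1 * N z).
  apply: rintegrable_ge0 => [|z|]; first exact: measurable_funM.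
    by rewrite mulr_ge0// invr_ge0 ltW.
  exact: le_lt_trans le1 iS.
have := rintegrableZl k1 h1; congr (rintegrable _ _); apply/funext => z.
by rewrite mulrA divff ?mul1r// gt_eqF.
Qed.

Lemma integrable_family (F : R -> 'rV[C]_m -> C) (f : R -> 'rV[R]_m -> R) (S : R -> \bar R) (x0 : 'rV[R]_m) r rho :
  0 < rho <= r / 32 ->
  (forall z w, cdisc (cplx x0) r w -> cana (F z) w) ->
  (forall z w, cdisc (cplx x0) r w -> ((nC (F z w))%:E <= S z)%E) ->
  (forall z x, pdisc x0 rho x -> F z (cplx x) = (f z x)%:C%C) ->
  (forall x, pdisc x0 rho x -> measurable_fun [set: rT] (f ^~ x)) ->
  (\int[leb]_(z in [set: rT]) S z < +oo)%E ->
  exists N : R -> R, [/\ measurable_fun [set: rT] N, forall z, An x0 rho (f z) (N z) &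
    rintegrable leb N].
Proof.
move=> rr FA FS Ff mf iS; have /andP[rho0 rhor] := rr; have rho0' := ltW rho0.
have r0 : 0 < r by lra.
have S0 z : (0 <= S z)%E.
  apply: le_trans (FS z (cplx x0) _); first by rewrite lee_fin nC_ge0.
  by move=> i; rewrite subrr nC0.
have [c cP] := choice (fun z => real_coefficients r0 (FA z)).
have [B cB] := choice (fun z => (cP z).2 rho (f z) rr (Ff z)).
have mc := coef_measurable (T := rT) rho0 cB mf.
have mp n : measurable_fun [set: rT] (fun z => pnorm rho (c z) n).
  apply: measurable_sum => a; apply: measurable_funM => //.
  exact: (measurableT_comp (@normr_measurable R setT)).
have lim z := nd_cvg (fun n k (nk : (n <= k)%N) => pnorm_nd (c z) rho0' nk) (cB z).1.
(* The exact l^1 norm, as a limit of measurable partial norms; a bound picked for each [z] need not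
   be measurable in [z]. *)
have [N NP] := choice lim.
have N0 z : 0 <= N z by have [_ h _] := NP z; exact: le_trans (pnorm_ge0 _ _ rho0') (h 0%N).
have mN : measurable_fun [set: rT] N.
  apply: (@measurable_fun_cvg _ _ _ _ (fun n z => pnorm rho (c z) n)) => //.
  by move=> z _; case: (NP z).
exists N; split=> //.
  by move=> z; exists (c z); have [_ h _] := NP z; have [_ h2] := cB z; split.
apply: (@integral_lower_bound _ S (2 ^+ m)) => // z.
have [hN _ _] := NP z.
case E : (S z) => [s| |].
- rewrite -EFinM lee_fin mulrC; apply: le_trans (ler_norm _) _.
  apply: (cvg_norm_le (n0 := 0%N) hN) => n _; rewrite ger0_norm ?pnorm_ge0//.
  apply: (pnorm_geom _ r0); first by rewrite rho0'/=; lra.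
  apply: (cP z).1 => [|w wr]; first by rewrite r0 lexx.
  by have := FS z w wr; rewrite E lee_fin.
- by rewrite mulry gtr0_sg ?exprn_gt0// mul1e leey.
- by have := S0 z; rewrite E.
Qed.

End complex_families.

Section channel_hypotheses.
Variables (R : realType) (l m : nat) (D : set 'rV[R]_m) (q : 'rV[R]_m -> 'I_l -> R -> R).
Variable a : 'rV[R]_m.
Hypothesis oD : open D.
Hypothesis Da : D a.
Hypothesis qD : forall t, D t -> forall y, probability_density (q t y).
Hypothesis qa0 : forall y z, 0 < q a y z.
Local Notation C := (R[i])%C.
Local Notation leb := (@lebesgue_measure R).
Local Notation rT := (measurableTypeR R).
Local Notation extends Q r := (forall y z, analytic_extension D (fun t => q t y z) a r (fun t => Q t y z)).

Lemma extends_cana (r : R) (Q : 'rV[Cplx R]_m -> 'I_l -> R -> Cplx R) : 0 < r -> extends Q r ->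
  forall y z w, cdisc (cplx a) r w -> cana (fun t => Q t y z) w.
Proof. by move=> r0 QE y z w wr; apply: analytic_cana; apply: (QE y z).1; exact/Cball_cdisc. Qed.

Lemma extends_real (r rho : R) (Q : 'rV[Cplx R]_m -> 'I_l -> R -> Cplx R) x :
  rho < r -> 0 < r -> (forall x, pdisc a rho x -> D x) -> extends Q r -> pdisc a rho x ->
  forall y z, Q (cplx x) y z = (q x y z)%:C%C.
Proof.
move=> rr r0 rD QE xr y z; apply: (QE y z).2; first exact: rD.
by apply/(Cball_cdisc a (cplx x) r0); exact: pdisc_cdisc rr xr.
Qed.

(** Equicontinuity at the centre supplies one radius for all [z]. Neighbourhoods in the subspace are
    traces on [Cball a r], hence the two discs. *)
Lemma equicontinuous_near (r e : R) (F : R -> 'rV[Cplx R]_m -> Cplx R) : 0 < r -> 0 < e ->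
  equicontinuous [set: R] (fun z : R => F z : subspace (Cball a r) -> Cplx R) ->
  \forall s \near 0^'+, forall w, cdisc (cplx a) s w -> cdisc (cplx a) r w ->
    forall z, nC (F z w - F z (cplx a)) < e.
Proof.
move=> r0 e0 eF.
have ar : Cball a r (cplx a).
  by apply/(Cball_cdisc a (cplx a) r0) => i; rewrite subrr nC0.
have e0' : (0 : Cplx R) < e%:C%C by rewrite ltcR.
have : within (Cball a r) (nbhs (cplx a : 'rV[Cplx R]_m)) (fun w : 'rV[Cplx R]_m => forall z, [set: R] z ->
    ball (F z (cplx a)) e%:C%C (F z w)).
  by rewrite (nbhs_subspace_in ar); exact: (eF (cplx a) _ (entourage_ball (Cplx R) (PosNum e0'))).
move=> /nbhs_ballP[/= s s0 H].
have sE : s = (complex.Re s)%:C%C by rewrite RRe_real ?gtr0_real.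
have s0' : 0 < complex.Re s by rewrite sE ltcR in s0.
apply: (near_right0 s0') => s' /andP[s'0 s's] w ws wr z.
have wr' : Cball a r w by exact/Cball_cdisc.
have ws' : ball (cplx a : 'rV[Cplx R]_m) s w.
  by rewrite sE; apply/(Cball_cdisc a w s0') => i; exact: lt_le_trans (ws i) s's.
by have := H w ws' wr' z Logic.I; rewrite /ball/= -normrN opprB ltr_nC.
Qed.

(** On a small complex polydisc the ratio is uniformly within [e] of its central value; Cauchy's
    estimates turn this into an l^1 bound uniform in [z], and the lower bound [C'] makes it
    relative. *)
Lemma near_ratio (r C' d : R) I (Q : 'rV[Cplx R]_m -> 'I_l -> R -> Cplx R) :
  0 < r -> 0 < C' -> 0 < d -> extends Q r ->
  (forall j, equicontinuous [set: R]
    (fun z : R => (fun t => Q t j z / Q t I z) : subspace (Cball a r) -> Cplx R)) ->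
  (forall j z, C' <= q a j z / q a I z) ->
  \forall rho \near 0^'+, forall j z,
    An a rho (fun t => q t j z / q t I z / (q a j z / q a I z) - 1) d.
Proof.
move=> r0 C'0 d0 QE Qeq qC.
(* [2 ^+ m] is the price of passing to the l^1 norm; the cap one half keeps [e] below 1. *)
pose e := Num.min (C' * d / 2 ^+ m) 2^-1.
have e0 : 0 < e by rewrite lt_min invr_gt0 ltr0n divr_gt0 ?mulr_gt0// exprn_gt0.
have e1 : e < 1 by rewrite gt_min; apply/orP; right; rewrite invf_lt1// ltr1n.
have Qa j z : Q (cplx a) j z = (q a j z)%:C%C.
  apply: (QE j z).2 => //.
  by apply/(Cball_cdisc a (cplx a) r0) => i; rewrite subrr nC0.
have near1 := near_right0_fin (fun j => equicontinuous_near r0 e0 (Qeq j)).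
have [s [s0 sr H]] : exists s, [/\ 0 < s, s < r & forall j w, cdisc (cplx a) s w ->
    forall z, nC (Q w j z / Q w I z - Q (cplx a) j z / Q (cplx a) I z) < e].
  near (0 : R)^'+ => s; exists s; split.
  - by near: s; exact: nbhs_right_gt.
  - by near: s; exact: nbhs_right_lt.
  - have sr : s < r by near: s; exact: nbhs_right_lt.
    move=> j w ws z; move: j w ws z.
    have h : forall j w, cdisc (cplx a) s w -> cdisc (cplx a) r w ->
      forall z, nC (Q w j z / Q w I z - Q (cplx a) j z / Q (cplx a) I z) < e by near: s.
    by move=> j w ws; apply: h => // i; exact: lt_trans (ws i) sr.
(* As [x / 0 = 0], the case [j = I] keeps [Q w I z] away from [0]. *)
have QI0 w z : cdisc (cplx a) s w -> Q w I z != 0.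
  move=> ws; apply: contraTneq (H I w ws z) => ->.
  rewrite invr0 mulr0 Qa divff ?sub0r ?nCN ?nC1 -?leNgt ?ltW//.
  by rewrite -nC_eq0 nC_real normr_eq0 gt_eqF.
near=> rho => j z.
have rD : forall x, pdisc a rho x -> D x by near: rho; exact: near_open.
have rho0 : 0 < rho by near: rho; exact: nbhs_right_gt.
have rhos : rho <= s / 32 by near: rho; apply: nbhs_right_le; rewrite divr_gt0.
pose k := q a j z / q a I z.
have k0 : 0 < k by rewrite divr_gt0.
have H1 : An a rho (fun t => q t j z / q t I z - k) (e * 2 ^+ m).
  apply: (@An_of_cana _ _ (fun w => Q w j z / Q w I z - Q (cplx a) j z / Q (cplx a) I z) _ s).
  - by rewrite rho0.
  - move=> w ws; apply: cana_sub; apply: cana_mul.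
      by apply: (extends_cana r0 QE) => i; exact: lt_trans (ws i) sr.
    apply: cana_inv; last exact: QI0.
    by apply: (extends_cana r0 QE) => i; exact: lt_trans (ws i) sr.
  - by move=> w ws; apply/ltW/H.
  - move=> x xr; have rr : rho < r by lra.
    rewrite !(extends_real rr r0 rD QE xr) !Qa /k.
    by rewrite -!fmorphV -!rmorphM -rmorphB.
have := AnZ k^-1 H1 => H2; apply: (@An_le _ _ _ _ _ (`|k^-1| * (e * 2 ^+ m))).
  rewrite ger0_norm ?invr_ge0 ?(ltW k0)// mulrC ler_pdivrMr//.
  apply: (@le_trans _ _ (C' * d)).
    by rewrite -ler_pdivlMr ?exprn_gt0// ge_min lexx.
  by rewrite mulrC ler_wpM2l ?(ltW d0)// qC.
by apply: An_ext H2 => x _; rewrite -/k; move: (_ / _) => y; field; rewrite gt_eqF.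
Unshelve. all: by end_near. Qed.

(** The majorant is the density at the centre, of mass 1, plus [rho / s] times an integrable norm
    [N] on a fixed radius [s], by [An_small]. Its mass tends to 1 with [rho]; this lets [kappa]
    approach 1. *)
Lemma near_density (r d : R) (Q : 'rV[Cplx R]_m -> 'I_l -> R -> Cplx R) :
  0 < r -> 0 < d -> extends Q r -> leb.-integrable [set: rT] (q_breve Q a r) ->
  \forall rho \near 0^'+, exists b : 'I_l -> R -> R,
    [/\ forall i, measurable_fun [set: rT] (b i), forall i z, An a rho (fun t => q t i z) (b i z) &
      forall i, (\int[leb]_z (b i z)%:E <= (1 + d)%:E)%E].
Proof.
move=> r0 d0 QE iQ.
have [s [s0 sr sD]] : exists s, [/\ 0 < s, s <= r / 32 & forall x, pdisc a s x -> D x].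
  near (0 : R)^'+ => s; exists s; split.
  - by near: s; exact: nbhs_right_gt.
  - by near: s; apply: nbhs_right_le; rewrite divr_gt0.
  - by near: s; exact: near_open.
have sr' : s < r by lra.
have NE i : exists N : R -> R, [/\ measurable_fun [set: rT] N,
    forall z, An a s (fun t => q t i z) (N z) & rintegrable leb N].
  apply: (@integrable_family _ _ (fun z w => Q w i z) _ (q_breve Q a r) _ r).
  - by rewrite s0.
  - move=> z w; exact: extends_cana.
  - move=> z w wr; apply: ereal_sup_ubound; exists (i, w) => //; split=> //=.
    exact/Cball_cdisc.
  - by move=> z x xs; exact: (extends_real sr' r0 sD QE xs).
  - by move=> x xs; have [] := qD (sD x xs) i.
  - have /integrableP[mQ] := iQ; apply: le_lt_trans; apply: ge0_le_integral => //.
    + move=> z _; apply: (@le_trans _ _ (nC (Q (cplx a) i z))%:E); first by rewrite lee_fin nC_ge0.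
      apply: ereal_sup_ubound; exists (i, cplx a) => //; split=> //=.
      by apply/(Cball_cdisc a (cplx a) r0) => k; rewrite subrr nC0.
    + exact: measurableT_comp.
    + by move=> z _; exact: lee_abs.
have [N NP] := choice NE.
have N0 i z : 0 <= N i z by have [_ h _] := NP i; exact: An_ge0 (ltW s0) (h z).
pose J := \sum_i \int[leb]_z N i z.
have J0 i : 0 <= \int[leb]_z N i z by exact: Rintegral_ge0.
have JN i : \int[leb]_z N i z <= J by rewrite /J (bigD1 i)//= lerDl sumr_ge0.
have J1 : 0 < J + 1 by rewrite ltr_wpDl// sumr_ge0.
near=> rho.
have rho0 : 0 < rho by near: rho; exact: nbhs_right_gt.
have rhos : rho <= s by near: rho; exact: nbhs_right_le.
have rhod : rho <= d * s / (J + 1) by near: rho; apply: nbhs_right_le; rewrite divr_gt0// mulr_gt0.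
have rs : 0 <= rho <= s by rewrite (ltW rho0).
have c0 : 0 <= rho / s by rewrite divr_ge0 ?ltW.
exists (fun i z => q a i z + rho / s * N i z); split.
- move=> i; have [mN _ _] := NP i; have [mq _ _] := qD Da i.
  by apply: measurable_funD => //; exact: measurable_funM.
- move=> i z; have [_ h _] := NP i.
  have := AnD (ltW rho0) (@An_cst R m a rho (q a i z) (ltW rho0)) (An_small s0 rs (h z)).
  rewrite (ger0_norm (ltW (qa0 i z))); apply: An_ext => x _; ring.
- move=> i; have [mN _ iN] := NP i; have [mq _ q1] := qD Da i.
  have iN2 := rintegrableZl (rho / s) iN.
  under eq_integral => z _ do rewrite EFinD.
  rewrite ge0_integralD//; last 4 first.
  + by move=> z _; rewrite lee_fin ltW.
  + exact/measurable_EFinP.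
  + by move=> z _; rewrite lee_fin mulr_ge0.
  + by apply/measurable_EFinP; exact: measurable_funM.
  rewrite q1 EFinD leeD2l//.
  have -> : (\int[leb]_z (rho / s * N i z)%:E = (rho / s * \int[leb]_z N i z)%:E)%E.
    rewrite -RintegralZl// /Rintegral fineK//; exact: integrable_fin_num iN2.
  rewrite lee_fin mulrAC ler_pdivrMr//; rewrite ler_pdivlMr// in rhod.
  by apply: le_trans rhod; rewrite ler_wpM2l ?(ltW rho0)// (le_trans (JN i))// lerDl.
Unshelve. all: by end_near. Qed.

Lemma near_entropy_density (r : R) I (Q : 'rV[Cplx R]_m -> 'I_l -> R -> Cplx R)
    (L : 'rV[Cplx R]_m -> R -> Cplx R) :
  0 < r -> extends Q r ->
  (forall z, analytic_extension [set t | D t /\ 0 < q t I z] (fun t => ln (q t I z)) a r (fun t => L t z)) ->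
  (forall j, (\int[leb]_(z in [set: rT])
     ereal_sup [set (ComplexField.Normc.normc (Q t j z * L t z))%:E | t in Cball a r] < +oo)%E) ->
  (\forall rho \near 0^'+, forall x, pdisc a rho x -> forall i z, 0 < q x i z) ->
  \forall rho \near 0^'+, exists b : 'I_l -> R -> R,
    (forall i z, An a rho (fun t => q t i z * ln (q t I z)) (b i z)) /\
    (forall i, rintegrable leb (b i)).
Proof.
move=> r0 QE LE iQ pos; near=> s.
have s0 : 0 < s by near: s; exact: nbhs_right_gt.
have sr : s <= r / 32 by near: s; apply: nbhs_right_le; rewrite divr_gt0.
have sD : forall x, pdisc a s x -> D x by near: s; exact: near_open.
have sq : forall x, pdisc a s x -> forall i z, 0 < q x i z by near: s.
have sr' : s < r by lra.
have NE i : exists N : R -> R, [/\ measurable_fun [set: rT] N,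
    forall z, An a s (fun t => q t i z * ln (q t I z)) (N z) & rintegrable leb N].
  apply: (@integrable_family _ _ (fun z w => Q w i z * L w z) _ _ _ r _ _ _ _ _ _ (iQ i)).
  - by rewrite s0.
  - move=> z w wr; apply: cana_mul; first exact: (extends_cana r0 QE).
    by apply: analytic_cana; apply: (LE z).1; exact/Cball_cdisc.
  - move=> z w wr; apply: ereal_sup_ubound; exists w => //; exact/Cball_cdisc.
  - move=> z x xs; rewrite (extends_real sr' r0 sD QE xs) rmorphM; congr (_ * _).
    apply: (LE z).2; first by split; [exact: sD|exact: sq].
    by apply/(Cball_cdisc a (cplx x) r0); exact: pdisc_cdisc sr' xs.
  - move=> x xs; have [mi _ _] := qD (sD x xs) i; have [mI _ _] := qD (sD x xs) I.
    by apply: measurable_funM => //; exact: (measurableT_comp (@measurable_ln R)).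
have [N NP] := choice NE; exists N.
by split=> [i z|i]; have [_ h1 h2] := NP i.
Unshelve. all: by end_near. Qed.

End channel_hypotheses.

Section blocks.
Variables (R : realType) (n1 n2 : nat) (a : 'rV[R]_n1) (b : 'rV[R]_n2).
Implicit Types rho B : R.

Lemma An_lsubmx rho B f : 0 < rho -> An a rho f B ->
  An (row_mx a b) rho (fun x => f (lsubmx x)) B.
Proof.
move=> r0 fB; apply: (An_comp r0 r0 fB) => i.
have := An_coord (row_mx a b) (lshift n2 i) (ltW r0); apply: An_ext => x _.
by rewrite row_mxEl mxE.
Qed.

Lemma An_rsubmx rho B f : 0 < rho -> An b rho f B ->
  An (row_mx a b) rho (fun x => f (rsubmx x)) B.
Proof.
move=> r0 fB; apply: (An_comp r0 r0 fB) => i.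
have := An_coord (row_mx a b) (rshift n1 i) (ltW r0); apply: An_ext => x _.
by rewrite row_mxEr mxE.
Qed.

Lemma pdisc_lsubmx rho x : pdisc (row_mx a b) rho x -> pdisc a rho (lsubmx x).
Proof. by move=> xr i; have := xr (lshift n2 i); rewrite row_mxEl mxE. Qed.

Lemma pdisc_rsubmx rho x : pdisc (row_mx a b) rho x -> pdisc b rho (rsubmx x).
Proof. by move=> xr i; have := xr (rshift n1 i); rewrite row_mxEr mxE. Qed.

End blocks.

Lemma An_gt0 (R : realType) m (x0 : 'rV[R]_m) (rho d : R) (f : 'rV[R]_m -> R) x : 0 <= rho -> d < 1 -> 0 < f x0 ->
  An x0 rho (fun x => f x / f x0 - 1) d -> pdisc x0 rho x -> 0 < f x.
Proof.
move=> r0 d1 f0 fA xr; have := An_bound r0 fA xr; rewrite ler_norml => /andP[h _].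
by rewrite -(pmulr_lgt0 _ (_ : 0 < (f x0)^-1)) ?invr_gt0//; lra.
Qed.

(** * Choice of the constants and of the radius *)

Section entropy_rate.
Variables (R : realType) (l n1 n2 : nat).
Variables (Omega1 : set 'rV[R]_n1) (Omega2 : set 'rV[R]_n2).
Variables (Pi : 'rV[R]_n1 -> 'M[R]_l) (pi_ : 'rV[R]_n1 -> 'rV[R]_l).
Variables (q : 'rV[R]_n2 -> 'I_l -> R -> R) (e0 : 'rV[R]_n1) (t0 : 'rV[R]_n2).
Local Notation leb := (@lebesgue_measure R).
Hypothesis oO1 : open Omega1.
Hypothesis oO2 : open Omega2.
Hypothesis PiS : forall e, Omega1 e -> stochastic_mx (Pi e).
Hypothesis PiA : forall i j, analytic_at (fun e => Pi e i j) e0.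
Hypothesis piS : forall e, Omega1 e -> stationary_vector (Pi e) (pi_ e).
Hypothesis qD : forall t, Omega2 t -> forall y, probability_density (q t y).
Hypothesis Oe0 : Omega1 e0.
Hypothesis Ot0 : Omega2 t0.
Hypothesis Pi0 : forall i j, 0 < Pi e0 i j.
Hypothesis q0 : forall y z, 0 < q t0 y z.
Variables (I : 'I_l) (C' C'' : R).
Hypothesis C'0 : 0 < C'.
Hypothesis ratio_bounds : forall j z, C' <= q t0 j z / q t0 I z <= C''.
Hypothesis ratio_near : forall d : R, 0 < d -> \forall rho \near 0^'+, forall j z,
  An t0 rho (fun t => q t j z / q t I z / (q t0 j z / q t0 I z) - 1) d.
Hypothesis density_near : forall d : R, 0 < d -> \forall rho \near 0^'+, exists b : 'I_l -> R -> R,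
  [/\ forall i, measurable_fun [set: measurableTypeR R] (b i),
      forall i z, An t0 rho (fun t => q t i z) (b i z) &
      forall i, (\int[leb]_z (b i z)%:E <= (1 + d)%:E)%E].
Hypothesis entropy_near :
  (\forall rho \near 0^'+, forall x, pdisc t0 rho x -> forall i z, 0 < q x i z) ->
  \forall rho \near 0^'+, exists b : 'I_l -> R -> R,
    (forall i z, An t0 rho (fun t => q t i z * ln (q t I z)) (b i z)) /\
    (forall i, rintegrable leb (b i)).

(** One radius works for all [z] because the ratio to [q x I z] stays within a factor of its
    positive central value. A nonzero quotient has a nonzero numerator, and densities are
    nonnegative. *)
Lemma near_channel_gt0 : \forall rho \near 0^'+, forall x, pdisc t0 rho x -> forall i z, 0 < q x i z.
Proof.
near=> rho => x xr i z.
have rho0 : 0 < rho by near: rho; exact: nbhs_right_gt.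
have xO : Omega2 x by apply: (near (near_open oO2 Ot0) rho).
have h : forall j z, An t0 rho (fun t => q t j z / q t I z / (q t0 j z / q t0 I z) - 1) 2^-1.
  by near: rho; apply: ratio_near; rewrite invr_gt0.
have : 0 < q x i z / q x I z.
  have d1 : 2^-1 < 1 :> R by rewrite invf_lt1// ltr1n.
  have k0 : 0 < q t0 i z / q t0 I z by rewrite divr_gt0.
  exact: (An_gt0 (ltW rho0) d1 k0 (h i z) xr).
have [_ qx _] := qD xO i; rewrite lt0r => /andP[]; rewrite mulf_eq0 negb_or => /andP[qi _] _.
by rewrite lt0r qi qx.
Unshelve. all: by end_near. Qed.

Lemma entropy_rate_An : exists rho H B, [/\ 0 < rho, An (row_mx e0 t0) rho H B &
  forall x, pdisc (row_mx e0 t0) rho x ->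
    mean_entropy (pi_ (lsubmx x)) (Pi (lsubmx x)) (q (rsubmx x)) @ \oo --> (H x)%:E].
Proof.
have [a [a0 aP]] : exists a, 0 < a /\ forall i j, a <= Pi e0 i j.
  near (0 : R)^'+ => a; exists a; split; first by near: a; exact: nbhs_right_gt.
  near: a; apply: near_right0_fin => i; apply: near_right0_fin => j; exact: nbhs_right_le.
have l0 : 0 < l%:R :> R by rewrite ltr0n; case: (l) I => // -[].
have P1 i j : Pi e0 i j <= 1.
  by have [P0 /(_ i) <-] := PiS Oe0; rewrite (bigD1 j)//= lerDl sumr_ge0.
have a1 : a <= 1 by exact: le_trans (aP I I) (P1 I I).
(* Bounds for the entries of [trans] at the centre: transition probabilities lie between [a] and
   1. *)
pose mu1 := C' * a; pose mu2 := C''.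
have mu10 : 0 < mu1 by rewrite mulr_gt0.
have C''0 : 0 < C'' by have /andP[h1 h2] := ratio_bounds I 0; exact: lt_le_trans (le_trans h1 h2).
have Mb z i j : mu1 <= q t0 i z / q t0 I z * Pi e0 i j <= mu2.
  have /andP[h1 h2] := ratio_bounds i z; apply/andP; split.
    exact: ler_pM (ltW C'0) (ltW a0) h1 (aP i j).
  have r0 := le_trans (ltW C'0) h1; have p0 := ltW (Pi0 i j).
  by rewrite -[mu2]mulr1; exact: ler_pM r0 p0 h2 (P1 i j).
have mu12 : mu1 <= mu2 by have /andP[h1 h2] := Mb 0 I I; exact: le_trans h2.
have mu20 : 0 < mu2 by [].
pose k := doeblin l mu1 mu2.
have k0 : 0 < k ^+ 2 by rewrite exprn_gt0// divr_gt0// exprn_gt0// divr_gt0.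
have K0 : 0 < 82 * l%:R * mu2 by rewrite !mulr_gt0.
have [eta [eta0 etak eta_drift]] : exists eta, [/\ 0 < eta, 20 * eta <= k ^+ 2 &
    82 * l%:R * mu2 * eta <= mu1 * k ^+ 2].
  near (0 : R)^'+ => eta; exists eta; split; first by near: eta; exact: nbhs_right_gt.
    rewrite mulrC -ler_pdivlMr//; near: eta; apply: nbhs_right_le; exact: divr_gt0.
  rewrite mulrC -ler_pdivlMr//; near: eta; apply: nbhs_right_le.
  by rewrite divr_gt0// mulr_gt0.
pose G := gamma l mu1 mu2.
have /andP[G0 G1] : 0 < G < 1 := gamma_range I mu10 mu12.
(* [4 * d <= a ^+ 2] is for the stationary vector. [4 * d <= 1 - G] gives
   [(1 + d) * (1 + d) * G < 1]. [3 * d <= eta ^+ 2] covers [d + d + d * d], the relative error of an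
   entry that is a product of two factors. *)
have [d [d0 d1 da dG deta]] : exists d, [/\ 0 < d, d <= 2^-1, 4 * d <= a ^+ 2,
    4 * d <= 1 - G & 3 * d <= eta ^+ 2].
  near (0 : R)^'+ => d; exists d; split.
  - by near: d; exact: nbhs_right_gt.
  - by near: d; apply: nbhs_right_le; rewrite invr_gt0.
  - by rewrite mulrC -ler_pdivlMr//; near: d; apply: nbhs_right_le; rewrite divr_gt0 ?exprn_gt0.
  - by rewrite mulrC -ler_pdivlMr//; near: d; apply: nbhs_right_le; rewrite divr_gt0 ?subr_gt0.
  - by rewrite mulrC -ler_pdivlMr//; near: d; apply: nbhs_right_le; rewrite divr_gt0 ?exprn_gt0.
near (0 : R)^'+ => rho.
have rho0 : 0 < rho by near: rho; exact: nbhs_right_gt.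
have O1 x : pdisc e0 rho x -> Omega1 x by apply: (near (near_open oO1 Oe0) rho).
have O2 x : pdisc t0 rho x -> Omega2 x by apply: (near (near_open oO2 Ot0) rho).
have qpos x : pdisc t0 rho x -> forall i z, 0 < q x i z by apply: (near near_channel_gt0 rho).
have qr j z : An t0 rho (fun t => q t j z / q t I z / (q t0 j z / q t0 I z) - 1) d.
  by apply: (near (ratio_near d0) rho).
have [b [mb qb bc]] : exists b : 'I_l -> R -> R,
  [/\ forall i, measurable_fun [set: measurableTypeR R] (b i),
      forall i z, An t0 rho (fun t => q t i z) (b i z) &
      forall i, (\int[leb]_z (b i z)%:E <= (1 + d)%:E)%E].
  by apply: (near (density_near d0) rho).
have [bL [qL ibL]] : exists b : 'I_l -> R -> R,
    (forall i z, An t0 rho (fun t => q t i z * ln (q t I z)) (b i z)) /\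
    (forall i, rintegrable leb (b i)).
  by apply: (near (entropy_near near_channel_gt0) rho).
have Pr i j : An e0 rho (fun e => Pi e i j / Pi e0 i j - 1) d.
  have h : forall i j, An e0 rho (fun e => Pi e i j / Pi e0 i j - 1) d.
    near: rho; apply: near_right0_fin => i'; apply: near_right0_fin => j'.
    exact: near_An_small (PiA i' j') _.
  exact: h.
have r0 := ltW rho0.
have d11 : d < 1 by lra.
have Ppos x i j : pdisc e0 rho x -> 0 < Pi x i j.
  exact: (@An_gt0 _ _ e0 rho d (fun e => Pi e i j)).
have vV j : An e0 rho (fun e => pi_ e ord0 j) (1 + 4 / (1 - (1 - a ^+ 2 / 2))).
  apply: (An_stationary rho0 I (P := fun i j e => Pi e i j) (v := fun j e => pi_ e ord0 j)
    a0 aP _ _ _ _ da (ltW d11) Pr).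
  - by move=> x i xr; have [_] := PiS (O1 _ xr).
  - by move=> x i xr; have [] := piS (O1 _ xr).
  - by move=> x xr; have [] := piS (O1 _ xr).
  - by move=> x i xr; have [_ _ {2}<-] := piS (O1 _ xr); rewrite mxE.
have PN i j : An e0 rho (fun e => Pi e i j) (Pi e0 i j * (1 + d)).
  have := AnZ (Pi e0 i j) (AnD r0 (@An_cst R n1 e0 rho 1 r0) (Pr i j)).
  rewrite normr1 (ger0_norm (ltW (Pi0 i j))); apply: An_ext => x _.
  by field; rewrite gt_eqF.
have qrB : forall z i j, An (row_mx e0 t0) rho (fun x =>
    trans I (fun x => Pi (lsubmx x)) (fun x => q (rsubmx x)) z i j x /
    trans I (fun x => Pi (lsubmx x)) (fun x => q (rsubmx x)) z i j (row_mx e0 t0) - 1) (eta ^+ 2).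
  move=> z i j.
  have A1 := An_rsubmx e0 rho0 (qr i z); have A2 := An_lsubmx t0 rho0 (Pr i j).
  have A3 := AnD r0 (AnD r0 A1 A2) (AnM r0 A1 A2).
  apply: (@An_le _ _ _ _ _ (d + d + d * d)); first by nra.
  apply: An_ext A3 => x _; rewrite /trans row_mxKl row_mxKr.
  have h1 := q0 i z; have h2 := q0 I z; have h3 := Pi0 i j.
  move: (q (rsubmx x) i z / q (rsubmx x) I z) => y.
  by field; rewrite !gt_eqF.
pose x0 := row_mx e0 t0.
have Mb' z i j : mu1 <= trans I (fun x => Pi (lsubmx x)) (fun x => q (rsubmx x)) z i j x0 <= mu2.
  by rewrite /trans row_mxKl row_mxKr.
have ck i : (1 + d) * \sum_j Pi e0 i j * (1 + d) <= (1 + d) * (1 + d).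
  by rewrite -mulr_suml; have [_ ->] := PiS Oe0; rewrite mul1r.
have kG : (1 + d) * (1 + d) * gamma l mu1 mu2 < 1 by rewrite -/G; nra.
have [H [B [HB HE]]] := An_entropy rho0
  (fun x i j xr => Ppos (lsubmx x) i j (pdisc_lsubmx xr))
  (fun x xr => PiS (O1 _ (pdisc_lsubmx xr))) (fun x xr => piS (O1 _ (pdisc_lsubmx xr)))
  (fun x i z xr => qpos (rsubmx x) (pdisc_rsubmx xr) i z)
  (fun x i xr => qD (O2 _ (pdisc_rsubmx xr)) i)
  mu10 mu12 Mb' eta0 etak eta_drift qrB
  (fun i j => An_lsubmx t0 rho0 (PN i j)) (fun i => An_lsubmx t0 rho0 (vV i))
  (fun i z => An_rsubmx e0 rho0 (qb i z)) mb bc ck kG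
  (fun i z => An_rsubmx e0 rho0 (qL i z)) ibL.
by exists rho, H, B.
Unshelve. all: by end_near. Qed.

End entropy_rate.

Theorem theorem1p2 (R : realType) (l m1 m2 : nat)
  (Omega1 : set 'rV[R]_m1) (Omega2 : set 'rV[R]_m2)
  (Pi : 'rV[R]_m1 -> 'M[R]_l) (pi_ : 'rV[R]_m1 -> 'rV[R]_l)
  (q : 'rV[R]_m2 -> 'I_l -> R -> R)
  (eps0 : 'rV[R]_m1) (theta0 : 'rV[R]_m2)
  (* standing assumptions *)
  (dom1 : bounded_domain Omega1) (dom2 : bounded_domain Omega2)
  (PiS : forall eps, Omega1 eps -> stochastic_mx (Pi eps))
  (PiA : forall eps, Omega1 eps ->
     forall i j, analytic_at (fun e => Pi e i j) eps)
  (piS : forall eps, Omega1 eps -> stationary_vector (Pi eps) (pi_ eps))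
  (qD : forall theta, Omega2 theta -> forall y, probability_density (q theta y))
  (qA : forall theta, Omega2 theta ->
     forall y z, analytic_at (fun t => q t y z) theta)
  (eps0P : Omega1 eps0) (theta0P : Omega2 theta0)
  (* (a) *)
  (ha : forall i j, 0 < Pi eps0 i j)
  (* (b) *)
  (hb : forall y z, 0 < q theta0 y z)
  (* (c) *)
  (hc : exists2 r2 : R, 0 < r2 &
     exists Q : 'rV[Cplx R]_m2 -> 'I_l -> R -> Cplx R,
     [/\ forall y z, analytic_extension Omega2 (fun t => q t y z) theta0 r2
                       (fun t => Q t y z),
         forall y, {within [set zt : R * 'rV[Cplx R]_m2 | Cball theta0 r2 zt.2],
                     continuous (fun zt => Q zt.2 y zt.1)} &
       [/\ lebesgue_measure.-integrable [set: measurableTypeR R]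
             (q_breve Q theta0 r2),
           lebesgue_measure.-integrable [set: measurableTypeR R]
             (fun z => q_breve Q theta0 r2 z * lne (q_hat Q theta0 r2 z))%E &
           lebesgue_measure.-integrable [set: measurableTypeR R]
             (fun z => q_breve Q theta0 r2 z * lne (q_breve Q theta0 r2 z))%E]])
  (* (d) *)
  (hd : exists I : 'I_l,
     (exists2 r2 : R, 0 < r2 &
        exists Q : 'rV[Cplx R]_m2 -> 'I_l -> R -> Cplx R,
        (forall y z, analytic_extension Omega2 (fun t => q t y z) theta0 r2
                       (fun t => Q t y z)) /\
        (forall j : 'I_l,
           equicontinuous [set: R]
             (fun z : R => (fun t => Q t j z / Q t I z)
                : subspace (Cball theta0 r2) -> Cplx R))) /\
     (exists2 r2 : R, 0 < r2 &
        exists (Q : 'rV[Cplx R]_m2 -> 'I_l -> R -> Cplx R)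
               (L : 'rV[Cplx R]_m2 -> R -> Cplx R),
        [/\ forall y z, analytic_extension Omega2 (fun t => q t y z) theta0 r2
                          (fun t => Q t y z),
            forall z, analytic_extension
                        [set t | Omega2 t /\ 0 < q t I z]
                        (fun t => ln (q t I z)) theta0 r2 (fun t => L t z) &
            forall j : 'I_l,
              (\int[lebesgue_measure]_(z in [set: measurableTypeR R])
                 ereal_sup [set (ComplexField.Normc.normc (Q t j z * L t z))%:E
                           | t in Cball theta0 r2] < +oo)%E]))
  (* bounded ratios at theta0 *)
  (hr : exists C' C'' : R, [/\ 0 < C', 0 < C'' &
     forall i j z, C' <= `|q theta0 j z / q theta0 i z| <= C'']) :
  (* conclusion *)
  \forall x \near row_mx eps0 theta0,
    let H := fun x : 'rV[R]_(m1 + m2) =>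
      entropy_rate (pi_ (lsubmx x)) (Pi (lsubmx x)) (q (rsubmx x)) in
    [/\ cvgn (mean_entropy (pi_ (lsubmx x)) (Pi (lsubmx x)) (q (rsubmx x))),
        H x \is a fin_num &
        analytic_at (fun x' => fine (H x')) x].
Proof.
have [oO1 _ _] := dom1; have [oO2 _ _] := dom2.
(* The extensions [Qc], [Qe] and [Ql] have their own radii and are never compared: each yields
   bounds for series of real functions, and these meet on one small real polydisc. *)
have [r3 r30 [Qc [QcE _ [iq _ _]]]] := hc.
have [I [[r4 r40 [Qe [QeE Qeq]]] [r5 r50 [Ql [L [QlE LE iL]]]]]] := hd.
have [C' [C'' [C'0 C''0 ratio]]] := hr.
have ratio_pos j z : C' <= q theta0 j z / q theta0 I z <= C''.
  by have := ratio I j z; rewrite ger0_norm// ltW// divr_gt0.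
have [rho [h [B [rho0 hB hlim]]]] := entropy_rate_An oO1 oO2 PiS (PiA _ eps0P) piS qD eps0P theta0P
  ha hb C'0 ratio_pos
  (fun d d0 => near_ratio oO2 theta0P hb r40 C'0 d0 QeE Qeq
     (fun j z => proj1 (andP (ratio_pos j z))))
  (fun d d0 => near_density oO2 theta0P qD hb r30 d0 QcE iq)
  (near_entropy_density oO2 theta0P qD r50 QlE LE iL).
have disc x : `|row_mx eps0 theta0 - x| < rho -> pdisc (row_mx eps0 theta0) rho x.
  move=> xr i; rewrite distrC; apply: ltW; apply: le_lt_trans xr.
  by have := rV_entry_le (row_mx eps0 theta0 - x) i; rewrite !mxE.
pose H (y : 'rV[R]_(m1 + m2)) :=
  entropy_rate (pi_ (lsubmx y)) (Pi (lsubmx y)) (q (rsubmx y)).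
have HE y : pdisc (row_mx eps0 theta0) rho y -> H y = (h y)%:E.
  by move=> yr; apply: cvg_lim => //; exact: hlim.
apply/nbhs_normP; exists rho => // x xr; split.
- by apply/cvg_ex; exists (h x)%:E; exact/hlim/disc.
- by rewrite -/(H x) (HE _ (disc _ xr)).
- apply: (An_analytic_at (f := fun y => fine (H y)) _ xr).
  by apply: An_ext hB => y yr; rewrite HE.
Qed.
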